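(* Let $P$ be an almost simple $n$-dimensional lattice polytope in $\mathbb{R}^n$, let $X$ be the toric variety associated with the normal fan of $P$, with compact torus $T^n$ acting and orbit map $\pi\colon X\to P$. A retraction sequence $(P_1,Q_1,v_1)\to\cdots\to(P_\ell,Q_\ell,v_\ell)$ of $P$ yields a $T^n$-equivariant stratification $$X_1\subseteq X_2\subseteq\cdots\subseteq X_\ell=X$$ such that, for $j=2,\dots,\ell$, the quotient $X_j/X_{j-1}$ is homeomorphic to the Thom space $\mathrm{Th}(\xi^{A_j})$ of a simple orbifold $T^n$-bundle $$\xi^{A_j}\colon\mathbb{C}^{k_j}/A_j\to\pi^{-1}(v_{\ell-j+1})$$ for some $k_j\in\mathbb{N}$ and some finite abelian group $A_j$, where $v_i$ denotes the free vertex of $P_i$ used to define $P_{i+1}$, for $i=1,\dots,\ell-1$.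
   Context: Toric variety model: let $\Sigma$ be a full dimensional rational polytopal fan in $\mathbb{R}^n$ and $P$ a lattice polytope whose normal fan is $\Sigma$; identify $\mathbb{R}^n$ with the Lie algebra of the compact torus $T^n\subset(\mathbb{C}^\ast)^n$. The toric variety $X=X_\Sigma$ is $T^n$-equivariantly homeomorphic to $(T^n\times P)/{\sim}$, where $(t,p)\sim(s,q)$ iff $p=q$ and $t^{-1}s\in T_{F(p)}$, with $T_{F(p)}\subseteq T^n$ the subtorus whose Lie algebra is generated by the outward normal vectors of the codimension-1 faces of $P$ containing $p$ (trivial if $p$ is interior). $T^n$ acts on the first factor and the orbit map is $\pi([t,p])=p$. Retraction sequence: regard the $n$-dimensional convex polytope $P$ as the polytopal complex of all its faces; $V(Q)$ is the vertex set of a face $Q$ and $\ell=|V(P)|$. Consider triples $(P_j,Q_j,v_j)$ with $P_j$ a polytopal subcomplex of $P$, $Q_j$ a face of $P_j$, $v_j$ a vertex of $Q_j$, defined inductively: $P_1=Q_1=P$ and $v_1$ is a vertex of $P$ having a neighborhood homeomorphic to $\mathbb{R}^n_{\ge}$ as manifold with corners. Given $(P_j,Q_j,v_j)$, set $P_{j+1}=\bigcup\{Q\in P_j\mid v_j\notin V(Q)\}$; choose a vertex $v_{j+1}$ of $P_{j+1}$ having a neighborhood in $P_{j+1}$ homeomorphic to $\mathbb{R}^d_{\ge}$ as manifold with corners for some $1\le d\le n$ (a free vertex of $P_{j+1}$), if one exists, and let $Q_{j+1}$ be the unique maximal face of $P_{j+1}$ containing $v_{j+1}$. The sequence is a retraction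 sequence of $P$ if it ends with $(P_\ell,Q_\ell,v_\ell)$ where $P_\ell=Q_\ell=v_\ell$ is a vertex of $P$. $P$ is almost simple if it admits at least one retraction sequence. Simple orbifold $T^n$-bundle: given a complex $T^n$-vector bundle $V\to B$ and a finite group $A$ acting linearly on each fiber and commuting with the $T^n$-action (preserving the orientation in the cohomology theory under consideration), the induced bundle $V/A\to B$. Its Thom space is $D(V/A)/S(V/A)$ with $D(V/A)=D(V)/A$, $S(V/A)=S(V)/A$. *)

(* Defs.v *)
From HB Require Import structures.
From mathcomp Require Import all_fingroup.
From mathcomp Require Import all_boot all_order all_algebra.
From mathcomp Require Import all_classical all_reals all_analysis.
From mathcomp Require Import complex.

Set Implicit Arguments.
Unset Strict Implicit.
Unset Printing Implicit Defensive.

Import Order.TTheory GRing.Theory Num.Theory.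
Import numFieldNormedType.Exports.

Local Open Scope classical_set_scope.
Local Open Scope ring_scope.
Local Open Scope quotient_scope.

Definition homeomorphic (X Y : topologicalType) :=
  exists (f : X -> Y) (g : Y -> X),
    [/\ continuous f, continuous g, cancel f g & cancel g f].

Section collapse.
Variables (Y : topologicalType) (A : set Y).

Definition collapse_rel (x y : Y) : bool := `[< x = y \/ A x /\ A y >].

Lemma collapse_rel_refl : reflexive collapse_rel.
Proof. by move=> x; apply/asboolP; left. Qed.

Lemma collapse_rel_sym : symmetric collapse_rel.
Proof. by move=> x y; apply/asboolP/asboolP => -[->|[]]; auto. Qed.

Lemma collapse_rel_trans : transitive collapse_rel.
Proof.
move=> y x z /asboolP xy /asboolP yz; apply/asboolP.
by case: xy yz => [->|[Ax Ay]] // [<-|[_ Az]]; right.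
Qed.

Canonical collapse_equiv :=
  EquivRel collapse_rel collapse_rel_refl collapse_rel_sym collapse_rel_trans.

(* [Y / A]; under this definition [Y / set0] is [Y], not [Y] with a disjoint
   base point. *)
Definition collapse : topologicalType :=
  quotient_topology {eq_quot collapse_equiv}.

End collapse.

(* [B / A], for [A `<=` B] *)
Definition subquotient (X : topologicalType) (B A : set X) : topologicalType :=
  @collapse (set_type B) (set_val @^-1` A).

Section polytopes.
Variables (R : realType) (n : nat).
Implicit Types (P Q F S : set 'rV[R]_n) (K : set (set 'rV[R]_n)).

Definition dotp (a x : 'rV[R]_n) : R := \sum_j a 0 j * x 0 j.

(* The affine hull of [S] has dimension at least [d]: the rows [(a, 1)], [a]
   ranging over the [d + 1] rows of [A], are linearly independent iff the rows
   of [A] are affinely independent. *)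
Definition adim_ge S (d : nat) :=
  exists A : 'M[R]_(d.+1, n),
    (forall i, S (row i A)) /\ row_free (row_mx A (const_mx 1 : 'cV[R]_d.+1)).

Definition has_dim S (d : nat) := adim_ge S d /\ ~ adim_ge S d.+1.

Definition lattice_polytope P :=
  exists (m : nat) (A : 'M[int]_(m, n)),
    P = [set x | exists c : 'rV[R]_m,
          [/\ forall i, 0 <= c 0 i, \sum_i c 0 i = 1
            & x = c *m map_mx intr A]].

Definition cut_by P F (a : 'rV[R]_n) (b : R) :=
  (forall x, P x -> dotp a x <= b) /\ F = P `&` [set x | dotp a x = b].

(* Nonempty faces only; [P] itself is a face (take [a = 0] and [b = 0]). *)
Definition face P F := F !=set0 /\ exists a b, cut_by P F a b.

Definition vertices P : set 'rV[R]_n := [set x | face P [set x]].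

(* A polytopal complex is represented by the set of its (nonempty) faces. *)
Definition faces P : set (set 'rV[R]_n) := [set F | face P F].

Definition underlying K : set 'rV[R]_n := \bigcup_(F in K) F.

Definition complex_vertices K : set 'rV[R]_n := \bigcup_(F in K) vertices F.

Definition corner d (I : {set 'I_d}) : set 'rV[R]_d :=
  [set x | (forall i, 0 <= x 0 i) /\ (forall i, i \in I -> x 0 i = 0)].

(* [v] has an open neighborhood [U] in the complex [K] that is homeomorphic to
   the orthant [corner set0] as a manifold with corners: the homeomorphism
   matches the faces of [K] meeting [U] with the faces of the orthant. *)
Definition corner_nbhd K (d : nat) (v : 'rV[R]_n) :=
  exists (W : set 'rV[R]_n) (f : 'rV[R]_n -> 'rV[R]_d)
         (g : 'rV[R]_d -> 'rV[R]_n),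
    let U := underlying K `&` W in
    [/\ open W /\ U v,
        {within U, continuous f} /\ {within corner finset.set0, continuous g},
        (forall x, U x -> corner finset.set0 (f x) /\ g (f x) = x) /\
        (forall y, corner finset.set0 y -> U (g y) /\ f (g y) = y),
        (forall F, K F -> F `&` U !=set0 ->
           exists I : {set 'I_d}, f @` (F `&` U) = corner I)
      & (forall I : {set 'I_d}, exists2 F, K F & f @` (F `&` U) = corner I)].

Definition free_vertex K (v : 'rV[R]_n) :=
  complex_vertices K v /\ exists d, (1 <= d <= n)%N /\ corner_nbhd K d v.

Definition unique_maximal_face K (v : 'rV[R]_n) Q :=
  [/\ K Q, Q v & forall F, K F -> F v -> F `<=` Q].

Definition remove_vertex K (v : 'rV[R]_n) : set (set 'rV[R]_n) :=
  [set F | K F /\ ~ vertices F v].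

(* The triples are indexed by [1, ..., l] as [(K j, Q j, v j)]; other indices
   are irrelevant. The last complex is a point, which has no free vertex since
   these have dimension at least 1; hence [j < l] below. *)
Definition retraction_sequence P (l : nat) (K : nat -> set (set 'rV[R]_n))
    (Q : nat -> set 'rV[R]_n) (v : nat -> 'rV[R]_n) :=
  [/\ (vertices P #= `I_l)%card,
      [/\ K 1%N = faces P, Q 1%N = P, vertices P (v 1%N)
        & corner_nbhd (K 1%N) n (v 1%N)],
      forall j, (1 <= j < l)%N -> K j.+1 = remove_vertex (K j) (v j),
      forall j, (2 <= j < l)%N ->
        free_vertex (K j) (v j) /\ unique_maximal_face (K j) (v j) (Q j)
    & [/\ vertices P (v l), K l = [set [set v l]] & Q l = [set v l]]].

Definition almost_simple P :=
  exists (l : nat) (K : nat -> set (set 'rV[R]_n)) (Q : nat -> set 'rV[R]_n)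
         (v : nat -> 'rV[R]_n), retraction_sequence P l K Q v.

Definition facet_normal P (p a : 'rV[R]_n) :=
  a != 0 /\ exists F b, [/\ cut_by P F a b, has_dim F n.-1 & F p].

End polytopes.

Section torus.
Variables (R : realType) (n : nat).

Definition torus : topologicalType :=
  set_type [set t : 'rV[R[i]^o]_n | forall j, `|t 0 j : R[i]| = 1].

Implicit Types t s : torus.

Definition tcoord t (j : 'I_n) : R[i] := set_val t 0 j.

Lemma norm_tcoord t j : `|tcoord t j| = 1.
Proof. by case: t => t /= tP; move/set_mem: (tP); apply. Qed.

Definition mk_torus (z : 'I_n -> R[i]) (hz : forall j, `|z j| = 1) : torus.
Proof.
refine (exist _ (\row_j (z j : R[i]^o)) _).
by apply/mem_set => j; rewrite mxE; exact: hz.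
Defined.

Lemma tcoord_mk z (hz : forall j, `|z j| = 1) j : tcoord (mk_torus hz) j = z j.
Proof. by rewrite /tcoord /= mxE. Qed.

Lemma torus_ext t s : (forall j, tcoord t j = tcoord s j) -> t = s.
Proof.
move=> ts; apply/val_inj/rowP => j; exact: ts.
Qed.

Lemma tone_subproof (j : 'I_n) : `|1 : R[i]| = 1.
Proof. exact: normr1. Qed.
Definition tone : torus := mk_torus tone_subproof.

Lemma tmul_subproof t s j : `|tcoord t j * tcoord s j| = 1.
Proof. by rewrite normrM !norm_tcoord mulr1. Qed.
Definition tmul t s : torus := mk_torus (tmul_subproof t s).

Lemma tinv_subproof t j : `|(tcoord t j)^-1| = 1.
Proof. by rewrite normfV norm_tcoord invr1. Qed.
Definition tinv t : torus := mk_torus (tinv_subproof t).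

Lemma texp_subproof (x : 'rV[R]_n) j :
  `|(cos (2 * pi * x 0 j) +i* sin (2 * pi * x 0 j))%C| = 1.
Proof. by rewrite normc_def /= cos2Dsin2 sqrtr1. Qed.

Definition texp (x : 'rV[R]_n) : torus := mk_torus (texp_subproof x).

Lemma tcoord_neq0 t j : tcoord t j != 0.
Proof. by rewrite -normr_gt0 norm_tcoord. Qed.

Lemma tmulA : associative tmul.
Proof. by move=> t s u; apply: torus_ext => j; rewrite !tcoord_mk mulrA. Qed.

Lemma tmulC : commutative tmul.
Proof. by move=> t s; apply: torus_ext => j; rewrite !tcoord_mk mulrC. Qed.

Lemma tmul1 : left_id tone tmul.
Proof. by move=> t; apply: torus_ext => j; rewrite !tcoord_mk mul1r. Qed.

Lemma tmulV : left_inverse tone tinv tmul.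
Proof.
by move=> t; apply: torus_ext => j; rewrite !tcoord_mk mulVf ?tcoord_neq0.
Qed.

Lemma tinvM t s : tinv (tmul t s) = tmul (tinv t) (tinv s).
Proof. by apply: torus_ext => j; rewrite !tcoord_mk invfM. Qed.

Lemma tinvK : involutive tinv.
Proof. by move=> t; apply: torus_ext => j; rewrite !tcoord_mk invrK. Qed.

Lemma texpD x y : texp (x + y) = tmul (texp x) (texp y).
Proof.
apply: torus_ext => j; rewrite !tcoord_mk mxE mulrDr cosD sinD.
by simpc; rewrite [X in _ = (_ +i* X)%C]addrC.
Qed.

Lemma texp0 : texp 0 = tone.
Proof.
by apply: torus_ext => j; rewrite !tcoord_mk mxE mulr0 cos0 sin0.
Qed.

Lemma texpN x : texp (- x) = tinv (texp x).
Proof.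
rewrite -[RHS]tmul1 -texp0 -(addNr x) texpD -tmulA [tmul (texp x) _]tmulC tmulV.
by rewrite tmulC tmul1.
Qed.

End torus.

Definition torus_action (R : realType) (n : nat) (X : topologicalType)
    (act : torus R n -> X -> X) :=
  [/\ continuous (fun tx : torus R n * X => act tx.1 tx.2),
      forall x, act (tone R n) x = x
    & forall t s x, act (tmul t s) x = act t (act s x)].

Section toric.
Variables (R : realType) (n : nat) (P : set 'rV[R]_n).

(* [(x <= A)%MS]: [x] is a linear combination of the rows of [A]. With [m = 0]
   this gives the trivial subtorus at the points lying on no facet. *)
Definition lie_isotropy (p : 'rV[R]_n) : set 'rV[R]_n :=
  [set x | exists (m : nat) (A : 'M[R]_(m, n)),
    (forall i, facet_normal P p (row i A)) /\ (x <= A)%MS].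

Definition isotropy (p : 'rV[R]_n) : set (torus R n) :=
  @texp R n @` lie_isotropy p.

Lemma isotropy1 p : isotropy p (tone R n).
Proof.
exists 0; last exact: texp0.
by exists 0%N, 0; split; [case | exact: sub0mx].
Qed.

Lemma isotropyM p t s : isotropy p t -> isotropy p s -> isotropy p (tmul t s).
Proof.
move=> [x [m [A [hA xA]]] <-] [y [k [B [hB yB]]] <-].
exists (x + y); last exact: texpD.
exists (m + k)%N, (col_mx A B); split.
  by move=> i; rewrite -(splitK i); case: (fintype.split i) => j;
    rewrite ?rowKu ?rowKd.
rewrite -addsmxE; apply: addmx_sub.
  by apply: submx_trans xA _; exact: addsmxSl.
by apply: submx_trans yB _; exact: addsmxSr.
Qed.

Lemma isotropyV p t : isotropy p t -> isotropy p (tinv t).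
Proof.
move=> [x [m [A [hA xA]]] <-]; exists (- x); last exact: texpN.
by exists m, A; split => //; rewrite eqmx_opp.
Qed.

Definition toric_rel (x y : torus R n * set_type P) : bool :=
  `[< x.2 = y.2 /\ isotropy (set_val x.2) (tmul (tinv x.1) y.1) >].

Lemma toric_rel_refl : reflexive toric_rel.
Proof. by move=> x; apply/asboolP; split=> //; rewrite tmulV; exact: isotropy1. Qed.

Lemma toric_rel_sym : symmetric toric_rel.
Proof.
suff H x y : toric_rel x y -> toric_rel y x by move=> x y; apply/idP/idP; exact: H.
move=> /asboolP[xy /isotropyV]; rewrite tinvM tinvK tmulC xy => h.
by apply/asboolP.
Qed.

Lemma toric_rel_trans : transitive toric_rel.
Proof.
move=> y x z /asboolP[xy h1] /asboolP[yz h2]; apply/asboolP.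
split; first by rewrite xy.
rewrite -xy in h2; have := isotropyM h1 h2; congr (isotropy _ _).
by rewrite -tmulA; congr tmul; rewrite tmulA [tmul y.1 _]tmulC tmulV tmul1.
Qed.

Canonical toric_equiv :=
  EquivRel toric_rel toric_rel_refl toric_rel_sym toric_rel_trans.

(* The complex toric variety of the normal fan of [P], up to equivariant
   homeomorphism. *)
Definition toric_variety : topologicalType :=
  quotient_topology {eq_quot toric_equiv}.

Definition toric_class (t : torus R n) (p : set_type P) : toric_variety :=
  \pi_({eq_quot toric_equiv}) (t, p).

(* On representatives: [act t [s, p] = [t s, p]] and [orbit_map [s, p] = p];
   see [toric_actE] and [orbit_mapE]. *)
Definition toric_act (t : torus R n) (x : toric_variety) : toric_variety :=
  let y := repr (x : {eq_quot toric_equiv}) in toric_class (tmul t y.1) y.2.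

Definition orbit_map (x : toric_variety) : 'rV[R]_n :=
  set_val (repr (x : {eq_quot toric_equiv})).2.

Lemma toric_repr t p :
  let y := repr (\pi_({eq_quot toric_equiv}) (t, p)) in
  y.2 = p /\ isotropy (set_val p) (tmul (tinv y.1) t).
Proof.
rewrite /=; set y := repr _.
have : y = (t, p) %[mod {eq_quot toric_equiv}] by rewrite reprK.
by move=> /eqmodP /asboolP /= [-> h]; split.
Qed.

Lemma toric_actE t s p : toric_act t (toric_class s p) = toric_class (tmul t s) p.
Proof.
rewrite /toric_act /toric_class; have [e h] := toric_repr s p.
apply/eqmodP/asboolP; split => //=; rewrite e.
by rewrite tinvM [tmul (tinv t) _]tmulC -tmulA [tmul (tinv t) _]tmulA tmulV tmul1.
Qed.

Lemma orbit_mapE t p : orbit_map (toric_class t p) = set_val p.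
Proof. by rewrite /orbit_map /toric_class; have [-> _] := toric_repr t p. Qed.

Lemma orbit_map_act t x : orbit_map (toric_act t x) = orbit_map x.
Proof. by rewrite /toric_act /= orbit_mapE. Qed.

Definition orbit_fiber (p : 'rV[R]_n) : topologicalType :=
  set_type (orbit_map @^-1` [set p]).

Definition orbit_fiber_act (p : 'rV[R]_n) (t : torus R n) (x : orbit_fiber p) :
  orbit_fiber p.
Proof.
refine (exist _ (toric_act t (set_val x)) _).
by apply/mem_set => /=; rewrite orbit_map_act; have /set_mem := valP x.
Defined.

Definition torus_stratification (l : nat) (X : nat -> set toric_variety) :=
  [/\ forall j, (1 <= j <= l)%N -> closed (X j),
      forall j t x, (1 <= j <= l)%N -> X j x -> X j (toric_act t x),
      forall j, (1 <= j < l)%N -> X j `<=` X j.+1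
    & X l = setT].

End toric.

(* A complex vector bundle of rank [k] over [B]: the fiberwise operations are
   total functions, meaningful on pairs of vectors of the same fiber, and the
   local trivializations [v |-> (proj v, phi v)], with inverse [psi], are
   required to be linear on fibers. *)
Record complex_bundle (R : realType) (B : topologicalType) (k : nat) := {
  tot :> topologicalType;
  proj : tot -> B;
  vadd : tot -> tot -> tot;
  vscale : R[i] -> tot -> tot;
  proj_continuous : continuous proj;
  local_triviality : forall b : B,
    exists (U : set B) (phi : tot -> 'cV[R[i]^o]_k)
           (psi : B * 'cV[R[i]^o]_k -> tot),
      let pU := proj @^-1` U in
      [/\ open U /\ U b,
          {within pU, continuous phi} /\
            {within U `*` setT, continuous psi},
          (forall v, pU v -> psi (proj v, phi v) = v) /\
            (forall c z, U c -> proj (psi (c, z)) = c /\ phi (psi (c, z)) = z),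
          (forall u v, pU u -> proj u = proj v ->
             proj (vadd u v) = proj u /\ phi (vadd u v) = phi u + phi v)
        & (forall a v, pU v ->
             proj (vscale a v) = proj v /\
             phi (vscale a v) = map_mx (fun z : R[i] => a * z) (phi v))]
}.

Section fiberwise_linear.
Variables (R : realType) (B : topologicalType) (k : nat).
Variable V : complex_bundle R B k.

Definition fiberwise_linear (f : V -> V) :=
  (forall u v, proj u = proj v -> f (vadd u v) = vadd (f u) (f v)) /\
  (forall a v, f (vscale a v) = vscale a (f v)).

Definition hermitian_metric (h : V -> V -> R[i]) :=
  [/\ continuous (fun v => h v v : R[i]^o),
      forall u v w, proj u = proj v -> proj u = proj w ->
        h (vadd u v) w = h u w + h v w,
      forall a u v, proj u = proj v -> h (vscale a u) v = a * h u v,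
      forall u v, proj u = proj v -> h v u = (h u v)^*
    & forall v, 0 <= h v v /\ (h v v = 0 -> v = vscale 0 v)].

End fiberwise_linear.

(* The invariant Hermitian metric is the auxiliary choice defining the disc
   and sphere bundles. A complex linear action of a finite group preserves
   orientations, so that no such condition appears. *)
Record simple_orbibundle (R : realType) (n : nat) (B : topologicalType)
    (actB : torus R n -> B -> B) (k : nat) (A : finGroupType) := {
  bundle :> complex_bundle R B k;
  tact : torus R n -> bundle -> bundle;
  tact_action : torus_action tact;
  tact_proj : forall t v, proj (tact t v) = actB t (proj v);
  tact_linear : forall t, fiberwise_linear (tact t);
  gact : A -> bundle -> bundle;
  gact1 : forall v, gact 1%g v = v;
  gactM : forall a b v, gact (a * b)%g v = gact a (gact b v);
  gact_continuous : forall a, continuous (gact a);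
  gact_proj : forall a v, proj (gact a v) = proj v;
  gact_linear : forall a, fiberwise_linear (gact a);
  gact_tact : forall a t v, gact a (tact t v) = tact t (gact a v);
  metric : bundle -> bundle -> R[i];
  metric_hermitian : hermitian_metric metric;
  metric_tact : forall t u v, proj u = proj v ->
    metric (tact t u) (tact t v) = metric u v;
  metric_gact : forall a u v, proj u = proj v ->
    metric (gact a u) (gact a v) = metric u v
}.

Section thom.
Variables (R : realType) (n : nat) (B : topologicalType).
Variables (actB : torus R n -> B -> B) (k : nat) (A : finGroupType).
Variable xi : simple_orbibundle actB k A.

Definition disc : set xi := [set v | metric v v <= 1].
Definition sphere : set xi := [set v | metric v v = 1].

Definition gorbit_rel (u v : set_type disc) : bool :=
  `[< exists a : A, gact a (set_val u) = set_val v >].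

Lemma gorbit_rel_refl : reflexive gorbit_rel.
Proof. by move=> u; apply/asboolP; exists 1%g; exact: gact1. Qed.

Lemma gorbit_rel_sym : symmetric gorbit_rel.
Proof.
suff H u v : gorbit_rel u v -> gorbit_rel v u by move=> u v; apply/idP/idP; exact: H.
move=> /asboolP[a e]; apply/asboolP; exists (a^-1)%g.
by rewrite -e -gactM mulVg gact1.
Qed.

Lemma gorbit_rel_trans : transitive gorbit_rel.
Proof.
move=> v u w /asboolP[a e] /asboolP[b f]; apply/asboolP; exists (b * a)%g.
by rewrite gactM e.
Qed.

Canonical gorbit_equiv :=
  EquivRel gorbit_rel gorbit_rel_refl gorbit_rel_sym gorbit_rel_trans.

Definition orbi_disc : topologicalType :=
  quotient_topology {eq_quot gorbit_equiv}.

Definition orbi_sphere : set orbi_disc :=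
  (fun v : set_type disc => \pi_({eq_quot gorbit_equiv}) v : orbi_disc)
    @` (set_val @^-1` sphere).

Definition thom_space : topologicalType := collapse orbi_sphere.

End thom.

(* Main.v *)
(* Since the facet normals of [P] at a vertex [v] span R^n, the fiber
   [pi^-1(v)] is a single point, and a complex vector bundle over it is C^d.
   The corner neighborhood of the free vertex [v] of [K] identifies the faces
   of [K] containing [v] with the subsets of a d-element set; hence these faces
   lie in one face [Q], whose tangent cone at [v] is spanned by [d] linearly
   independent edge vectors [u_k], which are integral since [P] is a lattice
   polytope. So [Q], minus its faces avoiding [v], has linear coordinates
   [y >= 0] with [gauge y < 1], for a homogeneous gauge function, and the
   isotropy at [y] is [{texp x | x . u_k = 0 whenever y_k > 0}].
   Choosing integral vectors [L_k] with [L_k . u_l = c] if [k = l] and [0]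
   otherwise, the disc of C^d and the quotient [X_j / X_(j-1)] are both
   quotients of the compact space of polar coordinates (angles [th], a unit
   direction [x >= 0] and a radius [r]), by [(r x_k e^(2 pi i th_k))_k] and by
   [[texp (sum_k th_k L_k), (r / gauge x) x]]. The fibers of the second map are
   those of the first one modulo the action of [(Z / c)^n] on C^d with weights
   given by the [u_k], and modulo the collapse of [r = 1]. *)
Require Import Defs.
From mathcomp Require Import all_fingroup.
From mathcomp Require Import all_boot all_order all_algebra.
From mathcomp Require Import all_classical all_reals all_analysis.
From mathcomp Require Import complex ring lra zify.

Set Implicit Arguments.
Unset Strict Implicit.
Unset Printing Implicit Defensive.

Import Order.TTheory GRing.Theory Num.Theory.
Import numFieldNormedType.Exports.

Local Open Scope classical_set_scope.
Local Open Scope ring_scope.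
Local Open Scope quotient_scope.

(** * Quotient maps *)

Section quotient_maps.
Implicit Types X Y Z : topologicalType.

(** No map between the two quotients is written down: it is enough that two maps from one compact
    space identify the same parameters. The burden moves to the Hausdorff property of
    [X_j / X_(j-1)], which is not automatic, since the toric variety is a quotient by isotropy
    groups that jump. It is obtained from real functions [g t * (rho q * h q)]: [g] measures a
    distance modulo the isotropy group of the point to be separated, and [rho] is a product of
    slacks that is nonzero only where the isotropy group is contained in that one, so that the
    product descends. A corner neighborhood is only a homeomorphism and carries no linear structure.
    It serves to read off the poset of faces through [v], and linear coordinates are rebuilt from
    this poset. The edge vectors need not extend to a lattice basis, hence the finite group: dual
    integral vectors exist only up to a factor, here [c = 2 (det G)^2] with [G] the Gram matrix of
    the edges. Dividing by the gauge reconciles the round sphere of C^d with the polyhedral boundary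
    of the star of [v]. *)

Definition quotient_map X Y (f : X -> Y) :=
  (forall y, exists x, f x = y) /\ forall A, open A <-> open (f @^-1` A).

Lemma quotient_map_continuous X Y (f : X -> Y) : quotient_map f -> continuous f.
Proof. by move=> [_ fP]; apply/continuousP => A /fP. Qed.

Lemma quotient_map_comp X Y Z (f : X -> Y) (g : Y -> Z) :
  quotient_map f -> quotient_map g -> quotient_map (g \o f).
Proof.
move=> [fs fP] [gs gP]; split=> [z|A].
  by have [y <-] := gs z; have [x <-] := fs y; exists x.
by rewrite gP fP.
Qed.

Lemma pi_quotient_map X (Q : quotType X) :
  quotient_map (\pi_(quotient_topology Q) : X -> quotient_topology Q).
Proof. by split=> [y|A //]; exists (repr y); rewrite reprK. Qed.

Lemma compact_hausdorff_quotient_map X Y (f : X -> Y) :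
  compact [set: X] -> hausdorff_space Y -> continuous f ->
  (forall y, exists x, f x = y) -> quotient_map f.
Proof.
move=> cX hY cf sf; split=> // A; split; first by move/continuousP: cf; apply.
move=> oA; rewrite -[A]setCK openC.
have -> : ~` A = f @` (f @^-1` (~` A)).
  apply/seteqP; split=> [y nAy|_ [x nAx <-] //].
  by have [x xy] := sf y; exists x => //=; rewrite xy.
apply: (compact_closed hY); apply: continuous_compact.
  by apply/continuous_subspaceT => x; exact: cf.
apply: (subclosed_compact _ cX) => //.
by rewrite preimage_setC closedC.
Qed.

(** The sections [s] and [r] are arbitrary and need not be continuous; [g \o s] and [f \o r] are
    continuous because, precomposed with the quotient maps [f] and [g], they become [g] and [f]. *)
Lemma quotient_maps_homeomorphic X Y Z (f : X -> Y) (g : X -> Z) :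
  quotient_map f -> quotient_map g ->
  (forall x x', f x = f x' <-> g x = g x') -> homeomorphic Y Z.
Proof.
move=> [fs fP] [gs gP] fg.
have [s sP] := choice fs; have [r rP] := choice gs.
exists (g \o s), (f \o r); split.
- apply/continuousP => A /gP oA; apply/fP.
  suff -> : f @^-1` ((g \o s) @^-1` A) = g @^-1` A by [].
  by apply/funext => x /=; congr A; apply/fg; rewrite sP.
- apply/continuousP => A /fP oA; apply/gP.
  suff -> : g @^-1` ((f \o r) @^-1` A) = f @^-1` A by [].
  by apply/funext => x /=; congr A; apply/fg; rewrite rP.
- by move=> y /=; rewrite -[RHS]sP; apply/fg; rewrite rP.
- by move=> z /=; rewrite -[RHS]rP; apply/fg; rewrite sP.
Qed.

End quotient_maps.

Lemma continuous_pair (S T U : topologicalType) (f : S -> T) (g : S -> U) :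
  continuous f -> continuous g -> continuous (fun x => (f x, g x)).
Proof. by move=> cf cg x; exact: (cvg_pair (cf x) (cg x)). Qed.

(** Reduces the Hausdorff property of a quotient to finding real functions that descend to it. *)
Lemma separating_hausdorff (R : realType) (T : topologicalType) :
  (forall x y : T, x <> y -> exists2 f : T -> R, continuous f & f x <> f y) ->
  hausdorff_space T.
Proof.
move=> sep x y cl; apply: contrapT => /sep[f cf]; apply.
apply: (@Rhausdorff R) => A B fA fB.
have [z [Az Bz]] := cl _ _ (cf x _ fA) (cf y _ fB).
by exists (f z).
Qed.

Section set_types.
Variables (T : topologicalType) (A : set T).

Lemma continuous_set_val : continuous (set_val : set_type A -> T).
Proof. exact: initial_continuous. Qed.

Lemma continuous_to_set_type (S : topologicalType) (f : S -> set_type A) :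
  continuous (fun s => set_val (f s)) -> continuous f.
Proof. by move=> cf; apply: continuous_comp_initial. Qed.

Lemma compact_set_type : compact A -> compact [set: set_type A].
Proof.
move=> cA F FF _.
have [|p [Ap clp]] := cA (set_val @ F) _.
  by rewrite /fmap/=; apply: filterS filterT => x _; exact: set_valP.
exists (exist _ p (mem_set Ap)); split=> // U V FU [_ [[W oW <-]] /= Wp WV].
have [|_ [[x Ux <-] Wx]] := clp (set_val @` U) W _ (open_nbhs_nbhs (conj oW
  Wp)).
  by rewrite /fmap/=; apply: filterS FU => x Ux; exists x.
by exists x; split=> //; apply: WV.
Qed.

End set_types.

Section collapses.
Variables (R : realType) (Y : topologicalType) (A : set Y).

Definition collapse_pi (y : Y) : collapse A :=
  \pi_({eq_quot (collapse_equiv A)}) y.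

Lemma collapse_pi_quotient : quotient_map collapse_pi.
Proof. exact: pi_quotient_map. Qed.

Lemma collapse_piP x y : collapse_pi x = collapse_pi y <-> x = y \/ A x /\ A y.
Proof.
split=> [/eqmodP/asboolP //|xy]; exact/eqmodP/asboolP.
Qed.

Lemma collapse_factor (Z : topologicalType) (f : Y -> Z) : continuous f ->
  (forall x y, A x -> A y -> f x = f y) ->
  exists2 g : collapse A -> Z, continuous g & forall y, g (collapse_pi y) = f y.
Proof.
move=> cf fA; have [cs cP] := collapse_pi_quotient.
have [r rP] := choice cs.
have frE y : f (r (collapse_pi y)) = f y.
  by case/collapse_piP: (rP (collapse_pi y)) => [-> //|[? ?]]; exact: fA.
exists (f \o r) => //; apply/continuousP => B oB; apply/cP.
have -> : collapse_pi @^-1` ((f \o r) @^-1` B) = f @^-1` B.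
  by apply/funext => y /=; rewrite frE.
by move/continuousP: cf; apply.
Qed.

End collapses.

(** * The torus *)

Lemma continuous_mx (S T : topologicalType) m n (f : S -> 'M[T]_(m, n)) :
  (forall i j, continuous (fun s => f s i j)) -> continuous f.
Proof.
move=> cf s A [/= P nP sPA]; rewrite /fmap/=.
have : \forall s' \near s, forall i j, P i j (f s' i j).
  apply: filter_forall => i; apply: filter_forall => j.
  exact: cf.
by apply: filterS => s' Ps'; apply: sPA.
Qed.

Section complex_continuity.
Variable R : realType.
Local Notation C := (R[i]^o).

Lemma continuous_ReIm (T : topologicalType) (f g : T -> R) :
  continuous f -> continuous g -> continuous (fun t => (f t +i* g t)%C : C).
Proof.
move=> cf cg t; apply/cvgrPdist_lt => /= e.
(* The radius [e] is a positive element of [R[i]], hence real: its imaginary part vanishes. *)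
rewrite ltcE /= => /andP[/eqP ei e0].
have e2 : 0 < complex.Re e / 2 by rewrite divr_gt0.
move/cvgrPdist_lt: (cf t) => /(_ _ e2) nf.
move/cvgrPdist_lt: (cg t) => /(_ _ e2).
apply: filterS2 nf => s ef eg /=.
rewrite normc_def ltcE /= ei eqxx /=.
have -> : complex.Re e = `|complex.Re e| by rewrite gtr0_norm.
rewrite -sqrtr_sqr ltr_sqrt; last by rewrite exprn_gt0.
rewrite -real_normK ?num_real // -[X in _ + X]real_normK ?num_real //.
move: ef eg; have := normr_ge0 (f t - f s); have := normr_ge0 (g t - g s).
move: `|_| `|_| => a b; nra.
Qed.

(** The norm of [R[i]] takes its values in [R[i]]; this is the same modulus as an element of [R]. *)
Definition cabs (z : C) : R := complex.Re `|z|.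

Lemma cabsE z : (cabs z)%:C%C = `|z|.
Proof. by rewrite /cabs normc_def. Qed.

Lemma cabs_ge0 z : 0 <= cabs z.
Proof. by rewrite -lecR cabsE normr_ge0. Qed.

Lemma cabsM z w : cabs (z * w) = cabs z * cabs w.
Proof. by apply: complexI; rewrite rmorphM /= !cabsE normrM. Qed.

Lemma cabsD z w : cabs (z + w) <= cabs z + cabs w.
Proof. by rewrite -lecR rmorphD /= !cabsE ler_normD. Qed.

Lemma cabs_eq0 z : (cabs z == 0) = (z == 0).
Proof. by rewrite -[RHS]normr_eq0 -cabsE (inj_eq (@complexI _) _ 0). Qed.

Lemma lipschitz_continuous (f : C -> R) :
  (forall z w, `|f z - f w| <= cabs (z - w)) -> continuous f.
Proof.
move=> fP z; apply/(@cvgrPdist_lt _ _ C (nbhs (z : C)) (nbhs_filter (z : C)))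
  => e e0.
have eC : 0 < e%:C%C by rewrite ltcR.
have : nbhs (z : C) (ball (z : C) e%:C%C) by exact: nbhsx_ballx.
apply: (@filterS _ _ (@nbhs_filter C z)) => w.
rewrite /ball /= -cabsE ltcR; exact: le_lt_trans.
Qed.

Lemma cabs_continuous : continuous (cabs : C -> R).
Proof.
apply: lipschitz_continuous => z w.
rewrite ler_norml; apply/andP; split.
  rewrite lerBrDr addrC lerBlDr.
  have -> : cabs (z - w) = cabs (w - z).
    by apply: complexI; rewrite !cabsE distrC.
  by apply: le_trans (cabsD _ _); rewrite addrC subrK.
by rewrite lerBlDr; apply: le_trans (cabsD _ _); rewrite subrK.
Qed.

End complex_continuity.

Section circle.
Variable R : realType.

(** The period is normalised to 1, so that the kernel consists of the integers and [texp] kills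
    exactly the integral vectors. *)
Definition cexp (x : R) : R[i]^o := (cos (2 * pi * x) +i* sin (2 * pi * x))%C.

Lemma cexpD x y : cexp (x + y) = cexp x * cexp y.
Proof.
rewrite /cexp mulrDr cosD sinD; simpc.
by congr (_ +i* _)%C; rewrite addrC.
Qed.

Lemma cexp0 : cexp 0 = 1.
Proof. by rewrite /cexp mulr0 cos0 sin0. Qed.

Lemma norm_cexp x : `|cexp x| = 1.
Proof. by rewrite normc_def /= cos2Dsin2 sqrtr1. Qed.

Lemma cexp_neq0 x : cexp x != 0.
Proof. by rewrite -normr_gt0 norm_cexp. Qed.

Lemma cexp_continuous : continuous cexp.
Proof.
have c2 : continuous (fun x : R => 2 * pi * x) by exact: mulrl_continuous.
apply: continuous_ReIm => x; apply: continuous_comp; try exact: c2.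
  exact: continuous_cos.
exact: continuous_sin.
Qed.

(** Modulo integers [x] lies in [[0, 1)]. There [cos (2 pi y) = 1 - 2 sin (pi y) ^ 2] forces
    [sin (pi y) = 0], while the sine is positive inside [(0, pi)]. *)
Lemma cexp_eq1 x : cexp x = 1 <-> exists z : int, x = z%:~R.
Proof.
have per z : cexp z%:~R = 1.
  have pn m : cexp m%:R = 1.
    elim: m => [|m IH]; first exact: cexp0.
    rewrite -addn1 natrD cexpD IH mul1r /cexp mulr1.
    by rewrite mulr_natl cos2pi sin2pi.
  case: z => m; first exact: pn.
  rewrite NegzE; have := pn m.+1 => e.
  by rewrite -[LHS]mulr1 -[in LHS]e -cexpD mulrNz -pmulrn addNr cexp0.
split=> [x1|[z ->] //].
exists (Num.floor x); set y := x - (Num.floor x)%:~R.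
suff y0 : y = 0 by apply/eqP; rewrite -subr_eq0 -/y y0.
have y1 : cexp y = 1.
  by rewrite /y cexpD x1 mul1r -mulrNz per.
have /andP[yge ylt] : 0 <= y < 1.
  by have /andP[] := floor_itv x; rewrite intrD subr_ge0 ltrBlDl => -> ->.
have [c1 s0] : cos (2 * pi * y) = 1 /\ sin (2 * pi * y) = 0 by case: y1.
have pi0 := pi_gt0 R.
have : cos (2 * pi * y) = 1 - (sin (pi * y)) ^+ 2 *+ 2.
  rewrite -mulrA mulr_natl cos_mulr2n cos2sin2; ring.
rewrite c1 => /eqP; rewrite eq_sym subr_eq addrC -subr_eq subrr eq_sym.
rewrite mulrn_eq0 /= expf_eq0 /= => /eqP sy.
apply/eqP; rewrite eq_le yge andbT leNgt; apply/negP => ygt.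
have : 0 < sin (pi * y).
  by apply: sin_gt0_pi; rewrite mulr_gt0 //= -[ltRHS]mulr1 ltr_pM2l.
by rewrite sy ltxx.
Qed.

Lemma cexp_surj (w : R[i]) : `|w| = 1 -> exists x, w = cexp x.
Proof.
case: w => a b; rewrite normc_def /= => -[] e.
have ab : a ^+ 2 + b ^+ 2 = 1.
  have /(congr1 (fun x => x ^+ 2)) := e.
  by rewrite sqr_sqrtr ?expr1n // addr_ge0 // sqr_ge0.
have a1 : -1 <= a <= 1 by apply/andP; split; nra.
have pi0 : 2 * pi != 0 :> R by rewrite mulf_neq0 // gt_eqF // pi_gt0.
have sb : sin (acos a) = `|b|.
  by rewrite sin_acos // -sqrtr_sqr -ab [_ + _ ^+ 2]addrC addrK.
have [b0|b0] := leP 0 b.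
  exists (acos a / (2 * pi)); rewrite /cexp mulrC divfK //.
  by rewrite acosK ?in_itv //= sb ger0_norm.
exists (- acos a / (2 * pi)); rewrite /cexp mulrC divfK //.
by rewrite cosN sinN acosK ?in_itv //= sb ltr0_norm // opprK.
Qed.

End circle.

Section torus_exp.
Variables (R : realType) (n : nat).
Implicit Types (x y : 'rV[R]_n) (t s u : torus R n).

Lemma tcoord_texp x j : tcoord (texp x) j = cexp (x 0 j).
Proof. exact: tcoord_mk. Qed.

Lemma tcoordM t s j : tcoord (tmul t s) j = tcoord t j * tcoord s j.
Proof. exact: tcoord_mk. Qed.

Lemma texp_continuous : continuous (@texp R n).
Proof.
apply: continuous_to_set_type; apply: continuous_mx => i j.
have -> : (fun x => set_val (texp x) i j) = cexp (R:=R) \o (fun x => x 0 j).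
  by apply/funext => p /=; rewrite mxE.
move=> x; apply: continuous_comp; first exact: coord_continuous.
exact: cexp_continuous.
Qed.

Lemma tcoord_continuous j : continuous (fun t => tcoord t j : R[i]^o).
Proof.
move=> t; apply: (@continuous_comp _ _ _ _ (fun z : 'rV[R[i]^o]_n => z 0 j)).
  exact: continuous_set_val.
exact: coord_continuous.
Qed.

Lemma texp_int (z : 'rV[int]_n) : texp (map_mx intr z : 'rV[R]_n) = tone R n.
Proof.
apply: torus_ext => j; rewrite tcoord_texp tcoord_mk mxE.
by apply/cexp_eq1; exists (z 0 j).
Qed.

Lemma texp_eqP x y :
  texp x = texp y <-> exists z : 'rV[int]_n, x = y + map_mx intr z.
Proof.
split=> [e|[z ->]]; last by rewrite texpD texp_int tmulC tmul1.
have H j : exists z : int, x 0 j - y 0 j = z%:~R.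
  apply/cexp_eq1; have := congr1 (fun t => tcoord t j) e.
  rewrite /= !tcoord_texp => ej; apply: (mulIf (cexp_neq0 (y 0 j))).
  by rewrite mul1r -cexpD subrK.
have [z zP] := choice H.
exists (\row_j z j); apply/rowP => j; rewrite !mxE -zP.
by rewrite addrC subrK.
Qed.

Lemma texp_surj t : exists x, texp x = t.
Proof.
have [x xP] := choice (fun j => cexp_surj (norm_tcoord t j)).
exists (\row_j x j); apply: torus_ext => j.
by rewrite tcoord_texp mxE xP.
Qed.

(** A translation-invariant distance; the invariance is what lets [coset_function] descend to
    cosets. *)
Definition tdist t s : R := \sum_j cabs (tcoord t j - tcoord s j).

Lemma cabs_tcoord t j : cabs (tcoord t j) = 1.
Proof. by apply: complexI; rewrite cabsE norm_tcoord. Qed.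

Lemma tdist_ge0 t s : 0 <= tdist t s.
Proof. by apply: sumr_ge0 => j _; exact: cabs_ge0. Qed.

Lemma tdistM t s u : tdist (tmul t u) (tmul s u) = tdist t s.
Proof.
apply: eq_bigr => j _.
by rewrite !tcoordM -mulrBl cabsM cabs_tcoord mulr1.
Qed.

Lemma tdistD t s u : tdist t s <= tdist t u + tdist u s.
Proof.
rewrite /tdist -big_split /=; apply: ler_sum => j _.
by apply: le_trans (cabsD _ _); rewrite addrA subrK.
Qed.

Lemma tdist_eq0 t s : tdist t s = 0 -> t = s.
Proof.
move=> /eqP; rewrite psumr_eq0; last by move=> j _; exact: cabs_ge0.
move=> /allP e; apply: torus_ext => j.
have := e j (mem_index_enum j).
by rewrite cabs_eq0 subr_eq0 => /eqP.
Qed.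

Lemma tdistxx t : tdist t t = 0.
Proof.
by rewrite /tdist big1 // => j _; apply/eqP; rewrite cabs_eq0 subrr.
Qed.

Lemma tdistC t s : tdist t s = tdist s t.
Proof.
apply: eq_bigr => j _; apply: complexI.
by rewrite !cabsE distrC.
Qed.

Lemma continuous_sumR (T : topologicalType) (I : finType) (f : I -> T -> R) :
  (forall i, continuous (f i)) -> continuous (fun p => \sum_i f i p).
Proof.
move=> cf p; apply: (@cvg_big _ _ +%R 0) => [|i _]; last exact: cf.
exact: add_continuous.
Qed.

Lemma tcoord_comp_continuous (T : topologicalType) (f : T -> torus R n) j :
  continuous f -> continuous (fun p => tcoord (f p) j : R[i]^o).
Proof.
move=> cf p.
apply: (@continuous_comp T _ R[i]^o f (fun t => tcoord t j)); first exact: cf.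
exact: tcoord_continuous.
Qed.

Lemma tdist_continuous s (T : topologicalType) (f : T -> torus R n) :
  continuous f -> continuous (fun p => tdist (f p) s).
Proof.
move=> cf; rewrite /tdist.
apply: (@continuous_sumR _ _ (fun j p => cabs (tcoord (f p) j - tcoord s j))).
move=> j p.
apply: (@continuous_comp T R[i]^o R
  (fun p => tcoord (f p) j - tcoord s j) (@cabs R)).
  apply: (@cvgB R[i] R[i]^o); last exact: cvg_cst.
  exact: tcoord_comp_continuous.
exact: cabs_continuous.
Qed.

Lemma tmul_continuous (T : topologicalType) (f : T -> torus R n) s :
  continuous f -> continuous (fun p => tmul s (f p)).
Proof.
move=> cf; apply: continuous_to_set_type; apply: continuous_mx => i j.
have -> : (fun p => set_val (tmul s (f p)) i j) =
    (fun p => (tcoord s j : R[i]^o) * tcoord (f p) j).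
  by apply/funext => p /=; rewrite mxE.
move=> p; apply: (@cvgMl_tmp R[i] _ _ _ (fun p => tcoord (f p) j : R[i]^o)).
exact: tcoord_comp_continuous.
Qed.

(* The infimum of the distances to [t0] over the coset [t H]; it is attained
   by compactness of [H]. *)
Lemma coset_function (S : set 'rV[R]_n) (H : set (torus R n)) (t0 : torus R n) :
  compact S -> H = @texp R n @` S -> H (tone R n) ->
  (forall t s, H t -> H s -> H (tmul t s)) -> (forall t, H t -> H (tinv t)) ->
  exists g : torus R n -> R,
    [/\ continuous g, forall t u, H u -> g (tmul t u) = g t, g t0 = 0
      & forall t, g t = 0 -> H (tmul (tinv t) t0)].
Proof.
move=> cS HE H1 HM HV.
pose D t := [set tdist (tmul t s) t0 | s in H].
pose g t := inf (D t).
have D0 t : lbound (D t) 0 by move=> _ [s _ <-]; exact: tdist_ge0.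
have Dhas t : has_inf (D t).
  by split; [exists (tdist (tmul t (tone R n)) t0), (tone R n)|exists 0].
have DE t u : H u -> D (tmul t u) = D t.
  move=> Hu; apply/seteqP; split=> _ [s Hs <-].
    by exists (tmul u s); [exact: HM|rewrite tmulA].
  exists (tmul (tinv u) s); first by apply: HM => //; exact: HV.
  by rewrite -tmulA (tmulA u) (tmulC u) tmulV tmul1.
(* An infimum of 1-Lipschitz functions is 1-Lipschitz, hence continuous. *)
have glip t t' : g t <= tdist t t' + g t'.
  rewrite addrC -lerBlDr; apply: lb_le_inf => [|_ [s Hs <-]].
    by have [] := Dhas t'.
  rewrite lerBlDl -(tdistM t t' s); apply: le_trans (tdistD _ _ _).
  by apply: ge_inf; [exists 0|exists s].
exists g; split.
- move=> t; apply/(@cvgrPdist_lt _ _ _ (nbhs t) (nbhs_filter t)) => e e0.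
  have := @tdist_continuous t _ id (fun=> cvg_id) t.
  move/(@cvgrPdist_lt _ _ _ (nbhs t) (nbhs_filter t)) => /(_ _ e0).
  apply: (@filterS _ _ (nbhs_filter t)) => t'.
  rewrite tdistxx sub0r normrN ger0_norm ?tdist_ge0 //.
  apply: le_lt_trans; rewrite ler_norml; apply/andP; split.
    by rewrite lerBrDr addrC lerBlDr addrC glip.
  by rewrite lerBlDr tdistC glip.
- by move=> t u Hu; rewrite /g DE.
- apply/eqP; rewrite eq_le; apply/andP; split; last first.
    by apply: lb_le_inf => //; have [] := Dhas t0.
  apply: ge_inf; first by exists 0.
  by exists (tone R n) => //; rewrite tmulC tmul1 tdistxx.
- move=> t gt0.
  have S0 : S !=set0 by move: H1; rewrite HE => -[x Sx _]; exists x.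
  pose f x := tdist (tmul t (texp x)) t0.
  have cf : continuous f.
    by apply: tdist_continuous; apply: tmul_continuous; exact: texp_continuous.
  have [x] := compact_EVT_min S0 cS (continuous_subspaceT cf).
  rewrite inE => Sx xmin.
  have fx : f x <= g t.
    apply: lb_le_inf => [|_ [s + <-]]; first by have [] := Dhas t.
    by rewrite HE => -[y Sy <-]; apply: xmin; rewrite inE.
  have /tdist_eq0 <- : f x = 0.
    by apply/eqP; rewrite eq_le tdist_ge0 -gt0 fx.
  by rewrite tmulA tmulV tmul1 HE; exists x.
Qed.

End torus_exp.

(** * Polytopes as intersections of half-spaces *)

Section dot_product.
Variables (R : realType) (n : nat).
Implicit Types a x y : 'rV[R]_n.

Lemma dotpE a x : dotp a x = (a *m x^T) 0 0.
Proof. by rewrite !mxE; apply: eq_bigr => j _; rewrite mxE. Qed.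

Lemma dotpC a x : dotp a x = dotp x a.
Proof. by apply: eq_bigr => j _; rewrite mulrC. Qed.

Lemma dotpDr a x y : dotp a (x + y) = dotp a x + dotp a y.
Proof. by rewrite !dotpE linearD mulmxDr mxE. Qed.

Lemma dotpZr c a x : dotp a (c *: x) = c * dotp a x.
Proof. by rewrite !dotpE linearZ -scalemxAr mxE. Qed.

Lemma dotpNr a x : dotp a (- x) = - dotp a x.
Proof. by rewrite -scaleN1r dotpZr mulN1r. Qed.

Lemma dotpBr a x y : dotp a (x - y) = dotp a x - dotp a y.
Proof. by rewrite dotpDr dotpNr. Qed.

Lemma dotp0r a : dotp a 0 = 0.
Proof. by rewrite -(scale0r 0) dotpZr mul0r. Qed.

Lemma dotp_sumr a (I : finType) (f : I -> 'rV[R]_n) :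
  dotp a (\sum_i f i) = \sum_i dotp a (f i).
Proof.
apply: (big_morph (dotp a)); [exact: dotpDr|exact: dotp0r].
Qed.

Lemma dotpDl a b x : dotp (a + b) x = dotp a x + dotp b x.
Proof. by rewrite !(dotpC _ x) dotpDr. Qed.

Lemma dotpZl c a x : dotp (c *: a) x = c * dotp a x.
Proof. by rewrite !(dotpC _ x) dotpZr. Qed.

Lemma dotpNl a x : dotp (- a) x = - dotp a x.
Proof. by rewrite !(dotpC _ x) dotpNr. Qed.

Lemma dotpBl a b x : dotp (a - b) x = dotp a x - dotp b x.
Proof. by rewrite dotpDl dotpNl. Qed.

Lemma dotp_suml x (I : finType) (f : I -> 'rV[R]_n) :
  dotp (\sum_i f i) x = \sum_i dotp (f i) x.
Proof. by rewrite dotpC dotp_sumr; apply: eq_bigr => i _; rewrite dotpC. Qed.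

Lemma dotp_deltar a j : dotp a (delta_mx 0 j) = a 0 j.
Proof.
rewrite /dotp (bigD1 j) //= mxE !eqxx mulr1 big1 ?addr0 // => k kj.
by rewrite mxE (negPf kj) andbF mulr0.
Qed.

Lemma dotp_mul_row a m (c : 'rV[R]_m) (B : 'M[R]_(m, n)) :
  dotp a (c *m B) = \sum_i c 0 i * dotp a (row i B).
Proof.
by rewrite mulmx_sum_row dotp_sumr; apply: eq_bigr => i _; rewrite dotpZr.
Qed.

Lemma dotp_continuous a : continuous (dotp a).
Proof.
apply: (@continuous_sumR R _ 'I_n (fun j x => a 0 j * x 0 j)) => j x.
apply: (@continuousM R); first exact: cst_continuous.
exact: coord_continuous.
Qed.

End dot_product.

Section weyl.
Variable R : realType.

Definition halfspaces n (s : seq 'rV[R]_n) x := all (fun a => dotp a x <= 0) s.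

(* Fourier-Motzkin elimination of the last generator [w]: for [t >= 0], the
   constraints [a . (x - t w) <= 0] bound [t] from below when [a . w > 0] and
   from above when [a . w < 0]. *)
Lemma halfspaces_add_ray n (s : seq 'rV[R]_n) w :
  exists s', forall x,
    halfspaces s' x <-> exists2 t, 0 <= t & halfspaces s (x - t *: w).
Proof.
(* When [a . w > 0 > b . w], this combination has positive coefficients and is orthogonal to [w]: it
   says that the lower bound from [a] does not exceed the upper bound from [b]. *)
pose comb (a b : 'rV[R]_n) := - dotp b w *: a + dotp a w *: b.
exists ([seq a <- s | dotp a w <= 0] ++
  [seq comb a b | a <- [seq a <- s | 0 < dotp a w],
                  b <- [seq b <- s | dotp b w < 0]]) => x.
have cE a b : dotp (comb a b) x = - dotp b w * dotp a x + dotp a w * dotp b x.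
  by rewrite dotpDl !dotpZl.
rewrite /halfspaces all_cat; split; last first.
  move=> [t t0 /allP h]; apply/andP; split; apply/allP.
    move=> a; rewrite mem_filter => /andP[aw /h].
    by rewrite dotpBr dotpZr; nra.
  move=> _ /allpairsP[[a b] /= [+ + ->]].
  rewrite !mem_filter => /andP[aw /h] + /andP[bw /h].
  by rewrite !dotpBr !dotpZr cE; nra.
move=> /andP[/allP h0 /allP h1].
have h2 a b : a \in s -> b \in s -> 0 < dotp a w -> dotp b w < 0 ->
    dotp a x / dotp a w <= dotp b x / dotp b w.
  move=> sa sb aw bw.
  have /h1 : comb a b \in [seq comb a b | a <- [seq a <- s | 0 < dotp a w],
                  b <- [seq b <- s | dotp b w < 0]].
    by apply/allpairsP; exists (a, b); rewrite !mem_filter /= sa sb aw bw.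
  rewrite cE ler_pdivrMr // mulrAC ler_ndivlMr //.
  by rewrite mulNr; lra.
(* The least admissible value: the largest of the lower bounds, the initial value 0 accounting for
   [t >= 0]. *)
pose t := \big[Num.max/0]_(a <- s | 0 < dotp a w) (dotp a x / dotp a w).
exists t; first exact: bigmax_ge_id.
apply/allP => a sa; rewrite dotpBr dotpZr subr_le0.
have [aw|aw|aw] := ltgtP 0 (dotp a w).
- rewrite -ler_pdivrMr //.
  exact: (le_bigmax_seq 0 a (fun a => 0 < dotp a w)
    (fun a => dotp a x / dotp a w)).
- rewrite -ler_ndivlMr //; rewrite /t big_seq_cond.
  elim/big_ind: _ => [|u u' hu hu'|b /andP[sb bw]]; last exact: h2.
    have := h0 a; rewrite mem_filter sa (ltW aw) => /(_ isT).
    by rewrite -[_ <= 0]oppr_ge0 => ax; rewrite -mulrNN mulr_ge0 // -invrN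
       invr_ge0 oppr_ge0 ltW.
  by rewrite ge_max hu hu'.
- by rewrite -aw mulr0; apply: h0; rewrite mem_filter sa -aw lexx.
Qed.

(** Weyl's theorem, by induction on the number of generators: the zero cone is cut out by the
    coordinates and their negatives, and [halfspaces_add_ray] adds one generator. *)
Lemma cone_halfspaces m n (W : 'M[R]_(m, n)) :
  exists s, forall x,
    halfspaces s x <-> exists2 c : 'rV[R]_m, (forall i, 0 <= c 0 i) & x = c *m
      W.
Proof.
elim: m W => [|m IH] W.
  exists ([seq delta_mx 0 j | j : 'I_n] ++ [seq - delta_mx 0 j | j : 'I_n]).
  move=> x; split=> [|[c _ ->]]; last first.
    rewrite (thinmx0 c) mul0mx; apply/allP => a _; by rewrite dotp0r.
  rewrite /halfspaces all_cat => /andP[/allP h1 /allP h2].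
  exists 0; first by case.
  rewrite mul0mx; apply/rowP => j; rewrite mxE; apply/eqP; rewrite eq_le.
  rewrite -(dotp_deltar x j) dotpC; apply/andP; split.
    by apply: h1; apply/mapP; exists j; rewrite ?mem_enum.
  rewrite -oppr_le0 -dotpNl.
  by apply: h2; apply/mapP; exists j; rewrite ?mem_enum.
have [s sP] := IH (@dsubmx _ 1 m n W).
have [s' s'P] := halfspaces_add_ray s (@usubmx _ 1 m n W).
exists s' => x; rewrite s'P; split.
  move=> [t t0 /sP[c c0 xc]].
  exists (@row_mx _ 1 1 m t%:M c : 'rV_(m.+1)).
    move=> i; case: (@split_ordP 1 m i) => j ->.
      by rewrite (@row_mxEl _ 1 1 m) mxE ord1 eqxx.
    by rewrite (@row_mxEr _ 1 1 m).
  rewrite -[W in RHS](@vsubmxK _ 1 m n) (@mul_row_col _ 1 1 m n) -xc.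
  by rewrite mul_scalar_mx addrC subrK.
move=> [c c0 ->]; exists (c 0 (lshift m (0 : 'I_1))) => //.
apply/sP; exists (@rsubmx _ 1 1 m c) => [i|]; first by rewrite mxE.
suff -> : c *m W = c 0 (lshift m (0 : 'I_1)) *: @usubmx _ 1 m n W +
    @rsubmx _ 1 1 m c *m @dsubmx _ 1 m n W by rewrite addrAC subrr add0r.
rewrite -mul_scalar_mx -(@mul_row_col _ 1 1 m n) vsubmxK; congr (_ *m _).
have -> : (c 0 (lshift m (0 : 'I_1)))%:M = @lsubmx _ 1 1 m c.
  by apply/rowP => i; rewrite !mxE ord1 eqxx.
by rewrite hsubmxK.
Qed.

End weyl.

Section polytope_halfspaces.
Variables (R : realType) (n : nat) (P : set 'rV[R]_n).

Definition Hrep (N : nat) (a : 'I_N -> 'rV[R]_n) (b : 'I_N -> R) :=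
  forall x, P x <-> forall i, dotp (a i) x <= b i.

(** This makes every inequality cut out a facet ([facet_dim]), so that the normals of the
    inequalities tight at a point are facet normals there. *)
Definition irredundant N (a : 'I_N -> 'rV[R]_n) (b : 'I_N -> R) :=
  forall i, exists2 y,
    (forall j, j != i -> dotp (a j) y <= b j) & b i < dotp (a i) y.

(** Homogenisation: [x] is in [P] iff [(x, 1)] is in the cone over the points [(row i A, 1)]; at
    height 1 the linear inequalities of the cone become affine ones. *)
Lemma lattice_polytope_Hrep : lattice_polytope P ->
  exists N (a : 'I_N -> 'rV[R]_n) b, Hrep a b.
Proof.
move=> [m [A PE]].
pose W := row_mx (map_mx intr A : 'M[R]_(m, n)) (const_mx 1 : 'cV[R]_m).
have [s sP] := cone_halfspaces W.
pose s_ (i : 'I_(size s)) := nth 0 s i.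
exists (size s), (fun i => lsubmx (s_ i)), (fun i => - rsubmx (s_ i) 0 0) => x.
have dE a : dotp a (row_mx x (1%:M : 'M[R]_1)) = dotp (lsubmx a) x + rsubmx a 0
  0.
  rewrite /dotp big_split_ord /= big_ord1; congr (_ + _).
    by apply: eq_bigr => j _; rewrite row_mxEl mxE.
  by rewrite row_mxEr !mxE eqxx mulr1.
suff -> : P x <-> halfspaces s (row_mx x (1%:M : 'M[R]_1)).
  rewrite /halfspaces; split=> [/allP h i|h].
    by rewrite -subr_le0 opprK -dE; apply: h; rewrite mem_nth.
  apply/(all_nthP 0) => i il; have := h (Ordinal il).
  by rewrite dE -[_ + _ <= 0]subr_le0 subr0 -[X in _ + X]opprK subr_le0.
  rewrite PE sP; split=> [[c [c0 c1 ->]]|[c c0]].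
    exists c => //; rewrite mul_mx_row; congr row_mx.
    apply/rowP => i; rewrite ord1 !mxE eqxx -[LHS]c1.
    by apply: eq_bigr => j _; rewrite mxE mulr1.
  rewrite mul_mx_row => /eq_row_mx[-> c1]; exists c; split=> //.
  move/rowP/(_ 0): c1; rewrite !mxE eqxx => c1; apply: etrans (esym c1).
  by apply: eq_bigr => j _; rewrite mxE mulr1.
Qed.

Lemma irredundant_Hrep : lattice_polytope P ->
  exists N (a : 'I_N -> 'rV[R]_n) b, Hrep a b /\ irredundant a b.
Proof.
move=> /lattice_polytope_Hrep[N].
elim: N => [|N IH] [a [b ab]]; first by exists 0%N, a, b; split=> // -[].
have [irr|] := pselect (irredundant a b); first by exists N.+1, a, b.
move=> /existsNP[i iP]; apply: IH.
exists (fun j => a (lift i j)), (fun j => b (lift i j)) => x.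
rewrite ab; split=> [h j //|h j].
have [->|ji] := eqVneq j i; last first.
  by case: (unliftP i j) ji => [k -> _|-> /eqP]; [exact: h|].
rewrite leNgt; apply/negP => lt; apply: iP; exists x => // k ki.
by case: (unliftP i k) ki => [k' -> _|-> /eqP]; [exact: h|].
Qed.

End polytope_halfspaces.

(** * Faces and isotropy *)

Section faces.
Variables (R : realType) (n : nat) (P : set 'rV[R]_n).
Variables (N : nat) (a : 'I_N -> 'rV[R]_n) (b : 'I_N -> R).
Hypothesis ab : Hrep P a b.

Definition tight (x : 'rV[R]_n) (i : 'I_N) := dotp (a i) x == b i.

(** For [p] in [P], the smallest face containing [p] ([carrier_min]). It turns inclusions of faces
    into inclusions of sets of tight inequalities. *)
Definition carrier (p : 'rV[R]_n) : set 'rV[R]_n :=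
  [set y | P y /\ forall i, tight p i -> tight y i].

Lemma not_tight x i : P x -> ~~ tight x i -> dotp (a i) x < b i.
Proof. by move=> /ab/(_ i) h t; rewrite lt_neqAle t. Qed.

(** The sum of the inequalities tight at [p] is a supporting one, and it is an equality exactly
    where each summand is. *)
Lemma carrier_face p : P p -> face P (carrier p).
Proof.
move=> Pp; split; first by exists p.
exists (\sum_(i | tight p i) a i), (\sum_(i | tight p i) b i).
have dE x : dotp (\sum_(i | tight p i) a i) x = \sum_(i | tight p i) dotp (a i)
  x.
  rewrite big_mkcond dotp_suml [RHS]big_mkcond; apply: eq_bigr => i _.
  by case: ifP => // _; rewrite dotpC dotp0r.
split=> [x Px|]; first by rewrite dE; apply: ler_sum => i _; exact: (ab x).1.
apply/seteqP; split=> [y [Py yp]|y [Py /=]].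
  by split=> //=; rewrite dE; apply: eq_bigr => i /yp /eqP.
rewrite dE => /eqP e; split=> // i ti; apply/eqP.
move: e; rewrite eq_sym -subr_eq0 -sumrB psumr_eq0.
  move/allP/(_ i (mem_index_enum i)); rewrite ti subr_eq0 => /eqP.
  by move=> ->.
by move=> j _; rewrite subr_ge0; exact: (ab y).1.
Qed.

Lemma finite_eps (I : finType) (c d : I -> R) : (forall i, 0 < d i) ->
  exists2 e, 0 < e & forall i t, 0 <= t <= e -> t * c i < d i.
Proof.
move=> d0.
suff [e e0 he] : exists2 e, 0 < e &
    forall i, i \in enum I -> forall t, 0 <= t <= e -> t * c i < d i.
  by exists e => // i; apply: he; rewrite mem_enum.
elim: (enum I) => [|i s [e e0 he]]; first by exists 1.
have ci : 0 < 1 + `|c i| by rewrite ltr_pwDl.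
exists (Num.min e (d i / (1 + `|c i|))).
  by rewrite lt_min e0 divr_gt0.
move=> j; rewrite inE => /predU1P[->|js] t /andP[t0]; rewrite le_min.
  move=> /andP[_]; rewrite ler_pdivlMr // => h.
  have := d0 i; have := ler_norm (c i).
  have [->|tn0] := eqVneq t 0; first by rewrite mul0r.
  have : 0 < t by rewrite lt_neqAle eq_sym tn0.
  by move: h; move: `|c i| => x; nra.
by move=> /andP[te _]; apply: he => //; rewrite t0.
Qed.

(** Inequalities that are not tight at [p] are strict and survive a short move, and [u] does not
    increase the tight ones. *)
Lemma step p u : P p -> (forall i, tight p i -> dotp (a i) u <= 0) ->
  exists2 e, 0 < e & forall t, 0 <= t <= e ->
    P (p + t *: u) /\ forall i, tight (p + t *: u) i -> tight p i.
Proof.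
move=> Pp up.
pose d i := if tight p i then 1 else b i - dotp (a i) p.
have d0 i : 0 < d i.
  by rewrite /d; case: ifPn => // /(not_tight Pp); rewrite subr_gt0.
have [e e0 he] := finite_eps (fun i => dotp (a i) u) d0.
have lt i t : 0 <= t <= e -> ~~ tight p i -> dotp (a i) (p + t *: u) < b i.
  move=> te; have := he i t te; rewrite /d; case: ifPn => // _.
  by rewrite dotpDr dotpZr ltrBrDl.
exists e => // t te; split.
  apply/ab => i; have [ti|] := boolP (tight p i);
    last by move=> /(lt i t te)/ltW.
  rewrite dotpDr dotpZr (eqP ti) gerDl mulr_ge0_le0 //; last exact: up.
  by case/andP: te.
by move=> i /eqP ti; apply: contraT => /(lt i t te); rewrite ti ltxx.
Qed.

(** A relative interior point: for each inequality in turn, pass to the midpoint with a point of [C]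
    where it is strict, if there is one. A midpoint is tight only where both ends are, so earlier
    gains are kept. *)
Lemma convex_relint (C : set 'rV[R]_n) : C `<=` P -> C !=set0 ->
  (forall x y, C x -> C y -> C (2^-1 *: (x + y))) ->
  exists2 p, C p & forall i x, C x -> tight p i -> tight x i.
Proof.
move=> CP [x0 Cx0] Cmid.
suff [p Cp h] : exists2 p, C p & forall i, i \in enum 'I_N ->
    forall x, C x -> tight p i -> tight x i.
  by exists p => // i; apply: h; rewrite mem_enum.
elim: (enum _) => [|i s [p Cp hp]]; first by exists x0.
have [y Cy hy] : exists2 y, C y & forall x, C x -> tight y i -> tight x i.
  have [[y [Cy yi]]|no] := pselect (exists y, C y /\ ~~ tight y i).
    by exists y => // x _ yt; rewrite yt in yi.
  exists x0 => // x Cx _; apply: contraT => tx; case: no; by exists x.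
exists (2^-1 *: (p + y)); first exact: Cmid.
have tl j : tight (2^-1 *: (p + y)) j -> tight p j && tight y j.
  rewrite /tight dotpZr dotpDr => /eqP h.
  have := (ab p).1 (CP _ Cp) j; have := (ab y).1 (CP _ Cy) j.
  by move=> h1 h2; apply/andP; split; apply/eqP; lra.
move=> j; rewrite inE => /predU1P[->|js] x Cx /tl /andP[h1 h2].
  exact: hy.
exact: hp.
Qed.

Lemma Hrep_mid x y : P x -> P y -> P (2^-1 *: (x + y)).
Proof.
move=> /ab Px /ab Py; apply/ab => i; rewrite dotpZr dotpDr.
by have := Px i; have := Py i; lra.
Qed.

(** Both [u] and [- u] are feasible directions at [p], where [a'] attains its maximum over [P]. *)
Lemma face_tight F p u a' b' : cut_by P F a' b' -> F p ->
  (forall i, tight p i -> dotp (a i) u = 0) -> dotp a' u = 0.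
Proof.
move=> [le FE]; rewrite FE => -[Pp /= pb] tu.
have H w : (forall i, tight p i -> dotp (a i) w = 0) -> dotp a' w <= 0.
  move=> tw; have [|e e0 he] := @step p w Pp; first by move=> i /tw ->.
  have [|/le + _] := he e; first by rewrite lexx ltW.
  by rewrite dotpDr dotpZr pb gerDl pmulr_rle0.
apply/eqP; rewrite eq_le H // -oppr_le0 -dotpNr H // => i ti.
by rewrite dotpNr tu // oppr0.
Qed.

Lemma faceP F : face P F -> exists2 p, F p & F = carrier p.
Proof.
move=> [F0 [a' [b' [le FE]]]].
have FP : F `<=` P by rewrite FE => x [].
have [|p Fp hp] := @convex_relint F FP F0.
  rewrite FE => x y [Px xb] [Py yb]; split; first exact: Hrep_mid.
  by move: xb yb; rewrite /= dotpZr dotpDr => -> ->; lra.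
exists p => //; apply/seteqP; split=> [x Fx|y [Py ty]].
  by split; [exact: FP|move=> i; apply: hp].
rewrite FE; split=> //=.
have pb : dotp a' p = b' by move: Fp; rewrite FE => -[].
apply/eqP; rewrite eq_le le //= -pb -subr_le0 -dotpBr.
(* Prolonging the segment from [y] to [p] slightly beyond [p] stays in [P]; since [a'] is maximal at
   [p], it cannot be smaller at [y]. *)
have [|e e0 he] := @step p (p - y) (FP _ Fp).
  by move=> i ti; rewrite dotpBr (eqP ti) (eqP (ty _ ti)) subrr.
have [|/le + _] := he e; first by rewrite lexx ltW.
by rewrite dotpDr dotpZr pb gerDl pmulr_rle0.
Qed.

Lemma face_sub F : face P F -> F `<=` P.
Proof. by move=> [_ [a' [b' [_ ->]]]] x []. Qed.

Lemma carrier_sub p q : (forall i, tight p i -> tight q i) ->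
  carrier q `<=` carrier p.
Proof. by move=> pq x [Px qx]; split=> // i /pq /qx. Qed.

Lemma carrier_min F p : face P F -> F p -> carrier p `<=` F.
Proof.
by move=> /faceP[q Fq ->] [Pp qp]; apply: carrier_sub.
Qed.

(** The direction from left to right needs that a vertex of a face is a vertex of [P], although it
    is exposed by a functional on [F] only. The carrier of [x] in [P] lies in [F], and prolonging
    segments beyond [x] inside [F] shows that it is [x] alone. *)
Lemma vertices_face F x : face P F -> vertices F x <-> face P [set x] /\ F x.
Proof.
move=> fF; have FP := face_sub fF; split=> [fx|[fx Fx]]; last first.
  case: fx => x0 [a' [b' [le xE]]]; split=> //; exists a', b'; split.
    by move=> y /FP /le.
  apply/seteqP; split=> [_ ->|y [/FP Py ya]]; last by rewrite xE.
  split=> //; have : [set x] x by [].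
  by rewrite [in X in X -> _]xE => -[].
case: (fx) => _ [a' [b' [le xE]]].
have Fx : F x by have : [set x] x by []; rewrite xE => -[].
have xb : dotp a' x = b' by have : [set x] x by []; rewrite xE => -[].
split=> //; suff -> : [set x] = carrier x by apply: carrier_face; exact: FP.
apply/seteqP; split=> [_ ->|y yc]; first by split=> //; exact: FP.
have Fy := carrier_min fF Fx yc.
rewrite xE; split=> //=; apply/eqP; rewrite eq_le le //=.
rewrite -xb -subr_le0 -dotpBr.
have [|e e0 he] := @step x (x - y) (FP _ Fx).
  by case: yc => _ ty i ti; rewrite dotpBr (eqP ti) (eqP (ty _ ti)) subrr.
have [|Pz tz] := he e; first by rewrite lexx ltW.
have Fz : F (x + e *: (x - y)).
  have [q Fq FE] := faceP fF; rewrite FE; split=> // i qi.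
  move: Fx Fy; rewrite FE => -[_ /(_ i qi)/eqP xi] [_ /(_ i qi)/eqP yi].
  by rewrite /tight dotpDr dotpZr dotpBr xi yi subrr mulr0 addr0.
by move/le: Fz; rewrite dotpDr dotpZr xb gerDl pmulr_rle0.
Qed.

Lemma closed_halfspace (c : 'rV[R]_n) (d : R) : closed [set x | dotp c x <= d].
Proof.
have -> : [set x | dotp c x <= d] = dotp c @^-1` [set y | y <= d] by [].
apply: preimage_closed; last exact: closed_le.
by move=> x _; exact: dotp_continuous.
Qed.

Lemma closed_hyperplane (c : 'rV[R]_n) (d : R) : closed [set x | dotp c x = d].
Proof.
have -> : [set x | dotp c x = d] = dotp c @^-1` [set d] by [].
apply: preimage_closed; last exact: closed_eq.
by move=> x _; exact: dotp_continuous.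
Qed.

Lemma closed_Hrep : closed P.
Proof.
have -> : P = \bigcap_i [set x | dotp (a i) x <= b i].
  by apply/seteqP; split=> [x /ab h i _|x h]; [exact: h|apply/ab => i;
    exact: h].
by apply: closed_bigI => i _; exact: closed_halfspace.
Qed.

Lemma closed_face F : face P F -> closed F.
Proof.
move=> [_ [a' [b' [_ ->]]]]; apply: closedI; first exact: closed_Hrep.
exact: closed_hyperplane.
Qed.

Lemma finite_faces : finite_set [set F | face P F].
Proof.
pose G (s : {ffun 'I_N -> bool}) := [set y | P y /\ forall i, s i -> tight y i].
apply: (@sub_finite_set _ _ (range G)).
  move=> F /faceP[p _ ->]; exists [ffun i => tight p i] => //.
  by apply/seteqP; split=> y [Py h]; split=> // i hi; apply: h;
     move: hi; rewrite ffunE.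
apply: finite_image; exact: finite_finset.
Qed.

Lemma closed_underlying K : K `<=` faces P -> closed (underlying K).
Proof.
move=> KP; apply: closed_bigcup => [|F /KP]; last exact: closed_face.
exact: sub_finite_set KP finite_faces.
Qed.

End faces.

Section facets.
Variables (R : realType) (n : nat) (P : set 'rV[R]_n).
Variables (N : nat) (a : 'I_N -> 'rV[R]_n) (b : 'I_N -> R).
Hypotheses (ab : Hrep P a b) (irr : irredundant a b) (dimP : has_dim P n).

(** An inequality tight on all of [P] would be tight at [n + 1] affinely independent points, so
    [(a i, b i)] would be zero, which irredundancy excludes. *)
Lemma exists_interior : exists2 p, P p & forall i, dotp (a i) p < b i.
Proof.
have [[A [PA Afree]] _] := dimP.
have P0 : P !=set0 by exists (row 0 A); exact: PA.
have [p Pp hp] := convex_relint ab (@subset_refl _ P) P0 (Hrep_mid ab).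
exists p => // i; apply: (not_tight ab) => //; apply/negP => ti.
have eqA : row_mx A (const_mx 1 : 'cV[R]_n.+1) *m
    col_mx (a i)^T (- (b i)%:M : 'M[R]_1) = 0.
  rewrite mul_row_col; apply/matrixP => k j; rewrite !mxE !ord1.
  have /eqP <- := hp i _ (PA k) ti.
  rewrite big_ord1 !mxE eqxx mulr1n mul1r; apply/eqP; rewrite subr_eq0.
  apply/eqP; apply: eq_bigr => l _; by rewrite !mxE mulrC.
have : col_mx (a i)^T (- (b i)%:M : 'M[R]_1) = 0.
  have /row_full_inj : row_full (row_mx A (const_mx 1 : 'cV[R]_n.+1)).
    by rewrite /row_full (eqP Afree) addn1.
  by apply; rewrite eqA mulmx0.
rewrite -[0]col_mx0 => /eq_col_mx[ai0 bi0].
have [y _] := irr i.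
have -> : a i = 0 by rewrite -[a i]trmxK ai0 trmx0.
have -> : b i = 0.
  by move/matrixP/(_ 0 0): bi0; rewrite !mxE eqxx => /eqP;
    rewrite oppr_eq0 => /eqP.
by rewrite dotpC dotp0r ltxx.
Qed.

Lemma normal_neq0 i : a i != 0.
Proof.
apply/eqP => ai0; have [p _ /(_ i)] := exists_interior.
have [y _] := irr i; rewrite ai0 !(dotpC 0) !dotp0r => lt1 lt2.
by have := lt_trans lt1 lt2; rewrite ltxx.
Qed.

(** The segment from an interior point to a point violating only inequality [i] crosses the
    hyperplane of [i] where all the other inequalities are strict. *)
Lemma facet_relint i : exists z,
  dotp (a i) z = b i /\ forall j, j != i -> dotp (a j) z < b j.
Proof.
have [p Pp hp] := exists_interior; have [y hy yi] := irr i.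
pose t := (b i - dotp (a i) p) / (dotp (a i) y - dotp (a i) p).
have dpos : 0 < dotp (a i) y - dotp (a i) p.
  by rewrite subr_gt0; exact: lt_trans (hp i) yi.
have t0 : 0 < t by rewrite divr_gt0 // subr_gt0 hp.
have t1 : t < 1 by rewrite ltr_pdivrMr // mul1r ltrD2r.
exists (p + t *: (y - p)); split=> [|j ji].
  by rewrite dotpDr dotpZr dotpBr divfK ?gt_eqF // addrC subrK.
by rewrite dotpDr dotpZr dotpBr; have := hp j; have := hy j ji; nra.
Qed.

End facets.

(** Around the point of [facet_relint], short moves along the hyperplane stay in [P] and give enough
    affinely independent points; one more such point would force [a i = 0]. *)
Lemma facet_dim (R : realType) (n : nat) (P : set 'rV[R]_n) (N : nat)
    (a : 'I_N -> 'rV[R]_n) (b : 'I_N -> R) i :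
  Hrep P a b -> irredundant a b -> has_dim P n ->
  has_dim (P `&` [set x | dotp (a i) x = b i]) n.-1.
Proof.
case: n P a => [|n'] P a ab irr dimP.
  by have /eqP[] := normal_neq0 ab irr dimP i; exact: thinmx0.
have [k0 k0P] : exists k, a i 0 k != 0.
  apply: contrapT => /forallNP h.
  move/eqP: (normal_neq0 ab irr dimP i); apply.
  by apply/rowP => k; rewrite mxE; apply/eqP; move/negP: (h k); rewrite negbK.
rewrite /=.
have [z [zi zj]] := facet_relint ab irr dimP i.
(* The unit vectors projected to the hyperplane along axis [k0]. In particular [w k0 = 0], so that
   row [k0] of the matrix below is [z] itself. *)
pose w k : 'rV[R]_n'.+1 := delta_mx 0 k - (a i 0 k / a i 0 k0) *: delta_mx 0 k0.
have aw k : dotp (a i) (w k) = 0.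
  by rewrite dotpBr dotpZr !dotp_deltar divfK // subrr.
pose c (jk : 'I_N * 'I_n'.+1) := dotp (a jk.1) (w jk.2).
pose d (jk : 'I_N * 'I_n'.+1) :=
  if jk.1 == i then 1 else b jk.1 - dotp (a jk.1) z.
have [e e0 he] : exists2 e, 0 < e & forall jk t, 0 <= t <= e -> t * c jk < d jk.
  apply: finite_eps => -[j k]; rewrite /d /=; case: eqP => // /eqP ji.
  by rewrite subr_gt0 zj.
have inF k : (P `&` [set x | dotp (a i) x = b i]) (z + e *: w k).
  have ei : dotp (a i) (z + e *: w k) = b i.
    by rewrite dotpDr dotpZr aw mulr0 addr0.
  split=> //; apply/ab => j; have [->|ji] := eqVneq j i; first by rewrite ei.
  have := he (j, k) e; rewrite lexx (ltW e0) /c /d /= (negPf ji) => /(_ isT).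
  by rewrite dotpDr dotpZr ltrBrDl => /ltW.
split.
  exists (\matrix_k (z + e *: w k)); split; first by move=> k; rewrite rowK.
  apply: inj_row_free => u; rewrite mul_mx_row -[X in _ = X -> _]row_mx0 =>
    /eq_row_mx[u1 u2].
  have su : \sum_k u 0 k = 0.
    move/rowP/(_ 0): u2; rewrite !mxE => e2; apply: etrans e2.
    by apply: eq_bigr => k _; rewrite mxE mulr1.
  have uw : \sum_k u 0 k *: w k = 0.
    have : e *: (\sum_k u 0 k *: w k) = 0.
      apply: etrans u1; rewrite mulmx_sum_row scaler_sumr.
      under [RHS]eq_bigr do rewrite rowK scalerDr.
      rewrite big_split /= -scaler_suml su scale0r add0r.
      by apply: eq_bigr => k _; rewrite !scalerA mulrC.
    by move/eqP; rewrite scaler_eq0 gt_eqF //= => /eqP.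
  have uk k : k != k0 -> u 0 k = 0.
    move=> kk0; move/rowP/(_ k): uw; rewrite summxE mxE (bigD1 k) //=.
    rewrite big1 ?addr0 => [|l lk].
      by rewrite !mxE !eqxx (negPf kk0) /= mulr0 subr0 mulr1.
    by rewrite !mxE /= [k == l]eq_sym (negPf lk) (negPf kk0) /= mulr0 subr0
      mulr0.
  apply/rowP => k; rewrite mxE; have [->|/uk //] := eqVneq k k0.
  by move: su; rewrite (bigD1 k0) //= big1 ?addr0 // => l /uk.
move=> [A [FA Afree]].
have eqA : row_mx A (const_mx 1 : 'cV[R]_n'.+2) *m
    col_mx (a i)^T (- (b i)%:M : 'M[R]_1) = 0.
  rewrite mul_row_col; apply/matrixP => k j; rewrite !mxE !ord1.
  have [_ /= <-] := FA k.
  rewrite big_ord1 !mxE eqxx mulr1n mul1r; apply/eqP; rewrite subr_eq0.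
  apply/eqP; apply: eq_bigr => l _; by rewrite !mxE mulrC.
have : col_mx (a i)^T (- (b i)%:M : 'M[R]_1) = 0.
  have /row_full_inj : row_full (row_mx A (const_mx 1 : 'cV[R]_n'.+2)).
    by rewrite /row_full (eqP Afree) addn1.
  by apply; rewrite eqA mulmx0.
rewrite -[0]col_mx0 => /eq_col_mx[ai0 bi0].
by move: (normal_neq0 ab irr dimP i); rewrite -[a i]trmxK ai0 trmx0 eqxx.
Qed.

Section isotropy_lie_algebra.
Variables (R : realType) (n : nat) (P : set 'rV[R]_n).
Variables (N : nat) (a : 'I_N -> 'rV[R]_n) (b : 'I_N -> R).
Hypotheses (ab : Hrep P a b) (irr : irredundant a b) (dimP : has_dim P n).

Lemma facet_normal_tight p i : P p -> tight a b p i -> facet_normal P p (a i).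
Proof.
move=> Pp /eqP ti; split; first exact: (normal_neq0 ab).
exists (P `&` [set x | dotp (a i) x = b i]), (b i); split=> //.
  by split=> // x /ab.
exact: (facet_dim i ab).
Qed.

(** Duality: the span of the facet normals at [p] is the orthogonal of the directions along which
    all tight inequalities stay tight. One inclusion is [face_tight], valid for any normal of a
    facet; the other needs that each tight [a i] is a facet normal. *)
Lemma lie_isotropyP p x : P p -> lie_isotropy P p x <->
  forall u, (forall i, tight a b p i -> dotp (a i) u = 0) -> dotp x u = 0.
Proof.
move=> Pp; split.
  move=> [m [A [Anormal /submxP[D ->]]]] u tu.
  rewrite dotpC dotp_mul_row big1 // => k _.
  have [_ [F [c [cutF _ Fp]]]] := Anormal k.
  by rewrite dotpC (face_tight ab cutF Fp tu) mulr0.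
move=> h; pose I := [pred i | tight a b p i].
pose A := \matrix_(k < #|I|) a (enum_val k).
exists #|I|, A; split.
  move=> k; rewrite rowK; apply: facet_normal_tight => //.
  by have := enum_valP k.
(* Membership in the row space is tested on the columns of the cokernel of [A], which are orthogonal
   to every tight normal. *)
rewrite submxE; apply/eqP/rowP => j; rewrite [RHS]mxE.
have dc (C : 'M[R]_n) : (x *m C) 0 j = dotp x (col j C)^T.
  by rewrite /dotp mxE; apply: eq_bigr => k _; rewrite !mxE.
rewrite dc; apply: h => i ti.
have Ii : i \in I by [].
have -> : a i = row (enum_rank_in Ii i) A by rewrite rowK enum_rankK_in.
by rewrite dotpE trmxK colE mulmxA -row_mul mulmx_coker row0 mul0mx mxE.
Qed.

End isotropy_lie_algebra.

(** * The local structure at a free vertex *)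

Section lattice_points.
Variables (R : realType) (n : nat) (P : set 'rV[R]_n).
Hypothesis latP : lattice_polytope P.

(** A convex combination that maximises a linear function has nonzero weights only on points that
    maximise it. *)
Lemma face_lattice_combination F x : face P F -> F x ->
  exists m (A : 'M[int]_(m, n)) (c : 'rV[R]_m),
    [/\ \sum_i c 0 i = 1, x = c *m map_mx intr A
      & forall i, c 0 i != 0 -> F (map_mx intr (row i A))].
Proof.
move=> [_ [a [b [le FE]]]]; have [m [A PE]] := latP.
rewrite FE => -[+ xb]; rewrite PE => -[c [c0 c1 xE]].
exists m, A, c; split=> // i ci.
have Prow k : P (map_mx intr (row k A)).
  rewrite PE; exists (delta_mx 0 k); split.
  - by move=> j; rewrite mxE; case: eqP => // _; case: eqP.
  - rewrite (bigD1 k) //= mxE !eqxx big1 ?addr0 // => j jk.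
    by rewrite mxE (negPf jk) andbF.
  - by rewrite -rowE map_row.
split=> /=; first by move: (Prow i); rewrite PE.
have : \sum_i c 0 i * (b - dotp a (map_mx intr (row i A))) = 0.
  under eq_bigr do rewrite mulrBr.
  rewrite sumrB -mulr_suml c1 mul1r -xb xE dotp_mul_row.
  by under [X in _ - X]eq_bigr do rewrite map_row; rewrite subrr.
move/eqP; rewrite psumr_eq0; last first.
  by move=> j _; rewrite mulr_ge0 // subr_ge0 le.
move/allP/(_ i (mem_index_enum i)).
by rewrite mulf_eq0 (negPf ci) subr_eq0 /= => /eqP ->.
Qed.

(** Otherwise every point of [F] would be an affine combination of copies of [w]. Applied to edges,
    this yields integral edge vectors. *)
Lemma face_lattice_point F w : face P F -> F <> [set w] ->
  exists2 z : 'rV[int]_n, F (map_mx intr z) & map_mx intr z <> w.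
Proof.
move=> fF Fw; apply: contrapT => no.
have allw z : F (map_mx intr z) -> map_mx intr z = w.
  by move=> Fz; apply: contrapT => zw; apply: no; exists z.
have Fsub x : F x -> x = w.
  move=> Fx; have [m [A [c [c1 -> cF]]]] := face_lattice_combination fF Fx.
  rewrite mulmx_sum_row -[RHS]scale1r -[X in _ = X *: _]c1 scaler_suml.
  apply: eq_bigr => i _; have [->|/cF/allw] := eqVneq (c 0 i) 0.
    by rewrite !scale0r.
  by rewrite map_row => ->.
apply: Fw; apply/seteqP; split=> x; first exact: Fsub.
by case: fF => -[y Fy] _ /= ->; rewrite -(Fsub y Fy).
Qed.

Lemma vertex_lattice_point v : face P [set v] ->
  exists z : 'rV[int]_n, v = map_mx intr z.
Proof.
move=> fv; have [m [A [c [c1 _ cF]]]] := face_lattice_combination fv (erefl v).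
have [i ci] : exists i, c 0 i != 0.
  apply: contrapT => /forallNP c0; move: c1; rewrite big1 => [/eqP|i _].
    by rewrite eq_sym oner_eq0.
  by apply/eqP; move/negP: (c0 i); rewrite negbK.
by exists (row i A); rewrite (cF _ ci).
Qed.

Lemma lattice_polytope_bounded :
  exists M : R, forall x j, P x -> `|x 0 j| <= M.
Proof.
have [m [A PE]] := latP.
exists (\sum_(j < n) \sum_(i < m) `|(A i j)%:~R|) => x j; rewrite PE.
move=> [c [c0 c1 ->]]; rewrite mxE; apply: le_trans (ler_norm_sum _ _ _) _.
have cle i : c 0 i <= 1.
  by rewrite -c1 (bigD1 i) //= lerDl; apply: sumr_ge0.
apply: (@le_trans _ _ (\sum_(i < m) `|(A i j)%:~R|)).
  apply: ler_sum => i _; rewrite mxE normrM (ger0_norm (c0 i)).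
  by rewrite ler_piMl.
by rewrite [leRHS](bigD1 j) //= lerDl; do 2 apply: sumr_ge0 => ? _.
Qed.

End lattice_points.

(** * The faces through a vertex with a corner neighborhood *)

Section local_faces.
Variables (R : realType) (n : nat) (P : set 'rV[R]_n).
Variables (N : nat) (a : 'I_N -> 'rV[R]_n) (b : 'I_N -> R).
Hypothesis ab : Hrep P a b.

Lemma segment_open (W : set 'rV[R]_n) v u : open W -> W v ->
  exists2 e, 0 < e <= 1 & W (v + e *: u).
Proof.
move=> oW Wv.
have cf : continuous (fun e : R => v + e *: u).
  apply: continuous_mx => i j.
  have -> : (fun e : R => (v + e *: u) i j) = (fun e => v i j + e * u i j).
    by apply/funext => e; rewrite !mxE.
  move=> e; apply: cvgD; first exact: cvg_cst.
  exact: mulrr_continuous.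
have : nbhs (0 : R) ((fun e : R => v + e *: u) @^-1` W).
  by apply: cf; rewrite scale0r addr0; exact: open_nbhs_nbhs.
move=> /nbhs_ballP[d /= d0 dW].
have e0 : 0 < Num.min (d / 2) 1 by rewrite lt_min divr_gt0 ?ltr01.
exists (Num.min (d / 2) 1); first by rewrite e0 ge_min lexx orbT.
apply: dW; rewrite /ball /= sub0r normrN gtr0_norm //.
by rewrite gt_min ltr_pdivrMr // mulr_natr mulr2n ltrDl d0.
Qed.

(** A face is determined by its germ at any of its points: shrink towards [v] the segment ending at
    a relative interior point [p] of [F]. An inequality tight at the shrunken end is tight at
    [p]. *)
Lemma face_sub_local F F' (W : set 'rV[R]_n) v : face P F -> face P F' ->
  open W -> W v -> F v -> F `&` W `<=` F' -> F `<=` F'.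
Proof.
move=> fF fF' oW Wv Fv sub.
have [p Fp FE] := faceP ab fF; have [q Fq F'E] := faceP ab fF'.
have [e /andP[e0 e1] We] := segment_open (p - v) oW Wv.
have Pv := face_sub fF Fv; have Pp := face_sub fF Fp.
have dE i : dotp (a i) (v + e *: (p - v)) =
    dotp (a i) v + e * (dotp (a i) p - dotp (a i) v).
  by rewrite dotpDr dotpZr dotpBr.
have Fx : F (v + e *: (p - v)).
  rewrite FE; split.
    apply/ab => i; rewrite dE; have := (ab v).1 Pv i; have := (ab p).1 Pp i.
    by nra.
  move=> i pi; move: (Fv); rewrite FE => -[_ /(_ i pi)/eqP vi].
  by rewrite /tight dE vi (eqP pi) subrr mulr0 addr0.
have := sub _ (conj Fx We); rewrite F'E => -[_ qx].
rewrite FE; apply: carrier_sub => i /qx; rewrite /tight dE => /eqP xi.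
have := (ab v).1 Pv i; have := (ab p).1 Pp i.
by move=> h1 h2; apply/eqP; nra.
Qed.

Lemma corner_sub d (I J : {set 'I_d}) :
  @corner R d I `<=` corner J <-> (J \subset I).
Proof.
split=> [sub|/fintype.subsetP sub x [x0 xI]]; last first.
  by split=> // i /sub; exact: xI.
apply/fintype.subsetP => j Jj; apply: contraT => Ij.
have : @corner R d I (delta_mx 0 j).
  split=> [i|i Ii]; rewrite mxE; first by case: eqP => // _; case: eqP.
  by case: eqP => //= _; case: eqP => // ij; move: Ij; rewrite -ij Ii.
by move=> /sub[_ /(_ j Jj)/eqP]; rewrite mxE !eqxx oner_eq0.
Qed.

Variables (K : set (set 'rV[R]_n)) (v : 'rV[R]_n) (d : nat).
Hypotheses (KP : K `<=` faces P) (Kv : K [set v]) (cornerK : corner_nbhd K d v).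

Lemma corner_face_lattice : exists Phi : {set 'I_d} -> set 'rV[R]_n,
  [/\ forall I, K (Phi I) /\ Phi I v,
      forall F, K F -> F v -> exists I, F = Phi I
    & forall I J, Phi I `<=` Phi J <-> (J \subset I)].
Proof.
have [W [f [g [[oW [Kv' Wv]] _ [fU gU] toI fromI]]]] := cornerK.
set U := underlying K `&` W in fU gU toI fromI.
have Uv : U v by split.
have finj x y : U x -> U y -> f x = f y -> x = y.
  by move=> /fU[_ ex] /fU[_ ey] e; rewrite -ex -ey e.
have /choice[Phi PhiP] : forall I : {set 'I_d},
    exists F, K F /\ f @` (F `&` U) = corner I.
  by move=> I; have [F KF FE] := fromI I; exists F.
(* The origin lies on every [corner I], in particular on the one matched with the face [[set v]]. *)
have fv0 : f v = 0.
  have [|I IE] := toI _ Kv; first by exists v.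
  have : @corner R d I 0 by split=> i; rewrite mxE.
  rewrite -IE => -[_ [-> _] fv0]; exact: fv0.
have Phiv I : Phi I v.
  have : @corner R d I 0 by split=> i; rewrite mxE.
  rewrite -(PhiP I).2 => -[x [Phix Ux]]; rewrite -fv0 => fx.
  by rewrite -(finj _ _ Ux Uv fx).
have sub F F' : K F -> K F' -> F v ->
    f @` (F `&` U) `<=` f @` (F' `&` U) -> F `<=` F'.
  move=> KF KF' Fv FF'.
  apply: (face_sub_local (KP KF) (KP KF') oW Wv Fv) => x [Fx Wx].
  have Ux : U x by split=> //; exists F.
  have [|y [F'y Uy]] := FF' (f x); first by exists x.
  by move=> /(finj _ _ Uy Ux) <-.
exists Phi; split=> [I|F KF Fv|I J].
- by split=> //; case: (PhiP I).
- have [|I IE] := toI _ KF; first by exists v.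
  exists I; have [KI PhiE] := PhiP I.
  by apply/seteqP; split; apply: sub; rewrite ?IE ?PhiE.
- have [KI IE] := PhiP I; have [KJ JE] := PhiP J.
  rewrite -corner_sub -IE -JE; split=> [IJ _ [x [Ix Ux] <-]|]; last exact: sub.
  by exists x => //; split=> //; exact: IJ.
Qed.

End local_faces.

(** The interface between convex geometry and topology. The level [gauge y = 1] is the part of the
    chart lying in the removed complex [K']. The functions of [chart_bump] vanish on [K'] and
    wherever the isotropy is not contained in that of the given point, which is what allows
    functions on the torus to be multiplied by them and still descend. *)
Record conical_chart (R : realType) (n : nat) (P : set 'rV[R]_n)
    (K K' : set (set 'rV[R]_n)) (v : 'rV[R]_n) (d : nat)
    (U : 'M[R]_(d, n)) (gauge : 'rV[R]_d -> R) : Prop := ConicalChart {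
  chart_free : forall y : 'rV[R]_d, y *m U = 0 -> y = 0;
  gauge_continuous : continuous gauge;
  gaugeZ : forall t (y : 'rV[R]_d), 0 <= t -> gauge (t *: y) = t * gauge y;
  gauge_gt0 : forall y : 'rV[R]_d, (forall k, 0 <= y 0 k) -> y != 0 -> 0 <
    gauge y;
  chart_in : forall y : 'rV[R]_d, (forall k, 0 <= y 0 k) -> gauge y <= 1 ->
    underlying K (v + y *m U);
  chart_boundary : forall y : 'rV[R]_d, (forall k, 0 <= y 0 k) -> gauge y = 1 ->
    underlying K' (v + y *m U);
  chart_interior : forall y : 'rV[R]_d, (forall k, 0 <= y 0 k) -> gauge y < 1 ->
    ~ underlying K' (v + y *m U);
  chart_lie : forall y : 'rV[R]_d, (forall k, 0 <= y 0 k) -> gauge y < 1 ->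
    forall x,
    lie_isotropy P (v + y *m U) x <->
    forall k, 0 < y 0 k -> dotp x (row k U) = 0;
  chart_cover : forall q, underlying K q -> ~ underlying K' q ->
    exists y : 'rV[R]_d, [/\ forall k, 0 <= y 0 k, gauge y < 1 & q = v + y *m
      U];
  chart_bump : forall y0 : 'rV[R]_d, (forall k, 0 <= y0 0 k) -> gauge y0 < 1 ->
    exists rho : 'rV[R]_n -> R,
      [/\ continuous rho, rho (v + y0 *m U) != 0,
          forall q, underlying K' q -> rho q = 0
        & forall q x, P q -> rho q != 0 -> lie_isotropy P q x ->
            lie_isotropy P (v + y0 *m U) x]
}.

(** * Linear coordinates on the open star of the vertex *)

Section local_chart.
Variables (R : realType) (n : nat) (P : set 'rV[R]_n).
Variables (N : nat) (a : 'I_N -> 'rV[R]_n) (b : 'I_N -> R).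
Hypotheses (latP : lattice_polytope P) (dimP : has_dim P n).
Hypotheses (ab : Hrep P a b) (irr : irredundant a b).
Variables (K : set (set 'rV[R]_n)) (v : 'rV[R]_n) (d : nat).
Hypotheses (KP : K `<=` faces P) (Kv : K [set v]).
Hypothesis Kdown : forall F F', K F -> face P F' -> F' `<=` F -> K F'.
Variable Phi : {set 'I_d} -> set 'rV[R]_n.
Hypotheses (PhiK : forall I, K (Phi I)) (Phiv : forall I, Phi I v).
Hypothesis PhiE : forall F, K F -> F v -> exists I, F = Phi I.
Hypothesis Phi_sub : forall I J, Phi I `<=` Phi J <-> (J \subset I).

Local Notation tight := (tight a b).
Local Notation carrier := (carrier P a b).

Lemma face_v : face P [set v]. Proof. exact: KP. Qed.

Lemma Pv : P v. Proof. by apply: (face_sub face_v). Qed.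

Lemma face_Phi I : face P (Phi I). Proof. by apply: KP. Qed.

Lemma PhiP I : Phi I `<=` P. Proof. exact: face_sub (face_Phi I). Qed.

Lemma Phi_carrier I : exists2 p, Phi I p & Phi I = carrier p.
Proof. exact: (faceP ab (face_Phi I)). Qed.

Lemma Phi_tight (I J : {set 'I_d}) x : Phi I x -> J \subset I -> Phi J x.
Proof. by move=> Ix /Phi_sub; apply. Qed.

Lemma Phi_setT : Phi finset.setT = [set v].
Proof.
have [I vE] := PhiE Kv (erefl v).
apply/seteqP; split=> [|_ -> //].
by rewrite [X in _ `<=` X]vE Phi_sub finset.subsetT.
Qed.

Lemma K_sub_Phi0 F : K F -> F v -> F `<=` Phi finset.set0.
Proof. by move=> KF /(PhiE KF)[I ->]; rewrite Phi_sub finset.sub0set. Qed.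

(* [wall k] is a facet inequality of [P] cutting out the facet
   [Phi [set k]] of the maximal face [Phi set0]. *)
Lemma wall_exists : exists wall : 'I_d -> 'I_N, forall k,
  [/\ tight v (wall k), ~ (forall x, Phi finset.set0 x -> tight x (wall k)),
      forall x, Phi (finset.set1 k) x -> tight x (wall k)
    & forall x, Phi finset.set0 x -> tight x (wall k) -> Phi (finset.set1 k) x].
Proof.
suff H k : exists i,
  [/\ tight v i, ~ (forall x, Phi finset.set0 x -> tight x i),
      forall x, Phi (finset.set1 k) x -> tight x i
    & forall x, Phi finset.set0 x -> tight x i -> Phi (finset.set1 k) x].
  by have [w wP] := choice H; exists w.
have [g Gg GE] := Phi_carrier (finset.set1 k).
have [q Qq QE] := Phi_carrier finset.set0.
have [i [gi qi]] : exists i, tight g i /\ ~~ tight q i.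
  apply: contrapT => /forallNP no.
  have /Phi_sub : Phi finset.set0 `<=` Phi (finset.set1 k).
    rewrite GE QE; apply: carrier_sub => i gi.
    by apply: contraT => qi; case: (no i).
  by rewrite finset.subset0 => /eqP/finset.setP/(_ k); rewrite !inE eqxx.
have Gi x : Phi (finset.set1 k) x -> tight x i.
  by rewrite GE => -[_]; apply.
exists i; split=> //; first exact: Gi.
  by move=> /(_ q Qq); apply/negP.
move=> x Qx xi.
(* The carrier of [m] contains [v], [g] and [x], and it is not all of [Phi set0] since inequality
   [i] is tight on it but not at [q]. So it lies in some [Phi [set j]], and containing [g] forces
   [j = k]. *)
pose m : 'rV[R]_n := 2^-1 *: (x + g).
have Px := PhiP Qx; have Pg := PhiP Gg.
have Pm : P m by exact: (Hrep_mid ab Px Pg).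
have tm j : tight m j <-> tight x j /\ tight g j.
  have := (ab x).1 Px j; have := (ab g).1 Pg j.
  rewrite /tight dotpZr dotpDr => h1 h2; split.
    by move/eqP => h; split; apply/eqP; lra.
  by move=> [/eqP -> /eqP ->]; apply/eqP; lra.
have Qm : Phi finset.set0 m.
  have Qg : Phi finset.set0 g by apply: Phi_tight Gg (finset.sub0set _).
  move: Qx Qg; rewrite QE => -[_ qx] [_ qg]; split=> // j qj.
  by apply/tm; split; [exact: qx|exact: qg].
have fm : face P (carrier m) := carrier_face ab Pm.
have Km : K (carrier m).
  by apply: (Kdown (PhiK finset.set0) fm); rewrite QE; apply: carrier_sub;
     move: Qm; rewrite QE => -[].
have cmg : carrier m g by split=> // j /tm[].
have cmx : carrier m x by split=> // j /tm[].
have cmv : carrier m v.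
  split; first exact: Pv.
  by move=> j /tm[_ gj]; have := Phiv (finset.set1 k); rewrite GE => -[_];
    apply.
have [I mI] := PhiE Km cmv.
have [I0|/finset.set0Pn[j Ij]] := eqVneq I finset.set0.
  move: qi; have [_ ->//] : carrier m q by rewrite mI I0.
  exact/tm.
have sIj : carrier m `<=` Phi (finset.set1 j).
  by rewrite mI; apply/Phi_sub; rewrite finset.sub1set.
have : Phi (finset.set1 k) `<=` Phi (finset.set1 j).
  apply: subset_trans sIj; rewrite GE; apply: carrier_sub => l.
  by case/tm.
move/Phi_sub; rewrite finset.sub1set inE => /eqP jk.
by rewrite -jk; exact: sIj.
Qed.

Variable wall : 'I_d -> 'I_N.
Hypothesis wall_v : forall k, tight v (wall k).
Hypothesis wall_proper : forall k,
  ~ (forall x, Phi finset.set0 x -> tight x (wall k)).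
Hypothesis wall_facet : forall k x, Phi (finset.set1 k) x -> tight x (wall k).
Hypothesis facet_wall : forall k x,
  Phi finset.set0 x -> tight x (wall k) -> Phi (finset.set1 k) x.

(** The open star of [v] in [K], which is the part lost in [remove_vertex] ([near_not_removed],
    [not_removed_near]). *)
Definition near_v q := [/\ P q, K (carrier q) & forall i, tight q i -> tight v
  i].

Definition walls q : {set 'I_d} := finset.finset (fun k => tight q (wall k)).

Lemma near_Phi0 q : near_v q -> Phi finset.set0 q.
Proof.
move=> [Pq Kq qv]; apply: (K_sub_Phi0 Kq); last by split.
by split=> //; exact: Pv.
Qed.

(** The carrier is some [Phi I], and [k] belongs to [I] iff [Phi I] lies in the facet [Phi [set k]],
    that is, iff wall [k] is tight at [q]. *)
Lemma near_carrier q : near_v q -> carrier q = Phi (walls q).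
Proof.
move=> nq; have [Pq Kq qv] := nq.
have [I qI] := PhiE Kq (conj Pv qv).
rewrite qI; congr Phi; apply/finset.setP => k; rewrite inE.
have IkE : (k \in I) = (finset.set1 k \subset I) by rewrite finset.sub1set.
rewrite IkE; apply/idP/idP => [/Phi_sub sub|tk].
  by apply: wall_facet; apply: sub; rewrite -qI.
apply/Phi_sub; rewrite -qI; apply: (carrier_min ab (face_Phi _)).
by apply: facet_wall => //; exact: near_Phi0.
Qed.

(** Going halfway to [v] brings any point of the maximal face into the open star, where
    [near_carrier] applies. *)
Definition mid x : 'rV[R]_n := 2^-1 *: (x + v).

Lemma tight_mid x i : P x -> tight (mid x) i <-> tight x i /\ tight v i.
Proof.
move=> Px; have := (ab x).1 Px i; have := (ab v).1 Pv i.
rewrite /tight dotpZr dotpDr => h1 h2; split.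
  by move/eqP => h; split; apply/eqP; lra.
by move=> [/eqP -> /eqP ->]; apply/eqP; lra.
Qed.

Lemma near_mid x : Phi finset.set0 x -> near_v (mid x).
Proof.
move=> Qx; have Px := PhiP Qx.
have Pm : P (mid x) by exact: (Hrep_mid ab Px Pv).
split=> //; last by move=> i /(tight_mid i Px)[].
apply: (Kdown (PhiK finset.set0) (carrier_face ab Pm)).
apply: (carrier_min ab (face_Phi _)).
have [q Qq QE] := Phi_carrier finset.set0.
have Qv := Phiv finset.set0; move: Qx Qv; rewrite QE => -[_ qx] [_ qv].
by split=> // i qi; apply/(tight_mid i Px); split; [exact: qx|exact: qv].
Qed.

(** The face [Phi (~: [set k])] is an edge at [v], so it has a lattice point other than [v]. If wall
    [k] were tight there, the point halfway to [v] would lie on all walls, hence have carrier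
    [[set v]]. *)
Lemma edge_exists : exists z : 'I_d -> 'rV[int]_n, forall k,
  Phi (finset.setC (finset.set1 k)) (map_mx intr (z k)) /\
  ~~ tight (map_mx intr (z k)) (wall k).
Proof.
suff H k : exists z : 'rV[int]_n,
  Phi (finset.setC (finset.set1 k)) (map_mx intr z) /\
  ~~ tight (map_mx intr z) (wall k).
  by have [w wP] := choice H; exists w.
set E := Phi _.
have Ev : E <> [set v].
  rewrite -Phi_setT => EE.
  have : E `<=` Phi finset.setT by rewrite EE.
  move/Phi_sub => /fintype.subsetP/(_ k); rewrite !inE eqxx; by move/(_ isT).
have [z Ez zv] := face_lattice_point latP (face_Phi _) Ev.
exists z; split=> //; apply/negP => zk; apply: zv.
set x := map_mx _ _ in Ez zk *.
have Qx : Phi finset.set0 x by apply: Phi_tight Ez (finset.sub0set _).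
have Px := PhiP Qx.
have wT : walls (mid x) = finset.setT.
  apply/finset.setP => j; rewrite !inE; apply/(tight_mid _ Px); split=> //.
  have [->//|jk] := eqVneq j k.
  apply: wall_facet; apply: Phi_tight Ez _.
  by rewrite finset.sub1set !inE.
have : carrier (mid x) x.
  by split=> // i /(tight_mid _ Px)[].
by rewrite (near_carrier (near_mid Qx)) wT Phi_setT.
Qed.

(** Equations of the linear space parallel to the affine hull of the maximal face [Phi set0]. *)
Definition in_span u :=
  forall i, (forall x, Phi finset.set0 x -> tight x i) -> dotp (a i) u = 0.

Lemma in_spanB x y : Phi finset.set0 x -> Phi finset.set0 y -> in_span (x - y).
Proof. by move=> Qx Qy i iQ; rewrite dotpBr (eqP (iQ x Qx)) (eqP (iQ y Qy))
  subrr. Qed.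

Lemma near_of x : Phi finset.set0 x -> (forall i, tight x i -> tight v i) ->
  near_v x.
Proof.
move=> Qx xv; have Px := PhiP Qx; split=> //.
apply: (Kdown (PhiK finset.set0) (carrier_face ab Px)).
exact: (carrier_min ab (face_Phi _)).
Qed.

(* Otherwise, moving from a relative interior point of [Phi set0] in the
   direction [u], an inequality tight at [v] becomes tight before any wall
   does, although every proper face through [v] lies in a wall. *)
Lemma wall_cone u : in_span u -> (forall k, dotp (a (wall k)) u <= 0) ->
  forall i, tight v i -> dotp (a i) u <= 0.
Proof.
move=> uQ uw i1 vi1; rewrite leNgt; apply/negP => ui1.
have [q Qq QE] := Phi_carrier finset.set0.
have Pq := PhiP Qq.
pose w := q - v.
have aw i : tight v i -> dotp (a i) w <= 0.
  by move=> /eqP vi; rewrite dotpBr vi subr_le0; exact: (ab q).1.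
have tQ i : tight q i -> forall x, Phi finset.set0 x -> tight x i.
  by move=> qi x; rewrite QE => -[_]; apply.
have awlt i : tight v i -> ~~ tight q i -> dotp (a i) w < 0.
  by move=> /eqP vi qi; rewrite dotpBr vi subr_lt0; exact: (not_tight ab Pq qi).
pose bad := [pred i | tight v i && (0 < dotp (a i) u)].
(* The time at which the ray from [w] in direction [u] reaches the hyperplane orthogonal to [a i];
   [j] below is a constraint reached first. *)
pose r i := - dotp (a i) w / dotp (a i) u.
have bad1 : bad i1 by rewrite /= vi1.
have badq i : bad i -> ~~ tight q i.
  move=> /andP[_ ui]; apply/negP => /tQ /uQ ui0.
  by rewrite ui0 ltxx in ui.
have [j /= /andP[vj uj] jmin] := arg_minP r bad1.
have badj : bad j by rewrite /= vj.
have r0 : 0 <= r j.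
  by apply: divr_ge0; [rewrite oppr_ge0 ltW // awlt // badq|exact: ltW].
pose y := w + r j *: u.
have ay i : dotp (a i) y = dotp (a i) w + r j * dotp (a i) u.
  by rewrite dotpDr dotpZr.
have yle i : tight v i -> dotp (a i) y <= 0.
  move=> vi; rewrite ay; have [ui|ui] := leP (dotp (a i) u) 0.
    by have := aw i vi; nra.
  have := jmin i; rewrite /= vi ui => /(_ isT).
  by rewrite {2}/r ler_pdivlMr // => ?; lra.
have [e e0 he] := step ab Pv yle.
have [|Px xv] := he e; first by rewrite lexx ltW.
set x := v + e *: y in Px xv.
have Qx : Phi finset.set0 x.
  rewrite QE; split=> // i qi; have iQ := tQ i qi.
  have vi : dotp (a i) v = b i by apply/eqP; apply: iQ; exact: Phiv.
  rewrite /tight dotpDr dotpZr ay (uQ _ iQ) vi /w dotpBr vi (eqP qi).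
  by rewrite subrr !mulr0 addr0 mulr0 addr0.
have nx := near_of Qx xv.
(* The walls are strictly negative on [w] and do not increase along [u]. Hence [x] has carrier
   [Phi set0], which contains [q], although [j] is tight at [x] and not at [q]. *)
have wx0 : walls x = finset.set0.
  apply/finset.setP => k; rewrite !inE; apply/negP => xk.
  have wq : ~~ tight q (wall k).
    by apply/negP => /tQ; exact: wall_proper.
  have := awlt _ (wall_v k) wq.
  move: xk; rewrite /tight dotpDr dotpZr (eqP (wall_v k)) => /eqP h.
  have : dotp (a (wall k)) y = 0.
    have : e * dotp (a (wall k)) y = 0 by lra.
    by move/eqP; rewrite mulf_eq0 gt_eqF //= => /eqP.
  rewrite ay; have := uw k; nra.
have : carrier x q by rewrite (near_carrier nx) wx0.
move=> [_ xq]; move: (badq j badj); rewrite xq //.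
rewrite /tight dotpDr dotpZr ay.
have -> : r j * dotp (a j) u = - dotp (a j) w by rewrite divfK ?gt_eqF.
by rewrite subrr mulr0 addr0.
Qed.

Variable z : 'I_d -> 'rV[int]_n.
Hypothesis edge_z : forall k,
  Phi (finset.setC (finset.set1 k)) (map_mx intr (z k)).
Hypothesis wall_z : forall k, ~~ tight (map_mx intr (z k)) (wall k).

Local Notation U := (\matrix_k (map_mx intr (z k) - v) : 'M[R]_(d, n)).
Let height k := b (wall k) - dotp (a (wall k)) (map_mx intr (z k)).

Lemma Phi0_z k : Phi finset.set0 (map_mx intr (z k)).
Proof. exact: Phi_tight (edge_z k) (finset.sub0set _). Qed.

Lemma height_gt0 k : 0 < height k.
Proof. by rewrite subr_gt0; apply: (not_tight ab (PhiP (Phi0_z k)) (wall_z k)).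
  Qed.

Lemma wall_edge j k : dotp (a (wall j)) (row k U) = - (height k *+ (j == k)).
Proof.
rewrite rowK dotpBr (eqP (wall_v j)); have [->|jk] := eqVneq j k.
  by rewrite /height mulr1n opprB.
suff /eqP -> : tight (map_mx intr (z k)) (wall j) by rewrite subrr mulr0n oppr0.
apply: wall_facet; apply: Phi_tight (edge_z k) _.
by rewrite finset.sub1set !inE.
Qed.

Lemma wall_chart j (y : 'rV[R]_d) : dotp (a (wall j)) (y *m U) = - (y 0 j *
  height j).
Proof.
rewrite dotp_mul_row (bigD1 j) //= wall_edge eqxx mulr1n mulrN.
rewrite big1 ?addr0 // => k kj.
by rewrite wall_edge eq_sym (negPf kj) mulr0n oppr0 mulr0.
Qed.

Lemma in_span_chart (y : 'rV[R]_d) : in_span (y *m U).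
Proof.
move=> i iQ; rewrite dotp_mul_row big1 // => k _.
by rewrite rowK in_spanB ?mulr0 //; exact: Phi0_z.
Qed.

(** By [wall_cone] for [u] and [- u], all inequalities tight at [v] vanish on [u], so a short move
    along [u] stays in the carrier of [v], which is the point [v]. *)
Lemma in_span_eq0 u : in_span u -> (forall k, dotp (a (wall k)) u = 0) -> u = 0.
Proof.
move=> uQ uw.
have H u' : in_span u' -> (forall k, dotp (a (wall k)) u' = 0) ->
    forall i, tight v i -> dotp (a i) u' <= 0.
  by move=> u'Q u'w; apply: wall_cone => // k; rewrite u'w.
have uv i : tight v i -> dotp (a i) u = 0.
  move=> vi; apply/eqP; rewrite eq_le H //= -oppr_le0 -dotpNr H //.
    by move=> j jQ; rewrite dotpNr uQ // oppr0.
  by move=> k; rewrite dotpNr uw oppr0.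
have [|e e0 he] := step ab Pv (u := u); first by move=> i /uv ->.
have [|Px _] := he e; first by rewrite lexx ltW.
have [p -> vE] := faceP ab face_v.
have : carrier v (v + e *: u).
  by split=> // i vi; rewrite /tight dotpDr dotpZr uv // mulr0 addr0.
move/(carrier_min ab face_v (erefl v)) => /= /eqP.
by rewrite -subr_eq0 addrAC subrr add0r scaler_eq0 gt_eqF //= => /eqP.
Qed.

Lemma in_span_coords u : in_span u ->
  u = (\row_k (- dotp (a (wall k)) u / height k)) *m U.
Proof.
move=> uQ; apply/eqP; rewrite -subr_eq0; apply/eqP; apply: in_span_eq0.
  by move=> i iQ; rewrite dotpBr uQ // in_span_chart // subrr.
move=> k; rewrite dotpBr wall_chart mxE divfK ?opprK ?subrr //.
by rewrite gt_eqF // height_gt0.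
Qed.

Lemma chart_free_U (y : 'rV[R]_d) : y *m U = 0 -> y = 0.
Proof.
move=> y0; apply/rowP => k; rewrite mxE; apply/eqP.
have /eqP := wall_chart k y; rewrite y0 dotp0r eq_sym oppr_eq0 mulf_eq0.
by rewrite [height k == 0]gt_eqF ?height_gt0 // orbF.
Qed.

Definition far := [pred i | ~~ tight v i].

(** The Minkowski functional of the maximal face seen from [v]. Only the constraints strict at [v]
    enter; those tight at [v] amount to [y >= 0] by [wall_cone]. *)
Definition gauge (y : 'rV[R]_d) : R :=
  \big[Num.max/0]_(i | far i) (dotp (a i) (y *m U) / (b i - dotp (a i) v)).

Lemma far_gt0 i : far i -> 0 < b i - dotp (a i) v.
Proof. by move=> fi; rewrite subr_gt0; exact: (not_tight ab Pv fi). Qed.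

Lemma gauge_le y c : 0 <= c -> gauge y <= c <->
  forall i, far i -> dotp (a i) (y *m U) <= c * (b i - dotp (a i) v).
Proof.
move=> c0; split=> [/bigmax_leP[_ h] i fi|h].
  by rewrite -ler_pdivrMr ?far_gt0 // h.
by apply/bigmax_leP; split=> // i fi; rewrite ler_pdivrMr ?far_gt0 // h.
Qed.

Lemma gauge_ge0 y : 0 <= gauge y. Proof. exact: bigmax_ge_id. Qed.

Lemma gauge_lt1 y : gauge y < 1 <->
  forall i, far i -> dotp (a i) (v + y *m U) < b i.
Proof.
split=> [/bigmax_ltP[_ h] i fi|h].
  by rewrite dotpDr -ltrBrDl -[ltRHS]mul1r -ltr_pdivrMr ?far_gt0 // h.
apply/bigmax_ltP; split=> // i fi.
by rewrite ltr_pdivrMr ?far_gt0 // mul1r ltrBrDl -dotpDr h.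
Qed.

Lemma chart_P (y : 'rV[R]_d) : (forall k, 0 <= y 0 k) -> gauge y <= 1 ->
  Phi finset.set0 (v + y *m U).
Proof.
move=> y0 /(gauge_le _ ler01) gy.
have [q Qq QE] := Phi_carrier finset.set0; rewrite QE; split.
  apply/ab => i; rewrite dotpDr; have [vi|vi] := boolP (tight v i).
    rewrite (eqP vi) gerDl; apply: wall_cone => // [|k].
      exact: in_span_chart.
    by rewrite wall_chart oppr_le0 mulr_ge0 // ltW // height_gt0.
  by have := gy i vi; rewrite mul1r lerBrDl.
move=> i qi; have iQ x : Phi finset.set0 x -> tight x i.
  by rewrite QE => -[_]; apply.
by rewrite /tight dotpDr in_span_chart // addr0; exact: iQ (Phiv _).
Qed.

Lemma chart_near (y : 'rV[R]_d) : (forall k, 0 <= y 0 k) -> gauge y < 1 ->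
  near_v (v + y *m U).
Proof.
move=> y0 gy; apply: near_of; first by apply: chart_P => //; exact: ltW.
move=> i ti; apply: contraT => vi.
by have := (gauge_lt1 y).1 gy i vi; rewrite (eqP ti) ltxx.
Qed.

Lemma chart_wall (y : 'rV[R]_d) k : tight (v + y *m U) (wall k) = (y 0 k == 0).
Proof.
rewrite /tight dotpDr wall_chart (eqP (wall_v k)) -subr_eq0 addrAC subrr add0r.
by rewrite oppr_eq0 mulf_eq0 [height k == 0]gt_eqF ?height_gt0 // orbF.
Qed.

Lemma gauge_cont : continuous gauge.
Proof.
apply: (@continuous_big R 'I_N Num.max 0 far) => [|i _ y].
  exact: max_continuous.
suff cf : continuous (fun y : 'rV[R]_d => dotp (a i) (y *m U)).
  exact: (@cvgMr_tmp R _ _ _ (fun y : 'rV[R]_d => dotp (a i) (y *m U))) (cf y).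
have -> : (fun y : 'rV[R]_d => dotp (a i) (y *m U)) =
    dotp (\row_k dotp (a i) (row k U)).
  apply/funext => y'; rewrite dotp_mul_row; apply: eq_bigr => k _.
  by rewrite mxE mulrC.
exact: dotp_continuous.
Qed.

Lemma gauge_scale t (y : 'rV[R]_d) : 0 <= t -> gauge (t *: y) = t * gauge y.
Proof.
move=> t0; rewrite /gauge.
have tmax : {morph *%R t : x y / Num.max x y} by move=> x x'; rewrite maxr_pMr.
rewrite (big_morph _ tmax (mulr0 t)).
by apply: eq_bigr => i _; rewrite -scalemxAl dotpZr mulrA.
Qed.

(** If the gauge vanished, the whole ray from [v] in direction [y *m U] would lie in the bounded set
    [P]. *)
Lemma gauge_pos (y : 'rV[R]_d) :
  (forall k, 0 <= y 0 k) -> y != 0 -> 0 < gauge y.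
Proof.
move=> y0 yn0; rewrite lt_neqAle gauge_ge0 andbT eq_sym; apply/eqP => g0.
have [M bndM] := lattice_polytope_bounded latP.
move/eqP: yn0; apply; apply: chart_free_U; apply/rowP => j; rewrite [RHS]mxE.
have H t : 0 <= t -> `|v 0 j + t * (y *m U) 0 j| <= M.
  move=> t0; have := bndM (v + (t *: y) *m U) j.
  have vE (w : 'rV[R]_n) : (v + t *: w) 0 j = v 0 j + t * w 0 j by rewrite !mxE.
  rewrite -scalemxAl vE; apply; rewrite scalemxAl.
  apply: (@PhiP finset.set0); apply: chart_P => [k|].
    by rewrite mxE mulr_ge0.
  by rewrite gauge_scale // g0 mulr0.
apply/eqP; apply: contraT => u0.
set u := (y *m U) 0 j in H u0 *.
have nu : 0 < `|u| by rewrite normr_gt0.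
have M0 : 0 <= M by apply: le_trans (H 0 _).
have := H ((M + `|v 0 j| + 1) / `|u|).
rewrite divr_ge0 // => [/(_ isT)|]; last by rewrite !addr_ge0.
set t := _ / _ => h.
have : `|t * u| = M + `|v 0 j| + 1.
  rewrite normrM [`|t|]ger0_norm; last by rewrite divr_ge0 // !addr_ge0.
  by rewrite divfK // gt_eqF.
have : `|t * u| <= `|v 0 j + t * u| + `|v 0 j|.
  by rewrite -[X in `|X| <= _](addKr (v 0 j)) addrC (le_trans (ler_normD _ _))
    // normrN.
by lra.
Qed.

Local Notation K' := (remove_vertex K v).

Lemma remove_vertexP F : K' F <-> K F /\ ~ F v.
Proof.
split=> -[KF Fv]; split=> // Fv'; apply: Fv.
  apply/(vertices_face ab v (KP KF)); split=> //; exact: face_v.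
by have [] := (vertices_face ab v (KP KF)).1 Fv'.
Qed.

Lemma near_not_removed q : near_v q -> ~ underlying K' q.
Proof.
move=> [Pq Kq qv] [F /remove_vertexP[KF nFv] Fq]; apply: nFv.
by apply: (carrier_min ab (KP KF) Fq); split=> //; exact: Pv.
Qed.

Lemma not_removed_near q : underlying K q -> ~ underlying K' q -> near_v q.
Proof.
move=> [F KF Fq] nq; have Pq := face_sub (KP KF) Fq.
have Kq : K (carrier q).
  apply: (Kdown KF (carrier_face ab Pq)).
  exact: (carrier_min ab (KP KF) Fq).
split=> // i qi; apply: contrapT => vi; apply: nq.
exists (carrier q) => //; apply/remove_vertexP; split=> // -[_ /(_ i qi)].
exact: vi.
Qed.

Lemma local_conical_chart : conical_chart P K K' v U gauge.
Proof.
split.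
- exact: chart_free_U.
- exact: gauge_cont.
- exact: gauge_scale.
- exact: gauge_pos.
- by move=> y y0 gy; exists (Phi finset.set0) => //; exact: chart_P.
- move=> y y0 gy.
  have Qy : Phi finset.set0 (v + y *m U) by apply: chart_P; rewrite ?gy.
  apply: contrapT => nK.
  have [] := not_removed_near _ nK; first by exists (Phi finset.set0).
  move=> Py _ yv; suff : gauge y < 1 by rewrite gy ltxx.
  apply/gauge_lt1 => i fi; apply: (not_tight ab Py).
  by apply/negP => /yv; exact/negP.
- by move=> y y0 gy; apply: near_not_removed; exact: chart_near.
- move=> y y0 gy x; have ny := chart_near y0 gy; have [Py Ky yv] := ny.
  rewrite (lie_isotropyP ab irr dimP x Py); split=> [h k yk|h u uy].
    apply: h => i ti; rewrite rowK dotpBr (eqP (yv i ti)).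
    suff : carrier (v + y *m U) (map_mx intr (z k)).
      by move=> [_ /(_ i ti)/eqP ->]; rewrite subrr.
    (* Since [y_k > 0], wall [k] is not tight at the point, so its carrier contains the edge in
       direction [k]. *)
    rewrite (near_carrier ny).
    suff /Phi_sub : walls (v + y *m U) \subset finset.setC (finset.set1 k).
      by apply; exact: edge_z.
    apply/fintype.subsetP => j; rewrite !inE chart_wall.
    by apply: contraTneq => ->; rewrite gt_eqF.
  (* Conversely [u] is a combination of edge vectors, and the coefficient of edge [k] is zero when
     [y_k = 0], because wall [k] is then tight. *)
  have uQ : in_span u by move=> i iQ; apply: uy; apply: iQ; exact: near_Phi0.
  rewrite (in_span_coords uQ) dotp_mul_row big1 // => k _.
  have [yk|yk] := eqVneq (y 0 k) 0; last first.
    by rewrite h ?mulr0 // lt_neqAle eq_sym yk y0.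
  by rewrite mxE uy ?oppr0 ?mul0r // chart_wall yk.
- move=> q Kq nKq; have nq := not_removed_near Kq nKq; have [Pq _ qv] := nq.
  have Qq := near_Phi0 nq.
  have uQ : in_span (q - v) by apply: in_spanB => //; exact: Phiv.
  pose y : 'rV[R]_d := \row_k (- dotp (a (wall k)) (q - v) / height k).
  have qE : q = v + y *m U by rewrite -(in_span_coords uQ) addrC subrK.
  exists y; split=> //.
    move=> k; rewrite mxE divr_ge0 //; last by rewrite ltW // height_gt0.
    by rewrite oppr_ge0 dotpBr (eqP (wall_v k)) subr_le0; exact: (ab q).1.
  apply/gauge_lt1 => i fi; rewrite -qE; apply: (not_tight ab Pq).
  by apply/negP => /qv; exact/negP.
- move=> y0 y0pos gy0; have ny0 := chart_near y0pos gy0.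
  have [Py0 _ y0v] := ny0.
  set q0 := v + y0 *m U in ny0 Py0 y0v *.
  (* If [rho q] is nonzero, every inequality tight at [q] is tight at [q0], hence at [v]. So the
     isotropy at [q] is contained in that at [q0], and each face containing [q] contains [v]. *)
  pose rho q := \prod_(i | ~~ tight q0 i) (b i - dotp (a i) q).
  have rhoP q : rho q != 0 -> forall i, tight q i -> tight q0 i.
    move=> /prodf_neq0 h i qi; apply: contraT => /h.
    by rewrite (eqP qi) subrr eqxx.
  exists rho; split.
  + apply: (@continuous_big R 'I_N *%R 1 (fun i => ~~ tight q0 i)) => [|i _ q].
      exact: mul_continuous.
    apply: (@cvgB R R _ (nbhs q) _ (fun=> b i) (dotp (a i))).
      exact: cvg_cst.
    exact: dotp_continuous.
  + by apply/prodf_neq0 => i; rewrite subr_eq0 eq_sym.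
  + move=> q [F /remove_vertexP[KF nFv] Fq]; apply/eqP; apply: contraT.
    move=> /rhoP h; case: nFv; apply: (carrier_min ab (KP KF) Fq).
    by split=> [|i /h /y0v //]; exact: Pv.
  + move=> q x Pq /rhoP h.
    rewrite (lie_isotropyP ab irr dimP x Pq) (lie_isotropyP ab irr dimP x Py0).
    by move=> hx u uq0; apply: hx => i /h; exact: uq0.
Qed.

End local_chart.

(** * The complexes of a retraction sequence *)

Section retraction.
Variables (R : realType) (n : nat) (P : set 'rV[R]_n).
Hypotheses (latP : lattice_polytope P) (dimP : has_dim P n).

Definition subcomplex (K : set (set 'rV[R]_n)) :=
  K `<=` faces P /\
  forall F F', K F -> face P F' -> F' `<=` F -> K F'.

Lemma exists_conical_chart K v d :
  subcomplex K -> K [set v] -> corner_nbhd K d v ->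
  exists (U : 'M[int]_(d, n)) (gauge : 'rV[R]_d -> R),
    conical_chart P K (remove_vertex K v) v (map_mx intr U) gauge.
Proof.
move=> [KP Kdown] Kv cK.
have [N [a [b [ab irr]]]] := irredundant_Hrep latP.
have [Phi [PhiK PhiE Phi_sub]] := corner_face_lattice ab KP Kv cK.
have PK I := (PhiK I).1; have Pv I := (PhiK I).2.
have [wall wallP] := wall_exists ab KP Kv Kdown PK Pv PhiE Phi_sub.
have w1 k : tight a b v (wall k) by have [] := wallP k.
have w2 k : ~ (forall x, Phi finset.set0 x -> tight a b x (wall k)).
  by have [] := wallP k.
have w3 k x : Phi (finset.set1 k) x -> tight a b x (wall k).
  by have [_ _ h _] := wallP k; exact: h.
have w4 k x : Phi finset.set0 x -> tight a b x (wall k) ->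
    Phi (finset.set1 k) x.
  by have [_ _ _ h] := wallP k; exact: h.
have [z zP] := edge_exists latP ab KP Kv Kdown PK Pv PhiE Phi_sub w1 w3 w4.
have e1 k := (zP k).1; have e2 k := (zP k).2.
have cc := local_conical_chart latP dimP ab irr KP Kv Kdown PK Pv PhiE Phi_sub
  w1 w2 w3 w4 e1 e2.
have [v0 vE] := vertex_lattice_point latP (KP _ Kv).
(* The vertex [v] is itself a lattice point [v0], so the edge vectors are integral. *)
exists (\matrix_k (z k - v0)), (gauge a b v z).
suff -> : map_mx intr (\matrix_k (z k - v0)) =
    \matrix_k (map_mx intr (z k) - v) :> 'M[R]_(d, n) by exact: cc.
apply/row_matrixP => k; rewrite -map_row !rowK vE.
by apply/rowP => j; rewrite !mxE intrB.
Qed.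

Lemma remove_vertex_subcomplex K v :
  subcomplex K -> subcomplex (remove_vertex K v).
Proof.
move=> [KP Kdown]; split=> [F [/KP]//|F F' [KF Fv] fF' F'F].
have [N [a [b ab]]] := lattice_polytope_Hrep latP.
split; first exact: Kdown KF fF' F'F.
move=> /(vertices_face ab v fF')[fv F'v]; apply: Fv.
by apply/(vertices_face ab v (KP _ KF)); split=> //; exact: F'F.
Qed.

Lemma retraction_subcomplex l K Q v : retraction_sequence P l K Q v ->
  forall m, (1 <= m <= l)%N -> subcomplex (K m).
Proof.
move=> [_ [K1 _ _ _] KS _ _] m; case: m => // m.
elim: m => [_|m IH ml].
  by rewrite K1; split.
rewrite KS; last by case/andP: ml => _ ->.
by apply: remove_vertex_subcomplex; apply: IH; case/andP: ml => _ /ltnW.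
Qed.

Lemma retraction_corner l K Q v : retraction_sequence P l K Q v ->
  forall m, (1 <= m < l)%N ->
    K m [set v m] /\ exists2 d, (0 < d)%N & corner_nbhd (K m) d (v m).
Proof.
move=> seqP m ml; have subK := retraction_subcomplex seqP.
have [cardP [K1 _ v1 c1] _ Kfree _] := seqP.
have [N [a [b ab]]] := lattice_polytope_Hrep latP.
have [m1|m1] := eqVneq m 1%N.
  rewrite m1 in ml *; split; first by rewrite K1.
  (* For the first vertex the dimension is [n]; if it were 0, [P] would have at most one vertex,
     against [1 < l]. *)
  exists n => //; rewrite lt0n; apply/eqP => n0; move: ml => /= l1.
  have : vertices P `<=` [set 0].
    by move=> x _; apply/rowP => j; have := ltn_ord j;
      rewrite [X in (_ < X)%N]n0.
  move/subset_card_le; rewrite (card_le_eql cardP) (card_le_eqr card_set1).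
  by rewrite card_le_II leqNgt l1.
have [|[[F KF Fv] [d [/andP[d1 _] cd]]] _] := Kfree m.
  by case/andP: ml => m0 ->; rewrite andbT ltn_neqAle eq_sym m1.
split; last by exists d.
have [KP Kdown] : subcomplex (K m).
  by apply: subK; case/andP: ml => -> /ltnW.
have [fv Fv'] := (vertices_face ab (v m) (KP _ KF)).1 Fv.
by apply: Kdown KF fv _ => _ ->.
Qed.

End retraction.

(** * The quotient of consecutive strata *)

Section dual_edges.
Variables (R : realType) (d n : nat) (U : 'M[int]_(d, n)).
Hypothesis freeU : forall y : 'rV[R]_d, y *m map_mx intr U = 0 -> y = 0.

(** The Gram matrix [G] is invertible because the edges are independent, and [\adj G *m U] is dual
    to [U] up to [\det G]. The extra factor [2 * \det G] makes the constant positive and larger than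
    1, so that ['Z_c] really is Z/c. *)
Lemma dual_lattice_basis : exists (L : 'M[int]_(d, n)) (c : nat),
  (1 < c)%N /\ L *m U^T = (c%:Z)%:M.
Proof.
pose G := U *m U^T.
have sq0 (u : 'rV[R]_n) : u *m u^T = 0 -> u = 0.
  move=> uu; have /eqP : dotp u u = 0 by rewrite dotpE uu mxE.
  rewrite /dotp psumr_eq0; last by move=> k _; rewrite -expr2 sqr_ge0.
  move=> /allP h; apply/rowP => j; rewrite mxE.
  by have := h j (mem_index_enum j); rewrite /= mulf_eq0 orbb => /eqP.
have detG : \det G != 0.
  rewrite -(intr_eq0 R) -det_map_mx; apply/negP => /det0P[y yn0].
  rewrite map_mxM -map_trmx mulmxA => yG.
  have /freeU y0 : y *m map_mx intr U = 0.
    by apply: sq0; rewrite trmx_mul mulmxA yG mul0mx.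
  by rewrite y0 eqxx in yn0.
exists ((2 * \det G) *: (\adj G *m U)), (absz (2 * \det G * \det G)).
have c0 : 0 <= 2 * \det G * \det G.
  by rewrite -mulrA mulr_ge0 // -expr2 sqr_ge0.
split.
  rewrite -ltz_nat gez0_abs //.
  have : 0 < \det G * \det G by rewrite -expr2 exprn_even_gt0.
  by rewrite gtz0_ge1 -mulrA => g2; lra.
rewrite gez0_abs // -scalemxAl -mulmxA -/G mul_adj_mx.
by rewrite scale_scalar_mx.
Qed.

End dual_edges.

Section toric_points.
Variables (R : realType) (n : nat) (P : set 'rV[R]_n).

Lemma toric_classP t s (p q : set_type P) :
  toric_class t p = toric_class s q <->
  p = q /\ isotropy P (set_val p) (tmul (tinv t) s).
Proof.
rewrite /toric_class; split=> [/eqmodP/asboolP //|pq].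
exact/eqmodP/asboolP.
Qed.

Lemma toric_class_surj (x : toric_variety P) : exists t p, x = toric_class t p.
Proof.
exists (repr (x : {eq_quot toric_equiv P})).1,
  (repr (x : {eq_quot toric_equiv P})).2.
by rewrite /toric_class -surjective_pairing reprK.
Qed.

Lemma toric_class_continuous (T : topologicalType) (f : T -> torus R n)
    (g : T -> set_type P) :
  continuous f -> continuous g -> continuous (fun x => toric_class (f x) (g x)).
Proof.
move=> cf cg x; rewrite /toric_class.
apply: (@continuous_comp T (torus R n * set_type P)%type (toric_variety P)
  (fun x => (f x, g x)) (fun y => \pi_(quotient_topology {eq_quot toric_equiv
    P}) y)).
  exact: continuous_pair.
exact: pi_continuous.
Qed.

Lemma toric_factor (Z : topologicalType) (f : torus R n -> set_type P -> Z) :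
  continuous (fun y : torus R n * set_type P => f y.1 y.2) ->
  (forall t s p, isotropy P (set_val p) (tmul (tinv t) s) -> f t p = f s p) ->
  exists2 g : toric_variety P -> Z, continuous g &
    forall t p, g (toric_class t p) = f t p.
Proof.
move=> cf ff; pose F (y : torus R n * set_type P) := f y.1 y.2.
have FE y y' : toric_rel y y' -> F y = F y'.
  by case: y y' => [t p] [s q] /asboolP[/= <-]; exact: ff.
exists (F \o (fun x : toric_variety P => repr (x : {eq_quot toric_equiv P}))).
  apply: (@repr_comp_continuous _ {eq_quot toric_equiv P}) => // y y' /eqP yy'.
  by apply/eqP/FE; apply/eqmodP.
move=> t p /=; apply: (FE _ (t, p)); apply/eqmodP.
by rewrite reprK.
Qed.

Lemma orbit_map_continuous : continuous (@orbit_map R n P).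
Proof.
have [||g cg gE] := @toric_factor _ (fun _ p => set_val p).
- move=> y; apply: (@continuous_comp _ _ _ snd set_val); first exact: cvg_snd.
  exact: continuous_set_val.
- by [].
suff -> : @orbit_map R n P = g by [].
apply/funext => x; have [t [p ->]] := toric_class_surj x.
by rewrite orbit_mapE gE.
Qed.

End toric_points.

(** * Polar parameters for a quotient of strata, and its Hausdorff property *)

Section stratum.
Variables (R : realType) (n : nat) (P : set 'rV[R]_n).
Variables (K K' : set (set 'rV[R]_n)) (v : 'rV[R]_n) (d : nat).
Variables (U : 'M[int]_(d, n)) (gauge : 'rV[R]_d -> R).
Local Notation Ur := (map_mx intr U : 'M[R]_(d, n)).
Hypothesis cc : conical_chart P K K' v Ur gauge.
Hypothesis KP : underlying K `<=` P.
Variables (L : 'M[int]_(d, n)) (c : nat).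
Hypotheses (c1 : (1 < c)%N) (LU : L *m U^T = (c%:Z)%:M).
Local Notation Lr := (map_mx intr L : 'M[R]_(d, n)).

Lemma cR_gt0 : 0 < c%:R :> R. Proof. by rewrite ltr0n ltnW. Qed.

Lemma LUr : Lr *m Ur^T = c%:R%:M.
Proof. by rewrite map_trmx -map_mxM LU map_scalar_mx. Qed.

Lemma dotp_edge x k : dotp x (row k Ur) = (x *m Ur^T) 0 k.
Proof. by rewrite dotpE mxE [RHS]mxE; apply: eq_bigr => j _; rewrite !mxE. Qed.

Lemma dotp_L (y : 'rV[R]_d) k : dotp (y *m Lr) (row k Ur) = c%:R * y 0 k.
Proof. by rewrite dotp_edge -mulmxA LUr mul_mx_scalar mxE. Qed.

Lemma floor_frac (t : R) : exists z : int, 0 <= t - z%:~R <= 1.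
Proof.
exists (Num.floor t); have /andP[] := floor_itv t.
rewrite intrD => h1 h2; lra.
Qed.

Lemma floor_frac_mx m (x : 'rV[R]_m) : exists z : 'rV[int]_m,
  forall j, 0 <= (x - map_mx intr z) 0 j <= 1.
Proof.
have [z zP] := choice (fun j => floor_frac (x 0 j)).
by exists (\row_j z j) => j; rewrite !mxE.
Qed.

Lemma compact_cube m : compact [set x : 'rV[R]_m | forall j, 0 <= x 0 j <= 1].
Proof.
have := @rV_compact R m (fun=> `[0, 1]%classic) (fun=> @segment_compact R 0 1).
suff -> : [set x : 'rV[R]_m | forall j, 0 <= x 0 j <= 1] =
  [set x : 'rV[R]_m | forall j, `[0, 1]%classic (x ord0 j)] by [].
by apply/seteqP; split=> x /= h j; have := h j; rewrite in_itv.
Qed.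

(** The logarithms of a torus element differ by lattice vectors, and only one of them has to lie in
    the Lie algebra. *)
Lemma isotropyE (y : 'rV[R]_d) x : (forall k, 0 <= y 0 k) -> gauge y < 1 ->
  isotropy P (v + y *m Ur) (texp x) <->
  exists z : 'rV[int]_n,
    forall k, 0 < y 0 k -> dotp (x + map_mx intr z) (row k Ur) = 0.
Proof.
move=> y0 gy; split=> [[w /(chart_lie cc y0 gy) hw /texp_eqP[z wE]]|[z hz]].
  by exists z => k yk; rewrite -wE hw.
exists (x + map_mx intr z); first exact/(chart_lie cc y0 gy).
by rewrite texpD texp_int tmulC tmul1.
Qed.

(* [W] is [c] times the projection, along the span of [L], onto the Lie
   algebra of the isotropy subtorus; it is integral, so that this subtorus is
   the image of the unit cube under [texp o W]. *)
Lemma isotropy_compact (y : 'rV[R]_d) : (forall k, 0 <= y 0 k) -> gauge y < 1 ->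
  exists2 S, compact S & isotropy P (v + y *m Ur) = @texp R n @` S.
Proof.
move=> y0 gy.
pose D : 'M[int]_d := diag_mx (\row_k Posz (0 < y 0 k)%R).
pose W : 'M[int]_n := (c%:Z)%:M - U^T *m D *m L.
have WE (x : 'rV[R]_n) : x *m map_mx intr W =
    c%:R *: x - (\row_k (if 0 < y 0 k then dotp x (row k Ur) else 0)) *m Lr.
  rewrite map_mxB map_scalar_mx mulmxBr mul_mx_scalar !map_mxM !mulmxA.
  congr (_ - _ *m _); rewrite map_diag_mx -map_trmx.
  apply/rowP => k; rewrite [RHS]mxE dotp_edge mul_mx_diag mxE mulrC.
  move: (x *m _) => w; rewrite !mxE.
  by case: ifP => _; rewrite ?mul1r ?mul0r.
exists ((fun x : 'rV[R]_n => x *m map_mx intr W) @`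
    [set x : 'rV[R]_n | forall j, 0 <= x 0 j <= 1]).
  apply: continuous_compact; last exact: compact_cube.
  apply: continuous_subspaceT; apply: continuous_mx => i j.
  have -> : (fun x : 'rV[R]_n => (x *m map_mx intr W) i j) =
      dotp (\row_k (map_mx intr W) k j).
    apply/funext => x; rewrite mxE dotpC ord1.
    by apply: eq_bigr => k _; rewrite [X in _ = _ * X]mxE.
  exact: dotp_continuous.
apply/seteqP; split=> [_ [x lx <-]|_ [_ [x _ <-] <-]].
  have xW : (c%:R^-1 *: x) *m map_mx intr W = x.
    rewrite WE scalerA divff ?gt_eqF ?cR_gt0 // scale1r.
    rewrite [X in X *m _](_ : _ = 0) ?mul0mx ?subr0 //.
    apply/rowP => k; rewrite !mxE dotpC dotpZr dotpC.
    case: ifP => // yk.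
    by rewrite ((chart_lie cc y0 gy x).1 lx k yk) mulr0.
  (* As [W] is integral, reducing [x / c] modulo the lattice does not change the image under
     [texp]. *)
  have [z zP] := floor_frac_mx (c%:R^-1 *: x).
  exists ((c%:R^-1 *: x - map_mx intr z) *m map_mx intr W).
    by exists (c%:R^-1 *: x - map_mx intr z).
  apply/texp_eqP; exists (- (z *m W)).
  by rewrite mulmxBl xW map_mxN map_mxM.
exists (x *m map_mx intr W) => //; apply/(chart_lie cc y0 gy) => k yk.
by rewrite WE dotpC dotpBr !(dotpC (row k Ur)) dotp_L mxE yk dotpZl subrr.
Qed.

Definition subspaceK : set (toric_variety P) := @orbit_map R n P @^-1`
  underlying K.
Definition subspaceK' : set (toric_variety P) :=
  @orbit_map R n P @^-1` underlying K'.

(** Points over different points of [P] are separated by the bump function, or by its product with a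
    coordinate when it takes equal values there. Points over the same point are separated by its
    product with a [coset_function]. *)
Lemma subspace_separation t (p : set_type P) x :
  ~ underlying K' (set_val p) -> underlying K (set_val p) ->
  subspaceK x ->  x <> toric_class t p ->
  exists2 f : toric_variety P -> R, continuous f &
    f x <> f (toric_class t p) /\ forall x', subspaceK' x' -> f x' = 0.
Proof.
have [s [q ->]] := toric_class_surj x.
move=> nK'p Kp; rewrite /subspaceK /= orbit_mapE => Kq neq.
have [y [y0 gy pE]] := chart_cover cc Kp nK'p.
have [rho [crho rhop rhoK' rhoI]] := chart_bump cc y0 gy.
rewrite -pE in rhop rhoI.
(* Functions [(t, q) |-> g t * (rho q * h q)] with [g] invariant under the
   isotropy group of [p] descend to the toric variety. *)
have build (g : torus R n -> R) (h : 'rV[R]_n -> R) :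
    continuous g -> continuous h ->
    (forall t u, isotropy P (set_val p) u -> g (tmul t u) = g t) ->
    exists2 f : toric_variety P -> R, continuous f &
      (forall t q, f (toric_class t q) =
        g t * (rho (set_val q) * h (set_val q))) /\
      forall x', subspaceK' x' -> f x' = 0.
  move=> cg ch gI.
  have [||f cf fE] := @toric_factor R n P _
      (fun t q => g t * (rho (set_val q) * h (set_val q))).
  - have cq : continuous (fun y : torus R n * set_type P => set_val y.2).
      move=> w; apply: (@continuous_comp _ _ _ snd set_val);
        first exact: cvg_snd.
      exact: continuous_set_val.
    have mulc (f1 f2 : torus R n * set_type P -> R) :
        continuous f1 -> continuous f2 -> continuous (fun w => f1 w * f2 w).
      by move=> c1' c2 w; exact: (@cvgM R _ (nbhs w) _ _ _ _ _ (c1' w) (c2 w)).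
    have ct w : continuous_at w (fun w : torus R n * set_type P => g w.1).
      by apply: continuous_comp; [exact: cvg_fst|exact: cg].
    have cr w : continuous_at w
        (fun w : torus R n * set_type P => rho (set_val w.2)).
      exact: (@continuous_comp _ _ _ _ rho w (cq w) (crho _)).
    have chq w : continuous_at w
        (fun w : torus R n * set_type P => h (set_val w.2)).
      exact: (@continuous_comp _ _ _ _ h w (cq w) (ch _)).
    exact: (mulc _ _ ct (mulc _ _ cr chq)).
  (* Where [rho] vanishes both values are 0; elsewhere the isotropy group of [q1] is contained in
     that of [p], under which [g] is invariant. *)
  - move=> t1 t2 q1 [u lu uE]; have [->|r0] := eqVneq (rho (set_val q1)) 0.
      by rewrite !mul0r !mulr0.
    congr (_ * _); have -> : t2 = tmul t1 (texp u).
      by rewrite uE tmulA (tmulC t1) tmulV tmul1.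
    rewrite gI //; exists u => //; apply: rhoI r0 lu.
    exact: set_valP.
  exists f => //; split=> // x'; have [t' [q' ->]] := toric_class_surj x'.
  by rewrite /subspaceK' /= orbit_mapE fE => /rhoK' ->; rewrite mul0r mulr0.
have [pq|pq] := pselect (set_val q = set_val p); last first.
  have [rr|rr] := eqVneq (rho (set_val q)) (rho (set_val p)); last first.
    have [||//|f cf [fE f0]] := build (fun=> 1) (fun=> 1);
      try exact: cst_continuous.
    exists f => //; split=> //; rewrite !fE !mulr1 !mul1r.
    exact/eqP.
  have [j pqj] : exists j, set_val q 0 j <> set_val p 0 j.
    by apply: contrapT => /forallNP h; apply: pq; apply/rowP => j;
      apply: contrapT; exact: h.
  have [||//|f cf [fE f0]] := build (fun=> 1) (fun x => x 0 j).
  - exact: cst_continuous.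
  - exact: coord_continuous.
  exists f => //; split=> //; rewrite !fE !mul1r rr.
  by move/(mulfI rhop).
have {}pq : q = p by exact: val_inj.
subst q.
have [S cS SE] := isotropy_compact y0 gy; rewrite -pE in SE.
have [g [cg gI gt g0]] := coset_function t cS SE (isotropy1 P (set_val p))
  (@isotropyM _ _ P (set_val p)) (@isotropyV _ _ P (set_val p)).
have [||//|f cf [fE f0]] := build g (fun=> 1) => //.
  exact: cst_continuous.
exists f => //; split=> //; rewrite !fE gt mul0r mulr1 => /eqP.
rewrite mulf_eq0 (negPf rhop) orbF => /eqP/g0 I.
by apply: neq; apply/toric_classP.
Qed.

(** Of two distinct points at least one is not the collapsed point, so [subspace_separation]
    applies; its functions vanish on [subspaceK'] and therefore factor through the collapse. *)
Lemma subquotient_hausdorff : hausdorff_space (subquotient subspaceK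
  subspaceK').
Proof.
apply: (@separating_hausdorff R) => y y' yy'.
have [ps _] := @collapse_pi_quotient (set_type subspaceK) (set_val @^-1`
  subspaceK').
have [x xE] := ps y; have [x' x'E] := ps y'.
have key (x1 x2 : set_type subspaceK) : x1 <> x2 -> ~ subspaceK' (set_val x1) ->
    exists2 f : subquotient subspaceK subspaceK' -> R, continuous f &
      f (collapse_pi _ x1) <> f (collapse_pi _ x2).
  move=> x12 nx1; have [t [p pE]] := toric_class_surj (set_val x1).
  have Kx1 : subspaceK (set_val x1) := set_valP x1;
    rewrite pE /subspaceK /= orbit_mapE in Kx1.
  rewrite pE /subspaceK' /= orbit_mapE in nx1.
  have [|f cf [f12 f0]] := subspace_separation (t := t) nx1 Kx1 (set_valP x2).
    by rewrite -pE => e; apply: x12; exact/val_inj/esym.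
  have [||F cF FE] := @collapse_factor _ (set_val @^-1` subspaceK') _
      (fun x : set_type subspaceK => f (set_val x)).
  - move=> w; apply: (@continuous_comp _ _ _ set_val f); last exact: cf.
    exact: continuous_set_val.
  - by move=> w w' /f0 -> /f0 ->.
  by exists F => //; rewrite !FE pE; exact: nesym.
have xx' : ~ (x = x' \/ subspaceK' (set_val x) /\ subspaceK' (set_val x')).
  move=> /(@collapse_piP (set_type subspaceK) (set_val @^-1` subspaceK')).
  by rewrite xE x'E.
have [xK'|nxK'] := pselect (subspaceK' (set_val x)); last first.
  have [|f cf ff] := key x x' _ nxK'; first by move=> e; apply: xx'; left.
  by exists f => //; rewrite -xE -x'E.
have [||f cf ff] := key x' x.
- by move=> e; apply: xx'; left.
- by move=> x'K'; apply: xx'; right.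
by exists f => //; rewrite -xE -x'E; exact: nesym.
Qed.

(** Angles are numbers in the closed unit cube and the direction is a Euclidean unit vector in the
    orthant. The identifications of 0 with 1, and of all directions at radius 0, are left to the two
    quotient maps. *)
Definition params : set ('rV[R]_d * 'rV[R]_d * R) :=
  [set w : 'rV[R]_d * 'rV[R]_d * R | [/\ forall j, 0 <= w.1.1 0 j <= 1, forall
    k, 0 <= w.1.2 0 k,
              \sum_k w.1.2 0 k ^+ 2 = 1 & 0 <= w.2 <= 1]].

Lemma compact_params : compact params.
Proof.
pose S := [set x : 'rV[R]_d | (forall k, 0 <= x 0 k <= 1) /\
  \sum_k x 0 k ^+ 2 = 1].
have cS : compact S.
  apply: compact_closedI; first exact: compact_cube.
  have -> : (fun x : 'rV[R]_d => \sum_k x 0 k ^+ 2 = 1) =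
    (fun x => \sum_k x 0 k ^+ 2) @^-1` [set 1] by [].
  apply: preimage_closed.
    suff cf : continuous (fun x : 'rV[R]_d => \sum_k x 0 k ^+ 2) by move=> x _;
      exact: cf.
    apply: (@continuous_sumR R 'rV[R]_d 'I_d (fun k x => x 0 k ^+ 2)) => k x.
    apply: (@continuous_comp _ _ _ (fun x : 'rV[R]_d => x 0 k)
      (fun t => t ^+ 2)); first exact: coord_continuous.
    exact: exprn_continuous.
  exact: closed_eq.
have := compact_setX (compact_setX (@compact_cube d) cS)
  (@segment_compact R 0 1).
congr compact; apply/seteqP; split=> [[[th x] r] /= [[h1 [h2 h3]] h4]|].
  by split=> //= k; have /andP[] := h2 k.
move=> [[th x] r] /= [h1 h2 h3 h4]; split; last by rewrite /= in_itv.
split=> //; split=> // k /=; rewrite h2 /=.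
rewrite -(@ler_pXn2r _ 2) ?nnegrE //= expr1n -h3 (bigD1 k) //= lerDl.
by apply: sumr_ge0 => j _; exact: sqr_ge0.
Qed.

Local Notation C := (set_type params).
Definition angle (w : C) : 'rV[R]_d := (set_val w).1.1.
Definition dir (w : C) : 'rV[R]_d := (set_val w).1.2.
Definition radius (w : C) : R := (set_val w).2.

Lemma paramsP (w : C) : [/\ forall j, 0 <= angle w 0 j <= 1,
  forall k, 0 <= dir w 0 k, \sum_k dir w 0 k ^+ 2 = 1 & 0 <= radius w <= 1].
Proof. exact: (set_valP w). Qed.

Lemma params_intro (th x : 'rV[R]_d) (r : R) : (forall j, 0 <= th 0 j <= 1) ->
  (forall k, 0 <= x 0 k) -> \sum_k x 0 k ^+ 2 = 1 -> 0 <= r <= 1 ->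
  exists w : C, [/\ angle w = th, dir w = x & radius w = r].
Proof.
move=> h1 h2 h3 h4.
have hp : params (th, x, r) by split.
by exists (exist _ (th, x, r) (mem_set hp) : C).
Qed.

Lemma angle_continuous : continuous angle.
Proof.
move=> w; apply: (@continuous_comp _ _ _ (fun w : C => (set_val w).1) fst).
  apply: (@continuous_comp _ _ _ set_val fst); first exact: continuous_set_val.
  exact: cvg_fst.
exact: cvg_fst.
Qed.

Lemma dir_continuous : continuous dir.
Proof.
move=> w; apply: (@continuous_comp _ _ _ (fun w : C => (set_val w).1) snd).
  apply: (@continuous_comp _ _ _ set_val fst); first exact: continuous_set_val.
  exact: cvg_fst.
exact: cvg_snd.
Qed.

Lemma radius_continuous : continuous radius.
Proof.
move=> w; apply: (@continuous_comp _ _ _ set_val snd).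
  exact: continuous_set_val.
exact: cvg_snd.
Qed.

Lemma dir_ge0 w k : 0 <= dir w 0 k. Proof. by have [] := paramsP w. Qed.

Lemma radius_ge0 w : 0 <= radius w. Proof. by have [_ _ _ /andP[]] := paramsP
  w. Qed.

Lemma radius_le1 w : radius w <= 1. Proof. by have [_ _ _ /andP[]] := paramsP
  w. Qed.

Lemma dir_neq0 w : dir w != 0.
Proof.
apply/eqP => x0; have [_ _ + _] := paramsP w.
rewrite x0 big1 => [/eqP|k _]; first by rewrite eq_sym oner_eq0.
by rewrite mxE expr0n.
Qed.

Lemma gauge0 : gauge 0 = 0.
Proof.
by rewrite -[X in gauge X](scale0r (0 : 'rV[R]_d)) (gaugeZ cc) // mul0r.
Qed.

Lemma gauge_dir w : 0 < gauge (dir w).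
Proof. exact: (gauge_gt0 cc (dir_ge0 w) (dir_neq0 w)). Qed.

(** Rescaled so that the gauge equals the radius; the unit sphere then corresponds exactly to the
    removed faces. *)
Definition chart_coords w := (radius w / gauge (dir w)) *: dir w.

Lemma chart_coords_ge0 w k : 0 <= chart_coords w 0 k.
Proof.
by rewrite mxE mulr_ge0 ?dir_ge0 // divr_ge0 ?radius_ge0 // ltW // gauge_dir.
Qed.

Lemma gauge_chart_coords w : gauge (chart_coords w) = radius w.
Proof.
rewrite (gaugeZ cc); first by rewrite divfK // gt_eqF // gauge_dir.
by rewrite divr_ge0 ?radius_ge0 // ltW // gauge_dir.
Qed.

Definition chart_point w := v + chart_coords w *m Ur.

Lemma chart_point_in w : underlying K (chart_point w).
Proof.
apply: (chart_in cc) => [k|]; first exact: chart_coords_ge0.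
by rewrite gauge_chart_coords radius_le1.
Qed.

Lemma chart_point_removed w : underlying K' (chart_point w) <-> radius w = 1.
Proof.
have y0 := chart_coords_ge0 w; split=> [|r1]; last first.
  by apply: (chart_boundary cc) => //; rewrite gauge_chart_coords.
move=> Kw; apply/eqP; rewrite eq_le radius_le1 leNgt; apply/negP => r1.
by apply: (chart_interior cc y0) Kw; rewrite gauge_chart_coords.
Qed.

Lemma chart_point_continuous : continuous chart_point.
Proof.
apply: continuous_mx => i j.
have -> : (fun w => chart_point w i j) = (fun w => v i j +
    radius w / gauge (dir w) * dotp (\row_k Ur k j) (dir w)).
  apply/funext => w; rewrite /chart_point -scalemxAl mxE [X in _ + X]mxE.
  congr (_ + _ * _); rewrite dotpC mxE ord1.
  by apply: eq_bigr => k _; rewrite [in RHS]mxE.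
move=> w; apply: (@cvgD R R _ (nbhs w)); first exact: cvg_cst.
apply: (@cvgM R _ (nbhs w)); last first.
  apply: (@continuous_comp _ _ _ dir (dotp (\row_k Ur k j))).
    exact: dir_continuous.
  exact: dotp_continuous.
apply: (@cvgM R _ (nbhs w)); first exact: radius_continuous.
apply: (@cvgV R _ (nbhs w)); first by rewrite gt_eqF // gauge_dir.
apply: (@continuous_comp _ _ _ dir gauge); first exact: dir_continuous.
exact: (gauge_continuous cc).
Qed.

Definition Ppoint w : set_type P :=
  exist _ (chart_point w) (mem_set (KP (chart_point_in w))).

Definition toric_param_point w : toric_variety P :=
  toric_class (texp (angle w *m Lr)) (Ppoint w).

Lemma toric_param_in w : subspaceK (toric_param_point w).
Proof.
rewrite /subspaceK /toric_param_point /= orbit_mapE; exact: chart_point_in.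
Qed.

Lemma toric_param_removed w :
  subspaceK' (toric_param_point w) <-> radius w = 1.
Proof.
rewrite /subspaceK' /toric_param_point /= orbit_mapE;
  exact: chart_point_removed.
Qed.

Definition toric_param w : subquotient subspaceK subspaceK' :=
  collapse_pi _ (exist _ (toric_param_point w) (mem_set (toric_param_in w))
    : set_type subspaceK).

Lemma mulmx_continuous m p (M : 'M[R]_(m, p)) :
  continuous (fun x : 'rV[R]_m => x *m M).
Proof.
apply: continuous_mx => i j.
have -> : (fun x : 'rV[R]_m => (x *m M) i j) = dotp (\row_k M k j).
  apply/funext => x; rewrite mxE dotpC ord1.
  by apply: eq_bigr => k _; rewrite [in RHS]mxE.
exact: dotp_continuous.
Qed.

Lemma toric_param_continuous : continuous toric_param.
Proof.
have cpi := quotient_map_continuous (@collapse_pi_quotient (set_type subspaceK)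
  (set_val @^-1` subspaceK')).
move=> w; apply: (@continuous_comp _ (set_type subspaceK) _
  (fun w => exist _ (toric_param_point w) (mem_set (toric_param_in w)))
  (@collapse_pi _ _)); last exact: cpi.
move: w; apply: continuous_to_set_type.
apply: toric_class_continuous; last first.
  by apply: continuous_to_set_type; exact: chart_point_continuous.
move=> w; apply: (@continuous_comp C _ _ (fun w => angle w *m Lr) (@texp R n));
  last exact: texp_continuous.
apply: (@continuous_comp _ _ _ angle (fun x : 'rV[R]_d => x *m Lr)).
  exact: angle_continuous.
exact: mulmx_continuous.
Qed.

Lemma toric_param_surj : (0 < d)%N -> forall y, exists w, toric_param w = y.
Proof.
move=> d0 y; have [ps _] := @collapse_pi_quotient (set_type subspaceK)
  (set_val @^-1` subspaceK').
have [x <-] := ps y.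
(* A direction for the two cases in which the point determines none: the collapsed point and the
   apex [yy = 0]. *)
pose e : 'rV[R]_d := delta_mx 0 (Ordinal d0).
have e0 k : 0 <= e 0 k by rewrite mxE; case: eqP => // _; case: eqP.
have e1 : \sum_k e 0 k ^+ 2 = 1.
  rewrite (bigD1 (Ordinal d0)) //= big1 => [|k kj].
    by rewrite mxE !eqxx expr1n addr0.
  by rewrite mxE (negPf kj) andbF expr0n.
have [xK'|nxK'] := pselect (subspaceK' (set_val x)).
  have th0 j : 0 <= (0 : 'rV[R]_d) 0 j <= 1 by rewrite mxE lexx ler01.
  have r1 : 0 <= (1 : R) <= 1 by rewrite ler01 lexx.
  have [w [_ _ w1]] := params_intro th0 e0 e1 r1.
  exists w; apply/collapse_piP; right; split=> //.
  exact/toric_param_removed.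
have [t [p xE]] := toric_class_surj (set_val x).
have Kx : subspaceK (set_val x) := set_valP x.
rewrite xE /subspaceK /= orbit_mapE in Kx.
rewrite xE /subspaceK' /= orbit_mapE in nxK'.
have [yy [y0 gy pE]] := chart_cover cc Kx nxK'.
have [u uE] := texp_surj t.
(* With these angles [s *m Lr] and [u] have the same product with every edge vector, so they differ
   by an element of the isotropy Lie algebra. Dropping the integral part [z] changes [s *m Lr] by
   the lattice vector [z *m L]. *)
pose s : 'rV[R]_d := \row_k (c%:R^-1 * dotp u (row k Ur)).
have [z zP] := floor_frac_mx s.
pose nrm := Num.sqrt (\sum_k yy 0 k ^+ 2).
pose xx := if yy == 0 then e else nrm^-1 *: yy.
have nrm_gt0 : yy != 0 -> 0 < nrm.
  move=> yn0; rewrite sqrtr_gt0 lt_neqAle sumr_ge0 ?andbT; last first.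
    by move=> k _; exact: sqr_ge0.
  apply: contra_neq yn0 => /esym/eqP; rewrite psumr_eq0; last first.
    by move=> k _; exact: sqr_ge0.
  move=> /allP h; apply/rowP => k; rewrite mxE.
  by have := h k (mem_index_enum k); rewrite /= sqrf_eq0 => /eqP.
have [|||w [wth wx wr]] := @params_intro (s - map_mx intr z) xx (gauge yy) zP.
- rewrite /xx => k; case: eqVneq => [_|/nrm_gt0 h]; first exact: e0.
  by rewrite mxE mulr_ge0 // invr_ge0 ltW.
- rewrite /xx; case: eqVneq => // /nrm_gt0 h.
  under eq_bigr do rewrite mxE exprMn.
  rewrite -mulr_sumr -[X in _ * X]sqr_sqrtr; last first.
    by apply: sumr_ge0 => k _; exact: sqr_ge0.
  by rewrite -exprMn mulVf ?expr1n // gt_eqF.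
- apply/andP; split; last exact: ltW.
  have [->|yn0] := eqVneq yy 0.
    by rewrite gauge0.
  by apply: ltW; exact: (gauge_gt0 cc).
have cw : chart_coords w = yy.
  rewrite /chart_coords wx wr /xx; case: eqVneq => [->|yn0].
    by rewrite gauge0 mul0r scale0r.
  have gy0 := gauge_gt0 cc y0 yn0; have h := nrm_gt0 yn0.
  rewrite (gaugeZ cc) ?invr_ge0 ?(ltW h) // scalerA invfM invrK.
  by rewrite mulrCA mulfV ?gt_eqF // mulr1 divff ?scale1r ?gt_eqF.
exists w; apply/collapse_piP; left; apply: val_inj => /=.
rewrite -[RHS]/(set_val x) xE; apply/toric_classP; split.
  by apply: val_inj; rewrite /= /chart_point cw -pE.
have -> : set_val (Ppoint w) = v + yy *m Ur by rewrite -cw.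
rewrite -uE -texpN -texpD.
apply/(isotropyE _ y0 gy); exists (- (z *m L)) => k _.
have sk : c%:R * s 0 k = dotp u (row k Ur).
  by rewrite mxE mulrA mulfV ?mul1r // gt_eqF // cR_gt0.
rewrite wth map_mxN map_mxM mulmxBl !(dotpDl, dotpNl, dotpBl) !dotp_L sk.
by ring.
Qed.

End stratum.

(** * The orbifold bundle and its Thom space *)

Section trivial_bundle.
Variables (R : realType) (B : topologicalType) (b0 : B) (k : nat).
Hypothesis base_point : forall b : B, b = b0.
Local Notation V := 'cV[R[i]^o]_k.

Definition cV_scale (a : R[i]) (v : V) : V := map_mx (fun z : R[i] => a * z) v.

Lemma point_local_triviality (b : B) :
  exists (U : set B) (phi : V -> V) (psi : B * V -> V),
      let pU := (fun=> b0) @^-1` U in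
      [/\ open U /\ U b,
          {within pU, continuous phi} /\
            {within U `*` setT, continuous psi},
          (forall v, pU v -> psi (b0, phi v) = v) /\
            (forall c z, U c -> b0 = c /\ phi (psi (c, z)) = z),
          (forall u v, pU u -> b0 = b0 ->
             b0 = b0 /\ phi (u + v) = phi u + phi v)
        & (forall a v, pU v ->
             b0 = b0 /\ phi (cV_scale a v) = map_mx (fun z : R[i] => a * z)
               (phi v))].
Proof.
exists setT, id, snd; split.
- by split=> //; exact: openT.
- split; apply: continuous_subspaceT => x; first exact: cvg_id.
  exact: cvg_snd.
- by split=> // a z _; rewrite (base_point a).
- by [].
- by [].
Qed.

Lemma const_continuous : continuous ((fun=> b0) : V -> B).
Proof. exact: cst_continuous. Qed.

Definition point_bundle : complex_bundle R B k :=
  @Build_complex_bundle R B k V (fun=> b0) (fun u v => u + v) cV_scale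
    const_continuous point_local_triviality.

Definition hermitian (u v : V) : R[i] := \sum_j u j 0 * (v j 0)^*.

Lemma hermitianE u : hermitian u u = (\sum_j cabs (u j 0) ^+ 2)%:C%C.
Proof.
rewrite rmorph_sum /=; apply: eq_bigr => j _.
by rewrite -normCK -cabsE rmorphXn.
Qed.

Lemma cV_coord_continuous (T : topologicalType) m p i j :
  continuous (fun M : 'M[T]_(m, p) => M i j).
Proof.
move=> M A nA; exists (fun i' j' => if (i' == i) && (j' == j) then A else setT).
  by move=> i' j' /=; case: ifP => [/andP[/eqP-> /eqP->]|_] //; exact: filterT.
by move=> M' /= /(_ i j); rewrite !eqxx.
Qed.

Lemma scale_continuous (T : topologicalType) (f : T -> R[i]^o) (a : R[i]^o) :
  continuous f -> continuous (fun x => a * f x).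
Proof. by move=> cf x; exact: (@cvgMl_tmp R[i] T (nbhs x) _ f a _ (cf x)). Qed.

Lemma hermitian_continuous : continuous (fun u : V => hermitian u u : R[i]^o).
Proof.
have -> : (fun u : V => hermitian u u : R[i]^o) =
    (fun u : V => (\sum_j cabs (u j 0) ^+ 2)%:C%C : R[i]^o).
  by apply/funext => u; rewrite hermitianE.
apply: (@continuous_ReIm R V (fun u => \sum_j cabs (u j 0) ^+ 2) (fun=> 0));
  last exact: cst_continuous.
apply: (@continuous_sumR R V 'I_k (fun j u => cabs (u j 0) ^+ 2)) => j u.
apply: (@continuous_comp V R R (fun u => cabs (u j 0)) (fun t => t ^+ 2)).
  apply: (@continuous_comp V R[i]^o R (fun u => u j 0) (@cabs R)).
    exact: cV_coord_continuous.
  exact: cabs_continuous.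
exact: exprn_continuous.
Qed.

Lemma hermitian_ge0 u : 0 <= hermitian u u.
Proof.
by rewrite hermitianE lecR; apply: sumr_ge0 => j _; exact: sqr_ge0.
Qed.

Lemma hermitian_eq0 u : hermitian u u = 0 -> u = 0.
Proof.
rewrite hermitianE => /complexI/eqP; rewrite psumr_eq0; last first.
  by move=> j _; exact: sqr_ge0.
move=> /allP h; apply/colP => j; rewrite mxE.
by have := h j (mem_index_enum j); rewrite /= sqrf_eq0 cabs_eq0 => /eqP.
Qed.

Lemma hermitian_hermitian : @hermitian_metric R B k point_bundle hermitian.
Proof.
split.
- exact: hermitian_continuous.
- move=> u v w _ _; rewrite /hermitian -big_split /=.
  by apply: eq_bigr => j _; rewrite mxE mulrDl.
- move=> a u v _; rewrite /hermitian mulr_sumr.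
  by apply: eq_bigr => j _; rewrite mxE mulrA.
- move=> u v _; rewrite /hermitian rmorph_sum /=.
  by apply: eq_bigr => j _; rewrite rmorphM /= conjCK mulrC.
- move=> v; split; first exact: hermitian_ge0.
  move=> /hermitian_eq0 ->; apply/colP => j.
  by rewrite !mxE mul0r.
Qed.

End trivial_bundle.

(** * The action of (Z/c)^n with weights the edge vectors *)

Section weight_action.
Variables (R : realType) (n d : nat) (U : 'M[int]_(d, n)) (c : nat).
Hypothesis c1 : (1 < c)%N.
Local Notation A := 'rV['Z_c]_n.
Local Notation V := 'cV[R[i]^o]_d.

Definition lift_Zc (a : A) : 'rV[int]_n := \row_j Posz (a 0 j).

Lemma val_ZcD (x y : 'Z_c) :
  nat_of_ord (x + y) = ((nat_of_ord x + nat_of_ord y) %% c)%N.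
Proof.
(* The modulus built into ['Z_c] is [(Zp_trunc c).+2], which equals [c] because [1 < c]. *)
transitivity ((nat_of_ord x + nat_of_ord y) %% (Zp_trunc c).+2)%N; first by [].
by move: (nat_of_ord x + nat_of_ord y)%N => m; rewrite Zp_cast.
Qed.

Lemma val_inZp m : nat_of_ord (inZp m : 'Z_c) = (m %% c)%N.
Proof.
transitivity (m %% (Zp_trunc c).+2)%N; first by [].
by rewrite Zp_cast.
Qed.

Lemma lift_ZcD (a b : A) : exists m : 'rV[int]_n,
  lift_Zc (a + b) = lift_Zc a + lift_Zc b - c%:Z *: m.
Proof.
exists (\row_j Posz ((nat_of_ord (a 0%R j) + nat_of_ord (b 0%R j)) %/ c)%N).
apply/rowP => j; rewrite !mxE val_ZcD.
move: (nat_of_ord (a _ _)) (nat_of_ord (b _ _)) => x y.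
rewrite -PoszD {2}(divn_eq (x + y)%N c) PoszD PoszM mulrC.
by rewrite addrAC subrr add0r.
Qed.

Lemma lift_Zc_surj (z : 'rV[int]_n) : exists (a : A) (m : 'rV[int]_n),
  lift_Zc a = z + c%:Z *: m.
Proof.
have c0 : c%:Z != 0 by rewrite eqz_nat -lt0n ltnW.
exists (\row_j inZp (absz (modz (z 0 j) c))), (\row_j (- divz (z 0 j) c)).
apply/rowP => j; rewrite !mxE val_inZp modn_small.
  rewrite gez0_abs ?modz_ge0 //; have := divz_eq (z 0 j) c.
  by move: (modz _ _) (divz _ _) => r q ->; ring.
by rewrite -ltz_nat gez0_abs ?modz_ge0 // ltz_pmod // ltz_nat ltnW.
Qed.

(** The character of (Z/c)^n given by the edge [k]. It arises since [th *m L + z] is orthogonal to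
    that edge iff [c th_k = - z . u_k]: lattice vectors shift the angles by multiples of [1 / c]. *)
Definition weight (a : A) (k : 'I_d) : R[i] :=
  cexp (((lift_Zc a *m U^T) 0 k)%:~R / c%:R).

Lemma weightD a b k : weight (a + b) k = weight a k * weight b k.
Proof.
rewrite /weight; have [m ->] := lift_ZcD a b.
have cn0 : c%:R != 0 :> R by rewrite pnatr_eq0 -lt0n ltnW.
have -> : (lift_Zc a + lift_Zc b - c%:Z *: m) *m U^T =
    lift_Zc a *m U^T + lift_Zc b *m U^T - c%:Z *: (m *m U^T).
  by rewrite mulmxBl mulmxDl -scalemxAl.
move: (lift_Zc a *m _) (lift_Zc b *m _) (m *m _) => x y z.
rewrite !mxE intrB intrD mulrBl intrM mulrAC mulfV // mul1r -mulrNz cexpD.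
have -> : cexp (((- z 0 k)%:~R) : R) = 1 by apply/cexp_eq1; exists (- z 0 k).
by rewrite mulr1 mulrDl cexpD.
Qed.

Lemma norm_weight a k : `|weight a k| = 1.
Proof. exact: norm_cexp. Qed.

Lemma weight0 k : weight 0 k = 1.
Proof.
have := weightD 0 0 k; rewrite addr0 -{1}[weight 0 k]mulr1.
by move/mulfI => <- //; exact: cexp_neq0.
Qed.

Definition weight_act (a : A) (v : V) : V := \col_k (weight a k * v k 0).

End weight_action.

Section weight_orbibundle.
Variables (R : realType) (n d : nat) (U : 'M[int]_(d, n)) (c : nat).
Hypothesis c1 : (1 < c)%N.
Variables (B : topologicalType) (b0 : B) (actB : torus R n -> B -> B).
Hypothesis base_point : forall b : B, b = b0.
Local Notation A := 'rV['Z_c]_n.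
Local Notation V := (point_bundle R d base_point).

(* Over a one-point base, [simple_orbibundle] does not relate the torus action
   on the total space to the one on the toric variety, and the trivial action is
   admissible. The action of [(Z / c)^n] need not be effective. *)
Let triv_act (t : torus R n) (u : V) : V := u.

Let act (a : A) : V -> V := weight_act U a.

Lemma triv_act_action : torus_action triv_act.
Proof. by split=> // w; exact: cvg_snd. Qed.

Lemma triv_act_proj t (u : V) : Defs.proj (triv_act t u) = actB t (Defs.proj u).
Proof. by rewrite [RHS]base_point. Qed.

Lemma triv_act_linear t : fiberwise_linear (triv_act t).
Proof. by []. Qed.

Lemma act1 (u : V) : act 1%g u = u.
Proof. by apply/colP => j; rewrite mxE (weight0 R U c1) mul1r. Qed.

Lemma actM (a b : A) (u : V) : act (a * b)%g u = act a (act b u).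
Proof.
by apply/colP => j; rewrite !mxE FinRing.zmodMgE (weightD R U c1) mulrA.
Qed.

Lemma act_continuous a : continuous (act a).
Proof.
apply: continuous_mx => i j.
have -> : (fun u : V => act a u i j) =
    (fun u : 'cV[R[i]^o]_d => (weight R U a i : R[i]^o) * u i 0).
  by apply/funext => u; rewrite mxE.
by apply: scale_continuous; exact: cV_coord_continuous.
Qed.

Lemma act_linear a : fiberwise_linear (act a).
Proof.
split=> [u w _|e u]; apply/colP => j; rewrite !mxE ?mulrDr //.
by rewrite mulrCA.
Qed.

Lemma hermitian_act a (u w : V) :
  hermitian (act a u) (act a w) = hermitian u w.
Proof.
apply: eq_bigr => j _; rewrite !mxE rmorphM /= mulrACA -normCK norm_weight.
by rewrite expr1n mul1r.
Qed.

Definition weight_orbibundle : simple_orbibundle actB d A :=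
  @Build_simple_orbibundle R n B actB d A V triv_act triv_act_action
    triv_act_proj triv_act_linear act act1 actM act_continuous
    (fun _ _ => erefl) act_linear (fun _ _ _ => erefl) (@hermitian R d)
    (hermitian_hermitian R d base_point)
    (fun _ _ _ _ => erefl) (fun a u w _ => hermitian_act a u w).

Local Notation xi := weight_orbibundle.
Local Notation Disc := (@disc R n B actB d A xi).
Local Notation Sphere := (@sphere R n B actB d A xi).
Local Notation C := (set_type (@params R d)).

Definition polar (w : C) : 'cV[R[i]^o]_d :=
  \col_k ((radius w * dir w 0 k)%:C%C * cexp (angle w 0 k)).

Lemma cabs_real (x : R) : 0 <= x -> cabs x%:C%C = x.
Proof.
by move=> x0; apply: complexI; rewrite cabsE normc_def /= expr0n addr0
  sqrtr_sqr ger0_norm.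
Qed.

Lemma cabs_cexp (x : R) : cabs (cexp x) = 1.
Proof. by apply: complexI; rewrite cabsE norm_cexp. Qed.

Lemma cabs_polar w k : cabs (polar w k 0) = radius w * dir w 0 k.
Proof.
by rewrite mxE cabsM cabs_cexp mulr1 cabs_real // mulr_ge0 ?radius_ge0 ?dir_ge0.
Qed.

Lemma hermitian_polar w : hermitian (polar w) (polar w) = (radius w ^+ 2)%:C%C.
Proof.
rewrite hermitianE; congr (_%:C)%C; under eq_bigr do rewrite cabs_polar exprMn.
by rewrite -mulr_sumr; have [_ _ -> _] := paramsP w; rewrite mulr1.
Qed.

Lemma polar_in w : Disc (polar w).
Proof.
rewrite /disc /= hermitian_polar lecR expr_le1 ?radius_le1 // ?radius_ge0 //.
Qed.

Lemma polar_sphere w : Sphere (polar w) <-> radius w = 1.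
Proof.
rewrite /sphere /= hermitian_polar; split=> [/complexI/eqP|->]; last first.
  by rewrite expr1n.
by rewrite sqrp_eq1 ?radius_ge0 // => /eqP.
Qed.

Definition disc_param (w : C) : set_type Disc :=
  exist _ (polar w : xi) (mem_set (polar_in w)).

Lemma polar_continuous : continuous polar.
Proof.
apply: continuous_mx => i j.
have -> : (fun w => polar w i j) = (fun w =>
    ((radius w * dir w 0 i)%:C%C : R[i]^o) * cexp (angle w 0 i)).
  by apply/funext => w; rewrite mxE.
move=> w; apply: (@cvgM R[i] _ (nbhs w)); last first.
  apply: (@continuous_comp C R R[i]^o (fun w => angle w 0 i) (@cexp R)).
    apply: (@continuous_comp C _ _ (@angle R d) (fun x : 'rV[R]_d => x 0 i)).
      exact: angle_continuous.
    exact: coord_continuous.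
  exact: cexp_continuous.
apply: (@continuous_ReIm R C (fun w => radius w * dir w 0 i) (fun=> 0));
  last exact: cst_continuous.
move=> {}w; apply: (@cvgM R _ (nbhs w)); first exact: radius_continuous.
apply: (@continuous_comp C _ _ (@dir R d) (fun x : 'rV[R]_d => x 0 i)).
  exact: dir_continuous.
exact: coord_continuous.
Qed.

Lemma disc_hausdorff : hausdorff_space (set_type Disc).
Proof.
apply: (@separating_hausdorff R) => u u' uu'.
have [k kP] : exists k, (set_val u : 'cV[R[i]^o]_d) k 0 <> (set_val u' :
  'cV[R[i]^o]_d) k 0.
  apply: contrapT => /forallNP h; apply: uu'; apply/val_inj/colP => k.
  by apply: contrapT; exact: h.
set z := (set_val u : 'cV[R[i]^o]_d) k 0 in kP.
exists (fun x => cabs ((set_val x : 'cV[R[i]^o]_d) k 0 - z)).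
  move=> x; apply: (@continuous_comp _ R[i]^o R
    (fun x => (set_val x : 'cV[R[i]^o]_d) k 0 - z) (@cabs R));
    last exact: cabs_continuous.
  apply: (@cvgB R[i] R[i]^o _ (nbhs x)); last exact: cvg_cst.
  apply: (@continuous_comp _ _ _ set_val (fun v : 'cV[R[i]^o]_d => v k 0)).
    exact: continuous_set_val.
  exact: cV_coord_continuous.
rewrite subrr => /esym e; apply: kP; apply/esym/eqP.
by rewrite -subr_eq0 -cabs_eq0 e; apply/eqP/cabs_real.
Qed.

Lemma polar_decomposition (z : R[i]) : exists t : R,
  0 <= t <= 1 /\ z = (cabs z)%:C%C * cexp t.
Proof.
have [z0|z0] := eqVneq z 0.
  exists 0; rewrite lexx ler01; split=> //.
  suff -> : cabs z = 0 by rewrite mul0r z0.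
  by apply/eqP; rewrite cabs_eq0 z0.
have az : (cabs z)%:C%C != 0 :> R[i] by rewrite cabsE normr_eq0.
have [|t tP] := @cexp_surj R (z / (cabs z)%:C%C).
  by rewrite normrM normfV -[X in _ / X]cabsE cabs_real ?cabs_ge0 // cabsE
    divff ?normr_eq0.
have [m mP] := floor_frac t.
exists (t - m%:~R); split=> //.
have -> : cexp (t - m%:~R) = cexp t.
  rewrite cexpD (_ : cexp (- _) = 1) ?mulr1 //.
  by apply/cexp_eq1; exists (- m); rewrite mulrNz.
by rewrite -tP mulrC divfK.
Qed.

Lemma disc_param_surj : (0 < d)%N -> forall u, exists w, disc_param w = u.
Proof.
move=> d0 u; pose z : 'cV[R[i]^o]_d := set_val u.
have zd : \sum_k cabs (z k 0) ^+ 2 <= 1.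
  by have : Disc z := set_valP u; rewrite /disc /= hermitianE lecR.
pose e : 'rV[R]_d := delta_mx 0 (Ordinal d0).
have e0 k : 0 <= e 0 k by rewrite mxE; case: eqP => // _; case: eqP.
have e1 : \sum_k e 0 k ^+ 2 = 1.
  rewrite (bigD1 (Ordinal d0)) //= big1 => [|k kj].
    by rewrite mxE !eqxx expr1n addr0.
  by rewrite mxE (negPf kj) andbF expr0n.
pose s := \sum_k cabs (z k 0) ^+ 2.
have s0 : 0 <= s by apply: sumr_ge0 => k _; exact: sqr_ge0.
pose r := Num.sqrt s.
have [t tP] := choice (fun k => polar_decomposition (z k 0)).
(* At the origin the direction is arbitrary, the radius being 0. *)
pose x : 'rV[R]_d := if s == 0 then e else \row_k (cabs (z k 0) / r).
have rx k : r * x 0 k = cabs (z k 0).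
  rewrite /x; case: eqVneq => [s00|sn0]; last first.
    by rewrite mxE mulrC divfK // sqrtr_eq0 -ltNge lt_neqAle eq_sym sn0.
  rewrite /r s00 sqrtr0 mul0r; move/eqP: s00; rewrite psumr_eq0; last first.
    by move=> j _; exact: sqr_ge0.
  move=> /allP/(_ k (mem_index_enum k)); rewrite /= sqrf_eq0 => /eqP ->.
  by [].
have [||||w [wth wx wr]] := @params_intro R d (\row_k t k) x r.
- by move=> j; rewrite mxE; have [] := tP j.
- rewrite /x => k; case: ifP => // _; rewrite mxE divr_ge0 ?cabs_ge0 //.
  exact: sqrtr_ge0.
- rewrite /x; case: eqVneq => // sn0.
  under eq_bigr do rewrite mxE expr_div_n.
  by rewrite -mulr_suml sqr_sqrtr // divff.
- rewrite sqrtr_ge0 /=; have -> : 1 = Num.sqrt 1 :> R by rewrite sqrtr1.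
  by rewrite ler_sqrt.
exists w; apply: val_inj; apply/colP => k /=.
rewrite mxE wth wx wr rx mxE; by have [_ <-] := tP k.
Qed.

Lemma compact_C : compact [set: C].
Proof. by apply: compact_set_type; exact: compact_params. Qed.

Lemma disc_param_quotient : (0 < d)%N -> quotient_map disc_param.
Proof.
move=> d0; apply: compact_hausdorff_quotient_map.
- exact: compact_C.
- exact: disc_hausdorff.
- by apply: continuous_to_set_type; exact: polar_continuous.
- exact: disc_param_surj.
Qed.

Definition orbit_pi (u : set_type Disc) : orbi_disc xi :=
  \pi_({eq_quot gorbit_equiv xi}) u.

Lemma orbit_piP u u' : orbit_pi u = orbit_pi u' <->
  exists a : A, act a (set_val u) = set_val u'.
Proof.
rewrite /orbit_pi; split=> [/eqmodP/asboolP //|h].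
exact/eqmodP/asboolP.
Qed.

Definition thom_param (w : C) : thom_space xi :=
  collapse_pi (@orbi_sphere R n B actB d A xi) (orbit_pi (disc_param w)).

Lemma thom_param_quotient : (0 < d)%N -> quotient_map thom_param.
Proof.
move=> d0; apply: (@quotient_map_comp _ _ _ (orbit_pi \o disc_param)).
  apply: quotient_map_comp; first exact: disc_param_quotient.
  exact: pi_quotient_map.
exact: collapse_pi_quotient.
Qed.

(** The action is unitary, so an orbit that meets the sphere lies in it. *)
Lemma orbi_sphereP w : @orbi_sphere R n B actB d A xi (orbit_pi (disc_param w))
  <->
  radius w = 1.
Proof.
rewrite -polar_sphere; split=> [[u us /orbit_piP[a aE]]|h]; last first.
  by exists (disc_param w).
have /= <- : act a (set_val u) = polar w by exact: aE.
by rewrite /sphere /= hermitian_act.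
Qed.

Lemma thom_paramP w w' : thom_param w = thom_param w' <->
  (exists a : A, weight_act U a (polar w) = polar w') \/
  (radius w = 1 /\ radius w' = 1).
Proof. by rewrite collapse_piP !orbi_sphereP orbit_piP. Qed.

End weight_orbibundle.

(** * Comparison *)

Section stratum_thom.
Variables (R : realType) (n : nat) (P : set 'rV[R]_n).
Variables (K K' : set (set 'rV[R]_n)) (v : 'rV[R]_n) (d : nat).
Variables (U : 'M[int]_(d, n)) (gauge : 'rV[R]_d -> R).
Local Notation Ur := (map_mx intr U : 'M[R]_(d, n)).
Hypothesis cc : conical_chart P K K' v Ur gauge.
Hypothesis KP : underlying K `<=` P.
Variables (L : 'M[int]_(d, n)) (c : nat).
Hypotheses (c1 : (1 < c)%N) (LU : L *m U^T = (c%:Z)%:M).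
Local Notation Lr := (map_mx intr L : 'M[R]_(d, n)).
Local Notation C := (set_type (@params R d)).
Implicit Types w : C.

Lemma dotp_int (z : 'rV[int]_n) k :
  dotp (map_mx intr z) (row k Ur) = ((z *m U^T) 0 k)%:~R.
Proof.
by rewrite dotp_edge map_trmx -map_mxM mxE.
Qed.

Lemma sum_dir_sqr w (t : R) : \sum_k (t * dir w 0 k) ^+ 2 = t ^+ 2.
Proof.
under eq_bigr do rewrite exprMn; rewrite -mulr_sumr.
by have [_ _ -> _] := paramsP w; rewrite mulr1.
Qed.

Lemma scaled_dir_inj w w' (t t' : R) : 0 <= t -> 0 <= t' ->
  (forall k, t * dir w 0 k = t' * dir w' 0 k) ->
  t = t' /\ (t = 0 \/ dir w = dir w').
Proof.
move=> t0 t'0 h; have tt' : t = t'.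
  apply/eqP; rewrite -(@eqrXn2 _ 2) // -(sum_dir_sqr w) -(sum_dir_sqr w').
  by apply/eqP/eq_bigr => k _; rewrite h.
split=> //; have [->|tn0] := eqVneq t 0; [by left|right].
by apply/rowP => k; apply: (mulfI tn0); rewrite h tt'.
Qed.

(** Both sides mean equal radii and, unless the radius is 0, equal directions: the rescaling factor
    depends on the direction alone. *)
Lemma chart_coordsP w w' :
  (forall k, radius w * dir w 0 k = radius w' * dir w' 0 k) <->
  chart_coords gauge w = chart_coords gauge w'.
Proof.
split=> [h|h].
  have [rr [r0|dd]] := scaled_dir_inj (radius_ge0 w) (radius_ge0 w') h.
    by rewrite /chart_coords -rr r0 !mul0r !scale0r.
  by rewrite /chart_coords -rr dd.
have rr : radius w = radius w'.
  by rewrite -(gauge_chart_coords cc) h (gauge_chart_coords cc).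
have g0 := gauge_dir cc w; have g'0 := gauge_dir cc w'.
have [||k|tt [t0|dd]] := @scaled_dir_inj w w'
    (radius w / gauge (dir w)) (radius w' / gauge (dir w')).
- by rewrite divr_ge0 ?radius_ge0 // ltW.
- by rewrite divr_ge0 ?radius_ge0 // ltW.
- by move/rowP/(_ k): h; rewrite !mxE.
- move: t0 => /eqP; rewrite mulf_eq0 invr_eq0 (gt_eqF g0) orbF => /eqP r0.
  by move=> k; rewrite -rr r0 !mul0r.
- by move=> k; rewrite rr dd.
Qed.

Lemma chart_point_inj w w' : chart_point v U gauge w = chart_point v U gauge w'
  ->
  chart_coords gauge w = chart_coords gauge w'.
Proof.
move=> /addrI h; apply/eqP; rewrite -subr_eq0; apply/eqP/(chart_free cc).
by rewrite mulmxBl h subrr.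
Qed.

(* The isotropy subtorus pulls back, along the cover [texp y |-> texp (y L)],
   to the product of a coordinate subtorus with the group of weights. *)
Lemma isotropy_weight (I : pred 'I_d) (th th' : 'rV[R]_d) :
  (exists z : 'rV[int]_n, forall k, I k ->
    dotp (th' *m Lr - th *m Lr + map_mx intr z) (row k Ur) = 0) <->
  exists a : 'rV['Z_c]_n, forall k, I k ->
    weight R U a k * cexp (th 0 k) = cexp (th' 0 k).
Proof.
have cn0 : c%:R != 0 :> R by rewrite gt_eqF // ltr0n ltnW.
have dE (z : 'rV[int]_n) k :
    dotp (th' *m Lr - th *m Lr + map_mx intr z) (row k Ur) =
    c%:R * (th' 0 k - th 0 k) + ((z *m U^T) 0 k)%:~R.
  by rewrite dotpDl dotpBl !(dotp_L LU) dotp_int mulrBr.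
split=> [[z hz]|[a ha]].
  (* The sign comes from [c (th'_k - th_k) = - z . u_k]. *)
  have [a [m am]] := lift_Zc_surj c1 (- z).
  exists a => k Ik; rewrite /weight am mulmxDl -scalemxAl mulNmx -cexpD.
  have := hz k Ik; rewrite dE; move: (z *m _) (m *m _) => zU mU h.
  rewrite !mxE intrD intrM -[(- _)%:~R]/((- zU 0 k)%:~R) mulrNz.
  have -> : (- (zU 0 k)%:~R + c%:~R * (mU 0 k)%:~R) / c%:R + th 0 k =
      th' 0 k + (mU 0 k)%:~R :> R.
    have -> : (zU 0 k)%:~R = - (c%:R * (th' 0 k - th 0 k)) :> R by lra.
    by field.
  rewrite cexpD (_ : cexp (mU 0 k)%:~R = 1) ?mulr1 //.
  by apply/cexp_eq1; exists (mU 0 k).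
have H k : exists mu : int, I k ->
    th' 0 k - th 0 k = ((lift_Zc a *m U^T) 0 k)%:~R / c%:R + mu%:~R.
  have [Ik|nIk] := boolP (I k); last by exists 0.
  have := ha k Ik; rewrite /weight; set x := _ / _; rewrite -cexpD => e.
  have [|mu muE] := (cexp_eq1 (th' 0 k - (x + th 0 k))).1.
    apply: (mulIf (cexp_neq0 (x + th 0 k))).
    by rewrite -cexpD subrK mul1r e.
  by exists mu => _; rewrite -muE; ring.
have [mu muP] := choice H.
(* The integral parts [mu k] of the angle differences become [c mu_k] after multiplication by [c],
   which is the product of [mu *m L] with the edge [k]. *)
exists (- lift_Zc a - (\row_k mu k) *m L) => k Ik.
rewrite dE muP // mulmxBl mulNmx -mulmxA LU mul_mx_scalar.
move: (lift_Zc a *m _) => x; rewrite !mxE intrB intrM mulrNz mulrDr.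
by rewrite mulrCA mulfV // mulr1 pmulrn; ring.
Qed.

Lemma chart_coords_gt0 w k :
  (0 < chart_coords gauge w 0 k) = (radius w * dir w 0 k != 0).
Proof.
rewrite lt_neqAle (chart_coords_ge0 cc) andbT eq_sym mxE mulrAC mulf_eq0.
by rewrite invr_eq0 (gt_eqF (gauge_dir cc w)) orbF.
Qed.

Lemma chart_coords_radius w w' :
  chart_coords gauge w = chart_coords gauge w' -> radius w = radius w'.
Proof.
by move=> e; rewrite -(gauge_chart_coords cc) e (gauge_chart_coords cc).
Qed.

(** The coordinates equal to 0 impose nothing on either side: the isotropy condition concerns
    positive chart coordinates only, and both polar coordinates vanish there. *)
Lemma isotropy_param w w' : radius w < 1 ->
  (forall k, radius w * dir w 0 k = radius w' * dir w' 0 k) ->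
  isotropy P (chart_point v U gauge w)
    (tmul (tinv (texp (angle w *m Lr))) (texp (angle w' *m Lr))) <->
  exists a : 'rV['Z_c]_n, weight_act U a (polar w) = polar w'.
Proof.
move=> r1 h; have gy : gauge (chart_coords gauge w) < 1.
  by rewrite (gauge_chart_coords cc).
rewrite -texpN -texpD [- _ + _]addrC.
rewrite (isotropyE cc _ (chart_coords_ge0 cc w) gy).
rewrite (isotropy_weight (fun k => 0 < chart_coords gauge w 0 k)).
split=> -[a aP]; exists a.
  apply/colP => k; rewrite !mxE -h; have [r0|rn0] := eqVneq (radius w * dir w 0
    k) 0.
    by rewrite r0 rmorph0 !mul0r mulr0.
  by rewrite mulrCA aP // chart_coords_gt0.
move=> k; rewrite chart_coords_gt0 => rn0; move/colP/(_ k): aP.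
by rewrite !mxE -h mulrCA => /mulfI; apply; rewrite (inj_eq (@complexI _) _ 0).
Qed.

Lemma polar_act_coords w w' (a : 'rV['Z_c]_n) :
  weight_act U a (polar w) = polar w' ->
  forall k, radius w * dir w 0 k = radius w' * dir w' 0 k.
Proof.
move=> /colP h k; rewrite -!cabs_polar -h [in RHS]mxE cabsM.
suff -> : cabs (weight R U a k) = 1 by rewrite mul1r.
by apply: complexI; rewrite cabsE norm_weight.
Qed.

(** The right-hand side is that of [thom_paramP], so the two quotient maps have the same fibers.
    When the radii are not both 1, equality of either kind makes them equal and less than 1, where
    [isotropy_param] applies. *)
Lemma toric_paramP w w' :
  toric_param cc KP L w = toric_param cc KP L w' <->
  (exists a : 'rV['Z_c]_n, weight_act U a (polar w) = polar w') \/
  (radius w = 1 /\ radius w' = 1).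
Proof.
have [rr|nrr] := pselect (radius w = 1 /\ radius w' = 1).
  split=> _; first by right.
  apply/collapse_piP; right; case: rr => r1 r'1.
  by split; apply/(toric_param_removed cc).
have lt1 : radius w = radius w' -> radius w < 1.
  move=> e; rewrite lt_neqAle radius_le1 andbT; apply/eqP => r1.
  by apply: nrr; rewrite -e.
split=> [/collapse_piP[e|[/(toric_param_removed cc) ? /(toric_param_removed cc)
  ?]]|].
- left; have /toric_classP[pp] := congr1 set_val e.
  have /chart_point_inj ee := congr1 set_val pp.
  by move/isotropy_param; apply;
    [exact/lt1/chart_coords_radius|exact/chart_coordsP].
- by right.
- case=> [ha|//]; have [a /polar_act_coords h] := ha.
  have ee := (chart_coordsP w w').1 h.
  apply/collapse_piP; left; apply: val_inj; apply/toric_classP; split.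
    by apply: val_inj; rewrite /= /chart_point ee.
  by apply/isotropy_param => //; exact/lt1/chart_coords_radius.
Qed.

Lemma stratum_homeomorphic (B : topologicalType) (b0 : B)
    (base_point : forall b : B, b = b0) (actB : torus R n -> B -> B) :
  (0 < d)%N ->
  homeomorphic (subquotient (@subspaceK R n P K) (@subspaceK' R n P K'))
    (thom_space (weight_orbibundle U c1 actB base_point)).
Proof.
move=> d0.
apply: (@quotient_maps_homeomorphic _ _ _ (toric_param cc KP L)
  (@thom_param R n d U c c1 B b0 actB base_point)).
- apply: compact_hausdorff_quotient_map.
  + exact: compact_C.
  + exact: (subquotient_hausdorff cc c1 LU).
  + exact: toric_param_continuous.
  + exact: (toric_param_surj cc KP c1 LU).
- exact: thom_param_quotient.
- by move=> w w'; rewrite toric_paramP thom_paramP.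
Qed.

End stratum_thom.

Theorem theorem3p6 (R : realType) (n : nat) (P : set 'rV[R]_n)
    (latticeP : lattice_polytope P) (dimP : has_dim P n)
    (simpleP : almost_simple P)
    (l : nat) (K : nat -> set (set 'rV[R]_n)) (Q : nat -> set 'rV[R]_n)
    (v : nat -> 'rV[R]_n) (seqP : retraction_sequence P l K Q v) :
  exists X : nat -> set (toric_variety P),
    [/\ torus_stratification l X,
        forall j, (1 <= j <= l)%N ->
          X j = @orbit_map R n P @^-1` underlying (K (l - j + 1)%N)
      & forall j, (2 <= j <= l)%N ->
          exists (k : nat) (A : finGroupType)
            (xi : simple_orbibundle
                    (@orbit_fiber_act R n P (v (l - j + 1)%N)) k A),
            abelian (finset.setT : {set A}) /\
            homeomorphic (subquotient (X j) (X (j - 1)%N)) (thom_space xi)].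
Proof.
have [N [a [b ab]]] := lattice_polytope_Hrep latticeP.
have subK := retraction_subcomplex latticeP seqP.
have corK := retraction_corner latticeP seqP.
have [_ [K1 _ _ _] KS _ _] := seqP.
exists (fun j => @orbit_map R n P @^-1` underlying (K (l - j + 1)%N)); split.
- split.
  + move=> j /andP[j1 jl].
    apply: preimage_closed; first by move=> x _; exact: orbit_map_continuous.
    have [|KP _] := subK (l - j + 1)%N; last exact: (closed_underlying ab).
    by rewrite addn1 ltnS leq0n /= ltn_subrL j1 (leq_trans j1 jl).
  + by move=> j t x _; rewrite /= orbit_map_act.
  + move=> j /andP[j1 jl] x [F KF Fx]; exists F => //.
    have e : (l - j + 1 = (l - j.+1 + 1).+1)%N by rewrite !addn1 subnSK.
    move: KF; rewrite e KS; first by case.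
    by lia.
  + apply/seteqP; split=> // x _; exists P; last first.
      by have [t [p ->]] := toric_class_surj x; rewrite orbit_mapE;
        exact: set_valP.
    rewrite subnn add0n K1; split.
      by have [t [p _]] := toric_class_surj x; exists (set_val p);
        exact: set_valP.
    exists 0, 0; split=> [y _|]; first by rewrite dotpC dotp0r.
    by apply/seteqP; split=> [y Py|y []] //; split=> //=; rewrite dotpC dotp0r.
- by [].
- move=> j /andP[j2 jl]; set m := (l - j + 1)%N.
  (* The filtration runs backwards along the retraction: [X j] lies over [K m] and [X (j - 1)] over
     [K m.+1], obtained from [K m] by removing [v m]. The bound [2 <= j] gives [m < l], so [v m] has
     a corner neighborhood of positive dimension. *)
  have ml : (1 <= m < l)%N by rewrite /m; lia.
  have eS : (l - (j - 1) + 1 = m.+1)%N by rewrite /m; lia.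
  have [Kv [d d0 cK]] := corK m ml.
  have sK : subcomplex P (K m).
    by apply: subK; case/andP: ml => -> /ltnW.
  have [U [gauge cc]] := exists_conical_chart latticeP dimP sK Kv cK.
  have KP : underlying (K m) `<=` P.
    by move=> x [F /sK.1/face_sub FP Fx]; exact: FP.
  have [L [c [c1 LU]]] := dual_lattice_basis (chart_free cc).
  have gv : gauge 0 < 1 by rewrite (gauge0 cc) ltr01.
  have pos0 : forall k, 0 <= (0 : 'rV[R]_d) 0 k by move=> k; rewrite mxE.
  have Pv : P (v m).
    by apply: KP; exists [set v m].
  pose p0 : set_type P := exist _ (v m) (mem_set Pv).
  have b0P : (@orbit_map R n P @^-1` [set v m]) (toric_class (tone R n) p0).
    by rewrite /= orbit_mapE.
  pose b0 : orbit_fiber P (v m) := exist _ (toric_class (tone R n) p0) (mem_set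
    b0P).
  have base_point (x : orbit_fiber P (v m)) : x = b0.
    apply: val_inj; have : (@orbit_map R n P @^-1` [set v m]) (set_val x) :=
      set_valP x.
    rewrite -[RHS]/(toric_class (tone R n) p0) -[LHS]/(set_val x).
    have [t [p ->]] := toric_class_surj (set_val x).
    rewrite /= orbit_mapE => pv; apply/toric_classP; split;
      first exact: val_inj.
    have [y <-] := texp_surj (tmul (tinv t) (tone R n)).
    (* The vertex is the origin of its chart, where no coordinate is positive; the condition of
       [isotropyE] is then empty and the isotropy group is the whole torus. *)
    have := isotropyE cc y pos0 gv; rewrite mul0mx addr0 pv => ->.
    by exists 0 => k; rewrite mxE ltxx.
  exists d, 'rV['Z_c]_n, (weight_orbibundle U c1 _ base_point).
  split; first by apply/centsP => x _ y _; exact: FinRing.zmod_mulgC.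
  rewrite eS KS //.
  exact: (stratum_homeomorphic cc KP c1 LU base_point _ d0).
Qed.
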